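(* Let $C\in\mathcal{H}_{10,11}$ be a general curve and $X=\mathrm{Bl}_C\mathbb{P}^3$. The divisor class $40H-11E$ is effective and rigid. This class spans an extremal ray of the effective cone of $X$; in other words, $\mathrm{Eff}(X)=[40H-11E,E]$.
   Context: The base field is algebraically closed of characteristic $0$. $\mathcal{H}_{10,11}$ is the unique irreducible component of the Hilbert scheme of curves of degree $10$ and genus $11$ in $\mathbb{P}^3$ whose general element is a smooth irreducible arithmetically Cohen-Macaulay curve. $N^1(X)=\langle H,E\rangle$, with $H$ the pullback of the hyperplane class of $\mathbb{P}^3$ and $E$ the exceptional divisor. $[A,B]$ denotes the cone of classes $aA+bB$ with $a,b\ge0$. An effective class $D$ is rigid if $h^0(X,mD)=1$ for all $m\ge1$. *)

(* Defs.v *)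
From HB Require Import structures.
From mathcomp Require Import all_boot all_order all_algebra.
From mathcomp Require Import mpoly.

Set Implicit Arguments.
Unset Strict Implicit.
Unset Printing Implicit Defensive.

Import Order.TTheory GRing.Theory Num.Theory.
Local Open Scope ring_scope.

(* A closed subscheme of P^3 over k is given by its saturated homogeneous
   ideal in k[x_0, .., x_3]. *)
Notation coord_ring k := {mpoly k[4]}.
Notation ideal k := ({mpoly k[4]} -> Prop).

Definition basis_modulo (k : fieldType) (V : lmodType k) (A B : V -> Prop)
    (n : nat) (e : 'I_n -> V) : Prop :=
  (forall i, A (e i)) /\
  forall v, A v -> exists! c : 'rV[k]_n, B (v - \sum_i c 0 i *: e i).

Section Ideals.
Context {k : fieldType}.
Implicit Types (I : ideal k) (p q f : coord_ring k).

Definition is_ideal I : Prop :=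
  [/\ I 0, forall p q, I p -> I q -> I (p + q) & forall p q, I q -> I (p * q)].

Definition homogeneous I : Prop :=
  forall p d, I p -> I (pihomog mdeg d p).

Definition saturated I : Prop :=
  forall p, (forall i : 'I_4, exists n, I ('X_i ^+ n * p)) -> I p.

Definition prime_ideal I : Prop :=
  ~ I 1 /\ forall p q, I (p * q) -> I p \/ I q.

Fixpoint ideal_pow I (n : nat) : ideal k :=
  if n is n'.+1 then
    fun p => exists r (a b : 'I_r -> coord_ring k),
      [/\ forall i, I (a i), forall i, ideal_pow I n' (b i)
        & p = \sum_i a i * b i]
  else fun=> True.

Definition forms (t : nat) p : Prop := p \is t.-homog.

Definition hilbert_function I (t r : nat) : Prop :=
  exists e : 'I_r -> coord_ring k, basis_modulo (forms t) I e.

End Ideals.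

Section HilbertScheme.
Context {k : fieldType}.
Implicit Types (I : ideal k) (Z U H : ideal k -> Prop).

(* Closed points of the Hilbert scheme of degree d, genus g curves: the
   Hilbert polynomial is d t + 1 - g (subtraction of naturals is harmless for
   t large when d > 0). *)
Definition Hilb (d g : nat) I : Prop :=
  [/\ is_ideal I, homogeneous I, saturated I
    & exists t0, forall t, (t0 <= t)%N -> hilbert_function I t (d * t + 1 - g)].

(* Gotzmann number of the polynomial d t + 1 - g.  In this degree t every
   point I of Hilb d g satisfies dim (S/I)_t = d t + 1 - g, and I |-> I_t
   is a closed embedding of the Hilbert scheme in a Grassmannian of S_t. *)
Definition gotzmann (d g : nat) : nat := ('C(d, 2) + 1 - g)%N.

Definition grass_rank (d g : nat) : nat :=
  let t := gotzmann d g in ('C(t + 3, 3) - (d * t + 1 - g))%N.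

(* A basis of I_t, i.e. a point over I_t of the Stiefel variety of frames. *)
Definition frame I (t N : nat) (e : 'I_N -> coord_ring k) : Prop :=
  basis_modulo (fun p => forms t p /\ I p) (eq^~ 0) e.

Definition frame_index (t N : nat) : finType := ('I_N * 'X_{1..4 < t.+1})%type.

Definition frame_coords (t N : nat) (e : 'I_N -> coord_ring k)
    (j : 'I_#|frame_index t N|) : k :=
  let im := enum_val j in (e im.1)@_(bmnm im.2).

(* Zariski topology on Hilb d g, induced from the Grassmannian.  The map from
   frames to the Grassmannian is open and surjective, so a set is closed iff
   its preimage is cut out by polynomials in the entries of the frame. *)
Definition hilb_closed (d g : nat) Z : Prop :=
  let t := gotzmann d g in
  let N := grass_rank d g in
  exists F : {mpoly k[#|frame_index t N|]} -> Prop,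
  forall I (e : 'I_N -> coord_ring k), Hilb d g I -> frame I t e ->
    (Z I <-> forall f, F f -> f.@[frame_coords e] = 0).

Definition hilb_irreducible (d g : nat) H : Prop :=
  [/\ forall I, H I -> Hilb d g I,
      exists I, H I
    & forall Z1 Z2, hilb_closed d g Z1 -> hilb_closed d g Z2 ->
        (forall I, H I -> Z1 I \/ Z2 I) ->
        (forall I, H I -> Z1 I) \/ (forall I, H I -> Z2 I)].

Definition hilb_component (d g : nat) H : Prop :=
  hilb_irreducible d g H /\
  forall H', hilb_irreducible d g H' -> (forall I, H I -> H' I) ->
    forall I, H' I -> H I.

(* P holds on a nonempty open subset of H. *)
Definition general_in (d g : nat) H (P : ideal k -> Prop) : Prop :=
  exists Z, [/\ hilb_closed d g Z, exists I, H I /\ ~ Z I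
              & forall I, H I -> ~ Z I -> P I].

End HilbertScheme.

Section Curves.
Context {k : fieldType}.
Implicit Types (I : ideal k).

(* Jacobian criterion for a curve in P^3: the gradients of the equations
   span a space of dimension 2, the codimension, at each point. *)
Definition smooth_curve I : Prop :=
  forall x : 'I_4 -> k, (exists i, x i != 0) -> (forall f, I f -> f.@[x] = 0) ->
    exists f : 'I_2 -> coord_ring k, (forall i, I (f i)) /\
      \rank (\matrix_(i < 2, j < 4) ((f i)^`M(j)).@[x]) = 2%N.

Definition nonzerodivisor_mod I (l : coord_ring k) : Prop :=
  forall p, I (l * p) -> I p.

Definition add_principal I (l : coord_ring k) : ideal k :=
  fun p => exists q, I (p - l * q).

(* For a curve the homogeneous coordinate ring S/I has dimension 2: it is
   Cohen-Macaulay iff the irrelevant ideal contains a homogeneous regular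
   sequence of length 2. *)
Definition arith_CM_curve I : Prop :=
  exists l1 l2 d1 d2,
    [/\ forms d1.+1 l1, forms d2.+1 l2,
        nonzerodivisor_mod I l1 & nonzerodivisor_mod (add_principal I l1) l2].

Definition smooth_irreducible_ACM I : Prop :=
  [/\ prime_ideal I, smooth_curve I & arith_CM_curve I].

End Curves.

(* N^1(X) = Z H + Z E, as row vectors of coordinates in the basis (H, E). *)
Notation divisor_class := 'rV[int]_2.
Definition clH : divisor_class := delta_mx 0 0.
Definition clE : divisor_class := delta_mx 0 1.

Section BlowUp.
Context {k : fieldType}.
Implicit Types (C : ideal k) (D : divisor_class).

(* H^0(X, O_X(aH + bE)) for X = Proj (S + I + I^2 + ..) the blow-up of P^3
   along C, where I is the ideal of C, O_X(H) is the pullback of O(1) and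
   O_X(-E) = I.O_X.  X is covered by the charts where x_i <> 0 and f generates
   I.O_X, for f in I homogeneous.  On such a chart, the sections of
   O_X(aH + bE) are the homogeneous fractions G / (x_i^m f^n) of degree a with
   G in I^(n - b); a global section is an element of the fraction field which
   is of this form on every chart. *)
Definition global_section C D (phi : {fraction coord_ring k}) : Prop :=
  forall (i : 'I_4) (f : coord_ring k) (e : nat),
    C f -> forms e f -> f != 0 ->
    exists (m n j t : nat) (G : coord_ring k),
      [/\ (j%:Z = n%:Z - D 0 1)%R,
          (t%:Z = D 0 0 + m%:Z + (n * e)%:Z)%R,
          ideal_pow C j G,
          forms t G
        & phi = (tofrac G / tofrac ('X_i ^+ m * f ^+ n))%R].

Definition h0 C D (n : nat) : Prop :=
  exists s : 'I_n -> {fraction coord_ring k},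
    (forall i, global_section C D (s i)) /\
    forall phi, global_section C D phi ->
      exists! c : 'rV[k]_n, phi = \sum_i tofrac (c 0 i)%:MP * s i.

Definition effective C D : Prop :=
  exists phi, global_section C D phi /\ phi != 0.

Definition rigid C D : Prop :=
  effective C D /\ forall m : nat, (1 <= m)%N -> h0 C (D *+ m) 1.

Definition real_class (R : realFieldType) D : 'rV[R]_2 := map_mx intr D.

Definition Eff (R : realFieldType) C (v : 'rV[R]_2) : Prop :=
  exists n (D : 'I_n -> divisor_class) (c : 'I_n -> R),
    (forall i, effective C (D i) /\ 0 <= c i) /\
    v = \sum_i c i *: real_class R (D i).

End BlowUp.

Arguments real_class R D : clear implicits.
Arguments Eff {k} R C v.

Section Cones.
Context {R : realFieldType} {V : lmodType R}.

Definition cone2 (A B v : V) : Prop :=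
  exists a b : R, [/\ 0 <= a, 0 <= b & v = a *: A + b *: B].

Definition ray (A v : V) : Prop := exists a : R, 0 <= a /\ v = a *: A.

Definition spans_extremal_ray (K : V -> Prop) (A : V) : Prop :=
  [/\ A <> 0, K A
    & forall u v, K u -> K v -> ray A (u + v) -> ray A u /\ ray A v].

End Cones.

(* Main.v *)
From HB Require Import structures.
From mathcomp Require Import all_boot all_order all_algebra.
From mathcomp Require Import boolp.
From mathcomp Require Import fingroup perm mpoly ring lra zify.
Require Import Defs.

Set Implicit Arguments.
Unset Strict Implicit.
Unset Printing Implicit Defensive.

Import Order.TTheory GRing.Theory Num.Theory.
Local Open Scope ring_scope.

(** An arithmetically Cohen-Macaulay curve C of degree 10 and genus 11 has h-vector
    (1, 2, 3, 4).  Hence its ideal I is generated by the five maximal minors F_c of a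
    4 x 5 matrix N(x) of linear forms, that is, by the quartics attached to a tensor
    T_abc on k^4 x k^4 x k^5 ([curve_determinantal]).

    Contract T with y in k^5 instead, to a 4 x 4 matrix M(y) with M(y) x = N(x) y.  The
    vector F(x) spans the kernel of N(x), so M(F(x)) x = 0 and the adjugate of M(F(x))
    has rank one: its entries are x_a g_b(x), with g_b of degree 11.  The covector g(x)
    kills M(F(x)), which says that F(x) is in the kernel of the matrix N'(g(x)) of the
    tensor T' obtained by exchanging the first two factors.  So F'(g) = h F for a form h
    of degree 4 * 11 - 4 = 40.  The same construction from T' gives g', h' with
    g'(g(x)) = h^3 x and h'(g) = h^11: the map g is a Cremona transformation of P^3
    with inverse g' ([cremona_inverse], [cremona_h]).

    The entries of N'(x_i g) are in I^3, because those of M(F) are in I; its maximal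
    minors are x_i^4 h F_c and are in I^12.  Thus h is a section of 40 H - 11 E
    ([hform_pow], [section_h]).  Conversely a section of a H - b E is a form P of degree
    a for which h'^b divides P(g'), since g' carries F to h' F' ([section_dvd]).  The
    degrees, 11 a of P(g') and 40 of h', give 40 b <= 11 a; and if (a, b) = (40 m, 11 m),
    then P(g') is a constant multiple of h'^(11 m) = h(g')^m, whence P is a multiple of
    h^m by substituting g ([slope_bound], [rigid_bound]).  The cone and the rigidity
    follow ([good_conclusion]).  What the argument requires of T ([good]) is that none
    of the families F, F' and g' has a common factor and that F'(g) is not zero.

    It remains to see that the general curve of the component comes from such a T.
    The determinantal ideals are parametrised by an open set of the affine space of
    tensors, and the Hilbert-Burch theorem puts them in the Hilbert scheme; so they
    form an irreducible set, whose closure is the given component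
    ([det_locus_component]).  Each requirement on T is open in T and holds for one
    explicit tensor ([generic_good]).  An open condition on T becomes an open condition
    on the ideal because T is recovered polynomially from a basis of I in degree 35
    ([recover]). *)

(** * Homogeneous parts and factors *)

Section Forms.
Context {R : idomainType} {n : nat}.
Implicit Types (p q : {mpoly R[n]}).

Lemma pihomogMr p q i e : q \is e.-homog ->
  pihomog mdeg (i + e) (p * q) = pihomog mdeg i p * q.
Proof.
move=> hq; have [k hk] : exists k, (maxn (msize p) i.+1 <= k)%N by exists (maxn (msize p) i.+1).
have hp : (msize p <= k)%N by apply: leq_trans hk; rewrite leq_maxl.
have hi : (i < k)%N by apply: leq_trans hk; rewrite leq_maxr.
rewrite {1}(pihomog_partitionE hp) mulr_suml linear_sum /= (bigD1 (Ordinal hi)) //=.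
rewrite pihomog_dE ?big1 ?addr0 //; last by apply: dhomogM => //; apply: pihomogP.
move=> j; rewrite -val_eqE /= => ji; apply: (@pihomog_ne0 _ _ mdeg (j + e)%N).
  by rewrite eqn_add2r.
by apply: dhomogM => //; apply: pihomogP.
Qed.

Lemma pihomogMr_lt p q i e : q \is e.-homog -> (i < e)%N ->
  pihomog mdeg i (p * q) = 0.
Proof.
move=> hq ie; rewrite {1}(pihomog_partitionE (leqnn (msize p))) mulr_suml linear_sum /= big1 //.
move=> j _; apply: (@pihomog_ne0 _ _ mdeg (j + e)%N); first by rewrite gtn_eqF // ltn_addl.
by apply: dhomogM => //; apply: pihomogP.
Qed.

Lemma dhomog_factor p q d e : q != 0 -> q \is e.-homog ->
  p * q \is (d + e).-homog -> p \is d.-homog.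
Proof.
move=> q0 hq /pihomog_dE; rewrite pihomogMr // => /(mulIf q0) <-.
exact: pihomogP.
Qed.

Lemma dhomog_factor_lt p q d e : q != 0 -> q \is e.-homog ->
  p * q \is d.-homog -> (d < e)%N -> p = 0.
Proof.
move=> q0 hq hpq de; apply/(mulIf q0); rewrite mul0r -(pihomog_dE hpq).
exact: pihomogMr_lt hq de.
Qed.

Lemma dhomog_constP p : p \is 0.-homog -> exists c, p = c%:MP.
Proof.
move=> /dhomogP hp; exists p@_0%MM; apply/mpolyP=> m; rewrite mcoeffC.
have [->|m0] := eqVneq m 0%MM; first by rewrite mulr1.
rewrite mulr0; apply/memN_msupp_eq0/negP=> /hp /eqP.
by rewrite mdeg_eq0 (negPf m0).
Qed.

End Forms.

(** * Substitutions in forms *)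

Lemma mpoly_ring_ind (R : nzRingType) (n : nat) (P : {mpoly R[n]} -> Prop) :
  (forall c, P c%:MP) -> (forall i, P 'X_i) ->
  (forall p q, P p -> P q -> P (p + q)) -> (forall p q, P p -> P q -> P (p * q)) ->
  forall p, P p.
Proof.
move=> PC PX PD PM p; rewrite (mpolyE p); apply: (big_ind P) => [||m _].
- by rewrite -[0]mpolyC0.
- exact: PD.
rewrite -mul_mpolyC; apply: (PM) => //; rewrite mpolyXE_id.
apply: (big_ind P) => [||i _]; [by rewrite -mpolyC1 | exact: PM |].
have pX j : P ('X_i ^+ j).
  by elim: j => [|j IH]; [rewrite expr0 -mpolyC1 | rewrite exprS; apply: PM].
exact: pX.
Qed.

HB.lock Definition subst (k : comNzRingType) (q : 'I_4 -> {mpoly k[4]})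
  (p : {mpoly k[4]}) : {mpoly k[4]} := p \mPo [tuple q i | i < 4].

Section Substitution.
Context {k : comNzRingType}.
Implicit Types (p : {mpoly k[4]}) (q r : 'I_4 -> {mpoly k[4]}).

Lemma substE q p : subst q p = p \mPo [tuple q i | i < 4].
Proof. by rewrite subst.unlock. Qed.

Fact subst_is_zmod_morphism q : zmod_morphism (subst q).
Proof. by move=> p p'; rewrite !substE rmorphB. Qed.

Fact subst_is_monoid_morphism q : monoid_morphism (subst q).
Proof. by split=> [|p p']; rewrite !substE ?rmorph1 ?rmorphM. Qed.

HB.instance Definition _ q := GRing.isZmodMorphism.Build _ _ (subst q)
  (subst_is_zmod_morphism q).
HB.instance Definition _ q := GRing.isMonoidMorphism.Build _ _ (subst q)
  (subst_is_monoid_morphism q).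

Lemma substX q i : subst q 'X_i = q i.
Proof. by rewrite substE comp_mpolyXU -tnth_nth tnth_mktuple. Qed.

Lemma substC q c : subst q c%:MP = c%:MP.
Proof. by rewrite substE comp_mpolyC. Qed.

Lemma substZ q c p : subst q (c *: p) = c *: subst q p.
Proof. by rewrite !substE comp_mpolyZ. Qed.

Lemma subst_comp q r p : subst q (subst r p) = subst (fun i => subst q (r i)) p.
Proof.
elim/mpoly_ring_ind: p => [c|i|p p' hp hq|p p' hp hq].
- by rewrite !substC.
- by rewrite !substX.
- by rewrite !rmorphD /= hp hq.
- by rewrite !rmorphM /= hp hq.
Qed.

Lemma subst_eq q r p : q =1 r -> subst q p = subst r p.
Proof. by move=> /funext ->. Qed.

Lemma subst_id p : subst (fun i => 'X_i) p = p.
Proof. by rewrite substE comp_mpoly_id. Qed.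

Lemma substEX q p :
  subst q p = \sum_(m <- msupp p) p@_m *: \prod_(i < 4) q i ^+ m i.
Proof.
rewrite substE comp_mpolyEX; apply: eq_bigr => m _; congr (_ *: _).
by rewrite comp_mpolyX; apply: eq_bigr => i _; rewrite tnth_mktuple.
Qed.

Lemma dhomog_subst q p d e : (forall i, q i \is e.-homog) ->
  p \is d.-homog -> subst q p \is (d * e).-homog.
Proof.
move=> hq hp; rewrite substEX big_seq rpred_sum //= => m mp.
apply: dhomogZ; have /dhomogP/(_ m mp) /= <- := hp; rewrite mdegE.
rewrite big_distrl /=.
elim/big_rec2: _ => [|i y1 y2 _ h]; first exact: dhomog1.
by apply: dhomogM => //; rewrite mulnC; apply: dhomogMn.
Qed.

Lemma subst_scale q c p d : p \is d.-homog ->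
  subst (fun i => c * q i) p = c ^+ d * subst q p.
Proof.
move=> /dhomogP hp; rewrite !substEX mulr_sumr !big_seq; apply: eq_bigr => m mp.
rewrite -scalerAr; congr (_ *: _); rewrite -(hp m mp) /= mdegE.
under eq_bigr do rewrite exprMn.
rewrite big_split /=; congr (_ * _).
by elim/big_rec2: _ => [|i y1 y2 _ ->]; rewrite ?expr0 // exprD.
Qed.

End Substitution.

Section LinearSubstitution.
Context {k : idomainType}.
Implicit Types (p q : {mpoly k[4]}) (A B : 'M[k]_4).

Definition lsub A : {mpoly k[4]} -> {mpoly k[4]} :=
  subst (fun i => \sum_j A i j *: 'X_j).

HB.instance Definition _ A := GRing.RMorphism.copy (lsub A)
  (subst (fun i => \sum_j A i j *: 'X_j)).

Lemma lsubX A i : lsub A 'X_i = \sum_j A i j *: 'X_j.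
Proof. exact: substX. Qed.

Lemma lsubC A c : lsub A c%:MP = c%:MP.
Proof. exact: substC. Qed.

Lemma lsubZ A c p : lsub A (c *: p) = c *: lsub A p.
Proof. exact: substZ. Qed.

Lemma lsub_comp A B p : lsub A (lsub B p) = lsub (B *m A) p.
Proof.
elim/mpoly_ring_ind: p => [c|i|p q hp hq|p q hp hq].
- by rewrite !lsubC.
- rewrite !lsubX raddf_sum /=.
  under eq_bigr do rewrite lsubZ lsubX scaler_sumr.
  rewrite exchange_big /=; apply: eq_bigr => j _.
  by rewrite mxE scaler_suml; apply: eq_bigr => l _; rewrite scalerA.
- by rewrite !rmorphD /= hp hq.
- by rewrite !rmorphM /= hp hq.
Qed.

Lemma lsub1 p : lsub 1%:M p = p.
Proof.
elim/mpoly_ring_ind: p => [c|i|p q hp hq|p q hp hq].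
- by rewrite !lsubC.
- rewrite lsubX (bigD1 i) //= big1 ?addr0 ?mxE ?eqxx ?scale1r //.
  by move=> j /negPf ji; rewrite mxE eq_sym ji scale0r.
- by rewrite !rmorphD /= hp hq.
- by rewrite !rmorphM /= hp hq.
Qed.

Lemma dhomog_lsub A p d : p \is d.-homog -> lsub A p \is d.-homog.
Proof.
move=> hp; rewrite -[d]muln1; apply: dhomog_subst => // i.
by apply: rpred_sum => j _; apply: dhomogZ; rewrite dhomogX /= mdeg1.
Qed.

Lemma pihomog_lsub A p d : pihomog mdeg d (lsub A p) = lsub A (pihomog mdeg d p).
Proof.
have [K [hK hd]] : exists K, (msize p <= K)%N /\ (d < K)%N.
  by exists (maxn (msize p) d.+1); rewrite leq_maxl leq_maxr.
rewrite {1}(pihomog_partitionE hK) (raddf_sum (lsub A)) (raddf_sum (pihomog mdeg d)) /=.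
rewrite (bigD1 (Ordinal hd)) //=.
rewrite pihomog_dE; last by apply: dhomog_lsub; apply: pihomogP.
rewrite big1 ?addr0 // => j; rewrite -val_eqE /= => jd.
apply: (pihomog_ne0 jd). by apply: dhomog_lsub; apply: pihomogP.
Qed.

(** Projectors that set one variable to zero; with them restriction to a coordinate
    subspace is a substitution in the same ring. *)
Definition kill (i : 'I_4) : 'M[k]_4 := 1%:M - delta_mx i i.

Lemma lsub_killX i j : lsub (kill i) 'X_j = if j == i then 0 else 'X_j.
Proof.
rewrite lsubX; have [->|ji] := eqVneq j i.
  by rewrite big1 // => l _; rewrite !mxE eqxx /= [l == i]eq_sym subrr scale0r.
rewrite (bigD1 j) //= big1 ?addr0 ?mxE ?eqxx ?(negPf ji) ?subr0 ?scale1r //.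
by move=> l lj; rewrite !mxE (negPf ji) /= subr0 eq_sym (negPf lj) scale0r.
Qed.

Lemma kill_mod i p : exists q, p = lsub (kill i) p + 'X_i * q.
Proof.
elim/mpoly_ring_ind: p => [c|j|p q [p' hp] [q' hq]|p q [p' hp] [q' hq]].
- by exists 0; rewrite lsubC mulr0 addr0.
- rewrite lsub_killX; have [->|ji] := eqVneq j i; first by exists 1; rewrite mulr1 add0r.
  by exists 0; rewrite mulr0 addr0.
- by exists (p' + q'); rewrite {1}hp {1}hq rmorphD /=; ring.
- exists (p' * lsub (kill i) q + lsub (kill i) p * q' + 'X_i * p' * q').
  by rewrite {1}hp {1}hq rmorphM /=; ring.
Qed.

Lemma kill_eq0 i p : lsub (kill i) p = 0 -> exists q, p = 'X_i * q.
Proof. by have [q e] := kill_mod i p => h; exists q; rewrite {1}e h add0r. Qed.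

Lemma kill_homog i p d : p \is d.+1.-homog -> lsub (kill i) p = 0 ->
  exists2 q, q \is d.-homog & p = 'X_i * q.
Proof.
move=> hp /kill_eq0 [q e]; exists q => //.
apply: (@dhomog_factor _ _ q 'X_i d 1); first by rewrite -msize_poly_eq0 msizeX.
  by rewrite dhomogX /= mdeg1.
by rewrite mulrC -e addn1.
Qed.

Lemma kill_homog0 i p : p \is 0.-homog -> lsub (kill i) p = 0 -> p = 0.
Proof. by move=> /dhomog_constP [c ->]; rewrite lsubC. Qed.

Lemma mpolyX_neq0 i : ('X_i : {mpoly k[4]}) != 0.
Proof. by rewrite -msize_poly_eq0 msizeX. Qed.

End LinearSubstitution.

Notation i0 := (0 : 'I_4).
Notation i1 := (1 : 'I_4).
Notation i2 := (2%:R : 'I_4).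
Notation i3 := (3%:R : 'I_4).

Section RegularPair.
Context {k : fieldType}.
Implicit Types (p q : {mpoly k[4]}) (A B : 'M[k]_4).

(** Regularity of the sequence (f, g) on the coordinate subspace cut out by the
    projector s. *)
Definition reg_pair (s : 'M[k]_4) (f g : {mpoly k[4]}) : Prop :=
  forall p q, lsub s q * lsub s f = lsub s p * lsub s g ->
    exists r, lsub s p = lsub s r * lsub s f.

(** A pair that is regular modulo x_i is regular: a relation q f = p g becomes, after
    subtracting a multiple of (f, g), divisible by x_i, and the quotient has smaller
    degree. *)
Lemma reg_pair_lift (s : 'M[k]_4) i f g t :
  s *m s = s -> s *m kill i = kill i *m s -> lsub s 'X_i = 'X_i ->
  f \is t.-homog -> g \is t.-homog -> lsub (s *m kill i) f != 0 ->
  reg_pair (s *m kill i) f g -> reg_pair s f g.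
Proof.
move=> ss sk sX hf hg f0 reg.
have sub p : lsub s (lsub s p) = lsub s p by rewrite lsub_comp ss.
have [hsf hsg] := (dhomog_lsub s hf, dhomog_lsub s hg).
have step d p q : p \is d.-homog -> q \is d.-homog -> lsub s p = p ->
    lsub s q = q -> q * lsub s f = p * lsub s g ->
      exists r p' q', [/\ p' = p - r * lsub s f, q' = q - r * lsub s g,
       [/\ p' \is d.-homog, q' \is d.-homog, lsub s p' = p' & lsub s q' = q'],
         q' * lsub s f = p' * lsub s g & lsub (kill i) p' = 0 /\ lsub (kill i) q' = 0].
    move=> hp hq sp sq e.
    have kE u : lsub (s *m kill i) u = lsub (kill i) (lsub s u) by rewrite lsub_comp.
    have /reg [r hr] : lsub (s *m kill i) q * lsub (s *m kill i) f
                     = lsub (s *m kill i) p * lsub (s *m kill i) g.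
      by rewrite !kE sp sq -!rmorphM /= e.
    pose r' := lsub (s *m kill i) r; exists r'.
    have sr : lsub s r' = r' by rewrite /r' lsub_comp -mulmxA -sk mulmxA ss.
    have kr : lsub (kill i) r' = r'.
      rewrite /r' lsub_comp -mulmxA; congr (lsub (_ *m _) _).
      rewrite /kill mulmxBr mulmx1 mulmxBl mul1mx mul_delta_mx.
      by rewrite subrr subr0.
    have e1 : lsub (kill i) q = r' * lsub (s *m kill i) g.
      apply: (mulIf f0); rewrite mulrAC -hr kE -rmorphM /= e rmorphM /= !kE sp.
      by rewrite mulrC.
    have hr' : r' * lsub s f \is d.-homog /\ r' * lsub s g \is d.-homog.
      have hkf : lsub (s *m kill i) f \is t.-homog by apply: dhomog_lsub.
      have hkp : r' * lsub (s *m kill i) f \is d.-homog.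
        by rewrite -hr; apply: dhomog_lsub.
      have [td|dt] := leqP t d; last first.
        by rewrite (dhomog_factor_lt f0 hkf hkp dt) !mul0r dhomog0.
      rewrite -(subnK td); split; apply: dhomogM => //;
      by apply: (dhomog_factor f0 hkf); rewrite subnK.
    exists (p - r' * lsub s f), (q - r' * lsub s g); split => //.
    - by rewrite !rmorphB !rmorphM /= !sub sp sq sr !rpredB //; case: hr'.
    - by rewrite !mulrBl e; ring.
    - rewrite !rmorphB !rmorphM /= kr e1 -!kE.
      by rewrite subrr -{1}sp -[lsub _ (lsub _ _)]kE hr subrr.
have base d : forall p q, p \is d.-homog -> q \is d.-homog -> lsub s p = p ->
    lsub s q = q -> q * lsub s f = p * lsub s g -> exists r, p = r * lsub s f.
  (* Dividing p' and q' by x_i lowers the degree d. *)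
  elim: d => [|d IH] p q hp hq sp sq e.
    have [r [p' [q' [ep _ [hp' _ _ _] _ [k0 _]]]]] := step _ p q hp hq sp sq e.
    exists r; apply/eqP; rewrite -subr_eq0 -ep; apply/eqP.
    exact: kill_homog0 k0.
  have [r [p' [q' [ep _ [hp' hq' sp' sq'] e' [k0 k0']]]]] := step _ p q hp hq sp sq e.
  have [p1 hp1 ep1] := kill_homog hp' k0; have [q1 hq1 eq1] := kill_homog hq' k0'.
  have [|||r1 er1] := IH p1 q1 hp1 hq1.
  - apply: (mulfI (mpolyX_neq0 i)); by rewrite -ep1 -[RHS]sp' ep1 rmorphM /= sX.
  - apply: (mulfI (mpolyX_neq0 i)); by rewrite -eq1 -[RHS]sq' eq1 rmorphM /= sX.
  - by apply: (mulfI (mpolyX_neq0 i)); rewrite !mulrA -ep1 -eq1.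
  exists (r + 'X_i * r1); rewrite mulrDl -mulrA -er1 -ep1 ep; ring.
move=> p q e.
pose K := msize (lsub s p).
suff /choice [r hr] : forall d, exists r, pihomog mdeg d (lsub s p) = r * lsub s f.
  exists (\sum_(d < K) r d); rewrite raddf_sum mulr_suml /=.
  rewrite {1}(pihomog_partitionE (leqnn K)); apply: eq_bigr => d _.
  by rewrite -{1}[lsub s f]sub -rmorphM /= -hr pihomog_lsub sub -pihomog_lsub.
move=> d; apply: (base d _ (pihomog mdeg d (lsub s q))); rewrite ?pihomogP //.
- by rewrite -pihomog_lsub sub.
- by rewrite -pihomog_lsub sub.
- by rewrite -!(@pihomogMr _ _ _ _ _ t) // e.
Qed.

End RegularPair.

(** * Families of forms without common factor *)

Section Primitive.
Context {k : fieldType}.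
Local Notation S := {mpoly k[4]}.

(** The family F generates an ideal of grade at least two: a vector proportional to F is
    a polynomial multiple of F.  For forms over a field this says that the F i have no
    common factor. *)
Definition primitive (I : finType) (F : I -> S) : Prop :=
  forall p : I -> S, (forall i j, p i * F j = p j * F i) ->
    exists h, forall i, p i = h * F i.

Definition mdvd (d p : S) : Prop := exists q, p = q * d.

Lemma mdvd_mulr d p q : mdvd d p -> mdvd d (p * q).
Proof. by case=> r ->; exists (r * q); rewrite mulrAC. Qed.

Lemma primitive_neq0 (I : finType) (F : I -> S) (i : I) :
  primitive F -> exists j, F j != 0.
Proof.
move=> pF; apply: contrapT => h.
have F0 j : F j = 0 by apply/eqP/negP => /negP Fj; apply: h; exists j.
have [|c /(_ i)] := pF (fun=> 1) _; first by move=> a b; rewrite !F0.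
by move/eqP; rewrite F0 mulr0 oner_eq0.
Qed.

(** The ideal (d : p) contains a power of each F i; since d is regular modulo F, these
    powers can be removed one at a time. *)
Lemma primitive_dvd (I : finType) (F : I -> S) (i : I) (d p : S) :
  primitive F -> d != 0 -> (forall i, exists m, mdvd d (p * F i ^+ m)) -> mdvd d p.
Proof.
move=> pF d0 /choice [m hm].
have [N] := ubnP (\sum_i m i)%N; elim: N => // N IH in p m hm *; rewrite ltnS => hN.
have H j : mdvd d (p * F j).
  have [mj|mj] := posnP (m j).
    by apply: mdvd_mulr; have := hm j; rewrite mj expr0 mulr1.
  apply: (IH _ (fun l => if l == j then (m j).-1 else m l)).
    move=> l; case: eqP => [->|_]; last by rewrite mulrAC; apply: mdvd_mulr.
    by rewrite -mulrA -exprS prednK.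
  apply: leq_trans hN; rewrite [X in (_ < X)%N](bigD1 j) //= (bigD1 j) //= eqxx.
  rewrite (eq_bigr m) ?ltn_add2r ?prednK // => l /negPf ->.
  by [].
have {H}/choice [a ha] := H.
have [|h hh] := pF a.
  by move=> u v; apply: (mulIf d0); rewrite mulrAC -ha (mulrAC (a v)) -ha mulrAC.
have [j Fj] := primitive_neq0 i pF.
by exists h; apply: (mulIf Fj); rewrite ha hh mulrAC.
Qed.

Lemma primitive_lsub (I : finType) (F : I -> S) (A : 'M[k]_4) : A \in unitmx ->
  primitive (fun i => lsub A (F i)) -> primitive F.
Proof.
move=> uA pF p hp; have [|h hh] := pF (fun i => lsub A (p i)).
  by move=> i j; rewrite -!rmorphM /= hp.
exists (lsub (invmx A) h) => i.
rewrite -[p i]lsub1 -[in RHS](lsub1 (F i)) -(mulmxV uA) -!lsub_comp hh.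
by rewrite rmorphM.
Qed.

(** The projector onto the line x_2 = x_3 = 0. *)
Definition line : 'M[k]_4 := kill i2 *m kill i3.

(** No common zero on the line: all binary forms of some degree are restrictions of
    elements of the ideal.  This is the certificate of grade two used throughout, because
    it is linear algebra in a fixed degree and hence an open condition. *)
Definition line_free (I : finType) (d : nat) (F : I -> S) : Prop :=
  exists (s : nat) (a b : I -> S),
    [/\ forall i, a i \is s.-homog, forall i, b i \is s.-homog,
        lsub line (\sum_i a i * F i) = 'X_i0 ^+ (s + d)
      & lsub line (\sum_i b i * F i) = 'X_i1 ^+ (s + d)].

Lemma kill_idem i : kill i *m kill i = kill i :> 'M[k]_4.
Proof.
by rewrite /kill mulmxBr mulmx1 mulmxBl mul1mx mul_delta_mx subrr subr0.
Qed.

Lemma killC i j : kill i *m kill j = kill j *m kill i :> 'M[k]_4.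
Proof.
have [->//|ij] := eqVneq i j.
rewrite /kill !mulmxBr !mulmxBl !mulmx1 !mul1mx !mul_delta_mx_cond.
by rewrite (negPf ij) eq_sym (negPf ij) !mulr0n !subr0 addrAC.
Qed.

Lemma lineX i : lsub line 'X_i = if (i == i2) || (i == i3) then 0 else 'X_i.
Proof.
rewrite -lsub_comp lsub_killX; have [->|ne] := eqVneq i i2; first by rewrite rmorph0.
exact: lsub_killX.
Qed.

Lemma line_idem p : lsub line (lsub line p) = lsub line p.
Proof.
rewrite lsub_comp /line {1}(killC i2) mulmxA -(mulmxA (kill i3)) kill_idem.
by rewrite killC -mulmxA kill_idem.
Qed.

Lemma reg_pair_line t s f g : lsub line f = 'X_i0 ^+ t -> lsub line g = 'X_i1 ^+ s ->
  reg_pair line f g.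
Proof.
move=> ef eg p q; rewrite ef eg.
suff H (u v : S) : v * 'X_i0 ^+ t = u * 'X_i1 ^+ s -> exists r, u = r * 'X_i0 ^+ t.
  move=> /H [r hr]; exists r; rewrite -line_idem hr rmorphM rmorphXn /=.
  by rewrite lineX.
elim: t u {ef} => [|t IH] u in v *; first by exists u; rewrite mulr1.
rewrite exprS => e.
have [|w hw] := @kill_eq0 _ i0 u.
  apply: (@mulIf _ ('X_i1 ^+ s)); first by rewrite expf_neq0 ?mpolyX_neq0.
  have /(congr1 (lsub (kill i0))) := e.
  by rewrite !rmorphM !rmorphXn /= !lsub_killX /= mul0r !mulr0 mul0r => <-.
have [|r hr] := IH w v.
  by apply: (mulfI (mpolyX_neq0 i0)); rewrite mulrCA e hw mulrA.
by exists r; rewrite hw hr mulrCA.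
Qed.

(** Two members of the ideal restrict to x_0^t and x_1^t on the line, where they form a
    regular sequence; lifting from the line to the plane x_2 = 0 and to the whole space
    shows that they are a regular sequence. *)
Lemma line_free_primitive (I : finType) d (F : I -> S) :
  (forall i, F i \is d.-homog) -> line_free d F -> primitive F.
Proof.
move=> hF [s [a [b [ha hb ea eb]]]].
pose f := \sum_i a i * F i; pose g := \sum_i b i * F i.
have hf : f \is (s + d).-homog by apply: rpred_sum => i _; apply: dhomogM.
have hg : g \is (s + d).-homog by apply: rpred_sum => i _; apply: dhomogM.
have f0 : lsub line f != 0 by rewrite ea expf_neq0 ?mpolyX_neq0.
have f0' : lsub (kill i2) f != 0.
  apply: contraNneq f0 => f0; rewrite /line -lsub_comp f0.
  by rewrite rmorph0.
have reg3 : reg_pair line f g by apply: reg_pair_line ea eb.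
have reg2 : reg_pair (kill i2) f g.
  apply: (reg_pair_lift (kill_idem _) _ _ hf hg f0 reg3); first by rewrite killC.
  by rewrite lsub_killX.
have reg1 : reg_pair 1%:M f g.
  by apply: (reg_pair_lift (i := i2) _ _ _ hf hg); rewrite ?mulmx1 ?mul1mx ?lsub1.
have f1 : f != 0 by apply: contraNneq f0 => ->; rewrite rmorph0.
move=> p hp.
have fp i : p i * f = (\sum_j a j * p j) * F i.
  rewrite mulr_sumr mulr_suml; apply: eq_bigr => j _.
  by rewrite mulrCA hp mulrA.
have [r hr] : exists r, \sum_j a j * p j = r * f.
  have := reg1 (\sum_j a j * p j) (\sum_j b j * p j).
  rewrite !lsub1; case; last by move=> r; rewrite ?lsub1 => hr; exists r.
  rewrite mulr_suml mulr_sumr; apply: eq_bigr => j _.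
  by rewrite -mulrA fp mulrCA.
exists r => i; apply: (mulIf f1); rewrite fp hr; ring.
Qed.

End Primitive.

(** * Maximal minors and tensors *)

HB.lock Definition minors (K : comNzRingType) (m : nat) (A : 'M[K]_(m, m.+1))
  (c : 'I_m.+1) : K := (-1) ^+ c * \det (col' c A).

Lemma minorsE (K : comNzRingType) (m : nat) (A : 'M[K]_(m, m.+1)) c :
  minors A c = (-1) ^+ c * \det (col' c A).
Proof. by rewrite minors.unlock. Qed.

Section Determinants.
Context {K : comNzRingType}.

Lemma dhomog_det (n m d : nat) (A : 'M[{mpoly K[n]}]_m) :
  (forall i j, A i j \is d.-homog) -> \det A \is (m * d).-homog.
Proof.
move=> hA; rewrite /determinant; apply: rpred_sum => s _.
rewrite -signr_odd mulr_sign.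
have H : \prod_i A i (s i) \is (m * d).-homog.
  rewrite -[m in (m * d)%N]card_ord -sum_nat_const.
  by elim/big_rec2: _ => [|i y1 y2 _ h]; [apply: dhomog1 | apply: dhomogM].
by case: (odd _); rewrite ?rpredN.
Qed.

Lemma minors_expand m (A : 'M[K]_(m, m.+1)) (r : 'I_m.+1 -> K) :
  \det (\matrix_(i, j) oapp (fun b => A b j) (r j) (unlift ord0 i))
    = \sum_c r c * minors A c.
Proof.
rewrite (expand_det_row _ ord0); apply: eq_bigr => c _.
rewrite mxE unlift_none /= /cofactor add0n minorsE; congr (_ * (_ * \det _)).
by apply/matrixP=> i j; rewrite !mxE liftK.
Qed.

Lemma minors_null m (A : 'M[K]_(m, m.+1)) b : \sum_c A b c * minors A c = 0.
Proof.
rewrite -minors_expand.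
apply: (determinant_alternate (neq_lift ord0 b)) => j.
by rewrite !mxE unlift_none liftK.
Qed.

End Determinants.

Lemma minors_map (K K' : comNzRingType) (f : {rmorphism K -> K'}) m
  (A : 'M[K]_(m, m.+1)) c : minors (map_mx f A) c = f (minors A c).
Proof.
rewrite !minorsE rmorphM rmorphXn rmorphN1 -det_map_mx; congr (_ * \det _).
by apply/matrixP=> i j; rewrite !mxE.
Qed.

Section Kernel.
Context {K : idomainType}.

Lemma det0_kernel m (A : 'M[K]_m) (y : 'I_m -> K) i :
  (forall b, \sum_c A b c * y c = 0) -> y i != 0 -> \det A = 0.
Proof.
move=> Ay yi; apply: (mulIf yi); rewrite mul0r.
have /matrixP/(_ i 0) := congr1 (mulmx^~ (\col_j y j)) (mul_adj_mx A).
rewrite -mulmxA mul_scalar_mx !mxE => <-.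
apply: big1 => b _; rewrite [(_ *m _) _ _]mxE.
by under eq_bigr do rewrite mxE; rewrite Ay mulr0.
Qed.

(** Cramer: the kernel of an m x (m + 1) matrix is proportional to its minors.  Adding the
    row e_c y_c' - e_c' y_c makes the matrix square and leaves y in its kernel, so its
    determinant vanishes. *)
Lemma kernel_minors m (A : 'M[K]_(m, m.+1)) (y : 'I_m.+1 -> K) c c' :
  (forall b, \sum_c A b c * y c = 0) -> minors A c * y c' = minors A c' * y c.
Proof.
move=> Ay.
have [[i yi]|y0] := EM (exists i, y i != 0); last first.
  have {}y0 j : y j = 0 by apply/eqP/negP => /negP yj; apply: y0; exists j.
  by rewrite !y0 !mulr0.
pose r j := y c' *+ (j == c) - y c *+ (j == c').
have rE (z : 'I_m.+1 -> K) : \sum_j r j * z j = y c' * z c - y c * z c'.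
  rewrite /r; under eq_bigr do rewrite mulrBl !mulrnAl.
  have one u v : \sum_j (u * z j) *+ (j == v) = u * z v.
    by rewrite (bigD1 v) //= eqxx big1 ?addr0 // => j /negPf ->.
  by rewrite sumrB !one.
have /det0_kernel-/(_ _ yi) : forall b, \sum_j
    (\matrix_(i, j) oapp (fun b => A b j) (r j) (unlift ord0 i)) b j * y j = 0.
  move=> b; case: (unliftP ord0 b) => [j|] ->.
    by rewrite -[RHS](Ay j); apply: eq_bigr => l _; rewrite mxE liftK.
  under eq_bigr do rewrite mxE unlift_none /=.
  by rewrite rE mulrC subrr.
rewrite minors_expand rE => /eqP; rewrite subr_eq0 => /eqP e.
by rewrite mulrC e mulrC.
Qed.

(** The adjugate of a singular matrix has rank one: its columns are proportional to the
    kernel vector x. *)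
Lemma kernel_adj m (A : 'M[K]_m) (x : 'I_m -> K) a a' b :
  (forall b, \sum_c A b c * x c = 0) -> \adj A a b * x a' = \adj A a' b * x a.
Proof.
move=> Ax.
have [[i xi]|x0] := EM (exists i, x i != 0); last first.
  have {}x0 j : x j = 0 by apply/eqP/negP => /negP xj; apply: x0; exists j.
  by rewrite !x0 !mulr0.
pose r j := x a' *+ (j == a) - x a *+ (j == a').
have rE (z : 'I_m -> K) : \sum_j r j * z j = x a' * z a - x a * z a'.
  rewrite /r; under eq_bigr do rewrite mulrBl !mulrnAl.
  have one u v : \sum_j (u * z j) *+ (j == v) = u * z v.
    by rewrite (bigD1 v) //= eqxx big1 ?addr0 // => j /negPf ->.
  by rewrite sumrB !one.
pose B := \matrix_(i, j) if i == b then r j else A i j.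
have /det0_kernel-/(_ _ xi) : forall b', \sum_j B b' j * x j = 0.
  move=> b'; under eq_bigr do rewrite mxE.
  case: eqP => // _; by rewrite rE mulrC subrr.
rewrite (expand_det_row _ b).
have cB j : cofactor B b j = \adj A j b.
  rewrite mxE /cofactor; congr (_ * \det _); apply/matrixP=> u v.
  by rewrite !mxE (negPf (_ : lift b u != b)) // eq_sym neq_lift.
under eq_bigr do rewrite mxE eqxx cB.
by rewrite rE => /eqP; rewrite subr_eq0 => /eqP e; rewrite mulrC e mulrC.
Qed.

End Kernel.

Definition tensor (K : Type) := 'I_4 -> 'I_4 -> 'I_5 -> K.
Definition tr (K : Type) (T : tensor K) : tensor K := fun a b c => T b a c.

Section Tensors.
Context {K : comNzRingType}.
Implicit Types (T : tensor K) (x : 'I_4 -> K) (y : 'I_5 -> K).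

Definition Nmx T x : 'M[K]_(4, 5) := \matrix_(b, c) \sum_a x a * T a b c.
Definition Mmx T y : 'M[K]_4 := \matrix_(b, a) \sum_c y c * T a b c.

Lemma Mmx_tr T y : Mmx (tr T) y = (Mmx T y)^T.
Proof. by apply/matrixP=> i j; rewrite !mxE. Qed.

Lemma Mmx_Nmx T x y b :
  \sum_a Mmx T y b a * x a = \sum_c Nmx T x b c * y c.
Proof.
under eq_bigr do rewrite mxE mulr_suml.
rewrite exchange_big; apply: eq_bigr => c _; rewrite mxE mulr_suml.
by apply: eq_bigr => a _; ring.
Qed.

End Tensors.

Section Tensors2.
Context {K : comNzRingType}.

Definition constT (T : tensor K) : tensor {mpoly K[4]} := fun a b c => (T a b c)%:MP.

End Tensors2.

HB.lock Definition quartic (K : comNzRingType) (T : tensor K) : 'I_5 -> {mpoly K[4]} :=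
  minors (Nmx (constT T) (fun a => 'X_a)).

HB.lock Definition adjM (K : comNzRingType) (T : tensor K) : 'M[{mpoly K[4]}]_4 :=
  \adj (Mmx (constT T) (quartic T)).

Section GenericMinors.
Context {K : comNzRingType}.
Implicit Types (T : tensor K).

Lemma quarticE T : quartic T = minors (Nmx (constT T) (fun a => 'X_a)).
Proof. by rewrite quartic.unlock. Qed.

Lemma adjME T : adjM T = \adj (Mmx (constT T) (quartic T)).
Proof. by rewrite adjM.unlock. Qed.

Lemma dhomog_Nmx T d (q : 'I_4 -> {mpoly K[4]}) : (forall a, q a \is d.-homog) ->
  forall b c, Nmx (constT T) q b c \is d.-homog.
Proof.
move=> hq b c; rewrite mxE; apply: rpred_sum => a _.
by rewrite mulrC mul_mpolyC; apply: dhomogZ.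
Qed.

Lemma dhomog_minors m d (A : 'M[{mpoly K[4]}]_(m, m.+1)) c :
  (forall i j, A i j \is d.-homog) -> minors A c \is (m * d).-homog.
Proof.
move=> hA; rewrite minorsE -signr_odd mulr_sign.
have : \det (col' c A) \is (m * d).-homog by apply: dhomog_det => i j; rewrite mxE.
by case: (odd _); rewrite ?rpredN.
Qed.

Lemma dhomog_quartic T c : quartic T c \is 4.-homog.
Proof.
rewrite quarticE; apply: (@dhomog_minors 4 1) => i j; by apply: dhomog_Nmx => a; rewrite dhomogX /= mdeg1.
Qed.

Lemma dhomog_adjM T a b : adjM T a b \is 12.-homog.
Proof.
rewrite adjME mxE /cofactor -signr_odd mulr_sign.
have : \det (row' b (col' a (Mmx (constT T) (quartic T)))) \is (3 * 4).-homog.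
  apply: dhomog_det => i j; rewrite !mxE; apply: rpred_sum => c _.
  by rewrite mulrC mul_mpolyC; apply: dhomogZ; apply: dhomog_quartic.
by case: (odd _); rewrite ?rpredN.
Qed.

(** F(x) spans the kernel of N(x). *)
Lemma quartic_syz T b :
  \sum_c Nmx (constT T) (fun a => 'X_a) b c * quartic T c = 0.
Proof. by rewrite quarticE minors_null. Qed.

Lemma subst_quartic T (q : 'I_4 -> {mpoly K[4]}) c :
  subst q (quartic T c) = minors (Nmx (constT T) q) c.
Proof.
rewrite quarticE -minors_map; congr (minors _ c); apply/matrixP=> i j.
rewrite !mxE rmorph_sum; apply: eq_bigr => a _.
by rewrite rmorphM /= substX substC.
Qed.

Lemma subst_adjM T (q : 'I_4 -> {mpoly K[4]}) a b :
  subst q (adjM T a b) = \adj (Mmx (constT T) (fun c => subst q (quartic T c))) a b.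
Proof.
transitivity (map_mx (subst q) (adjM T) a b); first by rewrite [RHS]mxE.
rewrite adjME map_mx_adj; congr (\adj _ a b).
apply/matrixP=> i j; rewrite !mxE rmorph_sum; apply: eq_bigr => c _.
by rewrite rmorphM /= substC.
Qed.

End GenericMinors.

(** * The Cremona transformation of a tensor *)

Section Cremona.
Context {k : fieldType}.
Local Notation S := {mpoly k[4]}.
Implicit Types (T : tensor k).

Lemma primitive_vars : primitive (fun i : 'I_4 => 'X_i : S).
Proof.
apply: (@line_free_primitive _ _ 1) => [i|]; first by rewrite dhomogX /= mdeg1.
exists 0%N, (fun i => (i == i0)%:R), (fun i => (i == i1)%:R).
have hom (b : bool) : (b%:R : S) \is 0.-homog.
  by case: b; [apply: dhomog1 | apply: dhomog0].
split=> // [].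
  rewrite (bigD1 i0) //= big1 => [|i /negPf ->]; last by rewrite mul0r.
  by rewrite ?eqxx ?mulr1n mul1r addr0 lineX.
rewrite (bigD1 i1) //= big1 => [|i /negPf ->]; last by rewrite mul0r.
by rewrite ?eqxx ?mulr1n mul1r addr0 lineX.
Qed.

(** The rank-one adjugate of M(F(x)) has x as its column, and g is its row. *)
Definition gform T (g : 'I_4 -> S) : Prop :=
  (forall b, g b \is 11.-homog) /\ forall a b, adjM T a b = 'X_a * g b.

Lemma Mmx_vars T b : \sum_a Mmx (constT T) (quartic T) b a * 'X_a = 0.
Proof. by rewrite Mmx_Nmx quartic_syz. Qed.

(** The columns of the adjugate are proportional to x, and the variables form a primitive
    family. *)
Lemma gform_exists T : exists g, gform T g.
Proof.
have /choice [g hg] : forall b, exists h, forall a, adjM T a b = h * 'X_a.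
  move=> b; rewrite adjME; apply: (primitive_vars (p := fun a => \adj _ a b)) => i j.
  by apply: (kernel_adj (x := fun a => 'X_a)) => c; apply: Mmx_vars.
exists g; split=> [b|a b]; last by rewrite hg mulrC.
apply: (@dhomog_factor _ _ (g b) 'X_i0 11 1); first exact: mpolyX_neq0.
  by rewrite dhomogX /= mdeg1.
by rewrite -hg dhomog_adjM.
Qed.

(** g kills M(F), and M(F) contracted with g is the matrix of the transposed tensor at g,
    applied to F. *)
Lemma gform_syz T g b : gform T g ->
  \sum_c Nmx (constT (tr T)) g b c * quartic T c = 0.
Proof.
case=> _ hg; have ct : constT (tr T) = tr (constT T) by [].
rewrite ct -Mmx_Nmx Mmx_tr.
have dM : \det (Mmx (constT T) (quartic T)) = 0.
  apply: (@det0_kernel _ _ _ (fun a => 'X_a) i0) (mpolyX_neq0 i0).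
  by move=> j; apply: Mmx_vars.
have /matrixP/(_ i0 b) := mul_adj_mx (Mmx (constT T) (quartic T)).
rewrite dM mxE [in RHS]mxE mul0rn => e.
apply: (mulfI (mpolyX_neq0 i0)); rewrite mulr0 -[RHS]e mulr_sumr.
by apply: eq_bigr => a _; rewrite -adjME hg [_^T _ _]mxE; ring.
Qed.

(** Both F and F'(g) are proportional to the kernel of N'(g). *)
Lemma hform_exists T g : gform T g -> primitive (quartic T) ->
  exists h, forall c, subst g (quartic (tr T) c) = h * quartic T c.
Proof.
move=> hg pF; apply: (pF (fun c => subst g (quartic (tr T) c))) => i j.
cbv beta; rewrite !subst_quartic.
have ker b : \sum_c Nmx (constT (tr T)) g b c * quartic T c = 0.
  exact: gform_syz.
exact: (@kernel_minors {mpoly k[4]} 4 _ (quartic T) i j ker).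
Qed.

Lemma primitive_gform T g : gform T g ->
  line_free 12 (fun ab : 'I_4 * 'I_4 => adjM T ab.1 ab.2) -> primitive g.
Proof.
case=> hg eg [s [a [b [ha hb ea eb]]]]; apply: (line_free_primitive hg).
have sumE (u : 'I_4 * 'I_4 -> S) :
    \sum_j (\sum_i u (i, j) * 'X_i) * g j = \sum_i u i * adjM T i.1 i.2.
  under eq_bigr do rewrite mulr_suml.
  rewrite exchange_big pair_big /=; apply: eq_bigr => -[i j] _ /=.
  by rewrite eg mulrA.
have hom (u : 'I_4 * 'I_4 -> S) j : (forall i, u i \is s.-homog) ->
    \sum_i u (i, j) * 'X_i \is s.+1.-homog.
  move=> hu; apply: rpred_sum => i _; rewrite -[s.+1]addn1; apply: dhomogM => //.
  by rewrite dhomogX /= mdeg1.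
exists s.+1, (fun j => \sum_i a (i, j) * 'X_i), (fun j => \sum_i b (i, j) * 'X_i).
by split=> [j|j||]; rewrite ?sumE ?addSnnS //; apply: hom.
Qed.

Lemma adjZ m (c : S) (A : 'M[S]_m.+1) : \adj (c *: A) = c ^+ m *: \adj A.
Proof. by apply/matrixP=> i j; rewrite !mxE cofactorZ. Qed.

Lemma trK T : tr (tr T) = T. Proof. by []. Qed.

(** Substituting g in the adjugate x_b g'_a of M'(F') gives the adjugate of h M(F)^T: that
    is g_b g'_a(g) = h^3 x_a g_b. *)
Lemma cremona_inverse T g g' h : gform T g -> gform (tr T) g' ->
  (forall c, subst g (quartic (tr T) c) = h * quartic T c) ->
  (exists c, subst g (quartic (tr T) c) != 0) ->
  forall a, subst g (g' a) = h ^+ 3 * 'X_a.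
Proof.
move=> [hg eg] [hg' eg'] eh [c c0] a.
have [b gb] : exists b, g b != 0.
  apply: contrapT => H; have g0 b : g b = 0.
    by apply/eqP/negP => /negP gb; apply: H; exists b.
  move/eqP: c0; apply; rewrite subst_quartic.
  have N0 : Nmx (constT (tr T)) g = 0.
    by apply/matrixP=> i j; rewrite !mxE big1 // => l _; rewrite g0 mul0r.
  rewrite N0 minorsE; have -> : col' c (0 : 'M[S]_(4, 5)) = 0.
    by apply/matrixP=> i j; rewrite !mxE.
  by rewrite det0 mulr0.
apply: (mulIf gb).
have : subst g (adjM (tr T) b a) = h ^+ 3 * adjM T a b.
  rewrite subst_adjM.
  have -> : Mmx (constT (tr T)) (fun c => subst g (quartic (tr T) c))
          = h *: (Mmx (constT T) (quartic T))^T.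
    apply/matrixP=> i j; rewrite !mxE mulr_sumr; apply: eq_bigr => l _.
    by rewrite eh mulrA.
  by rewrite adjZ -trmx_adj [LHS]mxE [X in _ * X]mxE adjME.
rewrite eg'.
rewrite eg.
rewrite rmorphM /=.
rewrite substX => e.
rewrite mulrC.
rewrite e.
by rewrite mulrA.
Qed.

(** Substitute g in h' F' = F(g'), and use g'(g) = h^3 x. *)
Lemma cremona_h T g g' h h' : gform T g -> gform (tr T) g' ->
  (forall c, subst g (quartic (tr T) c) = h * quartic T c) ->
  (exists c, subst g (quartic (tr T) c) != 0) ->
  (forall c, subst g' (quartic T c) = h' * quartic (tr T) c) ->
  subst g h' = h ^+ 11 /\ h != 0.
Proof.
move=> hg hg' eh [c c0] eh'.
have inv := cremona_inverse hg hg' eh (ex_intro _ c c0).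
have h0 : h != 0 by apply: contraNneq c0 => h0; rewrite eh h0 mul0r.
have F0 : quartic T c != 0 by apply: contraNneq c0 => F0; rewrite eh F0 mulr0.
split=> //; apply: (mulIf F0); apply: (mulIf h0).
have := congr1 (subst g) (eh' c); rewrite subst_comp (subst_eq _ inv).
rewrite (subst_scale _ _ (dhomog_quartic T c)) subst_id rmorphM /= eh -exprM.
by move=> e; rewrite -mulrA [X in _ * X]mulrC -e; ring.
Qed.

End Cremona.

(** * Powers of an ideal *)

Section IdealPowers.
Context {k : fieldType}.
Local Notation S := {mpoly k[4]}.

Definition ideal_gen (J : finType) (F : J -> S) : ideal k :=
  fun p => exists r : J -> S, p = \sum_c r c * F c.

Lemma ideal_gen_ideal (J : finType) (F : J -> S) : is_ideal (ideal_gen F).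
Proof.
split=> [|p q [r ->] [s ->]|p q [r ->]].
- by exists (fun=> 0); rewrite big1 // => c _; rewrite mul0r.
- by exists (fun c => r c + s c); rewrite -big_split; apply: eq_bigr => c _; rewrite mulrDl.
- by exists (fun c => p * r c); rewrite mulr_sumr; apply: eq_bigr => c _; rewrite mulrA.
Qed.

Lemma ideal_gen_mem (J : finType) (F : J -> S) c : ideal_gen F (F c).
Proof.
exists (fun j => (j == c)%:R); rewrite (bigD1 c) //= eqxx mul1r big1 ?addr0 //.
by move=> j /negPf ->; rewrite mul0r.
Qed.

Context {I : ideal k}.
Context (idI : is_ideal I).

Lemma ideal0 : I 0. Proof. by case: idI. Qed.
Lemma idealD p q : I p -> I q -> I (p + q). Proof. by case: idI => _ h _; apply: h. Qed.
Lemma idealMl p q : I q -> I (p * q). Proof. by case: idI => _ _; apply. Qed.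
Lemma idealMr p q : I p -> I (p * q). Proof. by rewrite mulrC; apply: idealMl. Qed.
Lemma idealZ c p : I p -> I (c *: p). Proof. by rewrite -mul_mpolyC; apply: idealMl. Qed.
Lemma idealN p : I p -> I (- p). Proof. by rewrite -mulN1r; apply: idealMl. Qed.
Lemma idealB p q : I p -> I q -> I (p - q).
Proof. by move=> hp hq; apply: idealD => //; apply: idealN. Qed.
Lemma ideal_sum (J : Type) (r : seq J) (P : pred J) (F : J -> S) :
  (forall j, P j -> I (F j)) -> I (\sum_(j <- r | P j) F j).
Proof. by move=> h; apply: big_ind => //; [apply: ideal0 | apply: idealD]. Qed.

Lemma pow_ideal n : is_ideal (ideal_pow I n).
Proof.
elim: n => [|n [_ _ IHM]]; first by split.
split=> [|p q [r [a [b [ha hb ->]]]] [s [c [d [hc hd ->]]]]|p q [r [a [b [ha hb ->]]]]].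
- by exists 0%N, (fun=> 0), (fun=> 0); split=> [[]|[]|]; rewrite ?big_ord0.
- exists (r + s)%N.
  exists (fun i => match split i with inl j => a j | inr j => c j end).
  exists (fun i => match split i with inl j => b j | inr j => d j end).
  split=> [i|i|]; [by case: split | by case: split |].
  rewrite big_split_ord; congr (_ + _); apply: eq_bigr => i _.
    by rewrite (unsplitK (inl i)).
  by rewrite (unsplitK (inr i)).
- exists r, (fun i => p * a i), b; split=> // [i|]; first exact: idealMl.
  by rewrite mulr_sumr; apply: eq_bigr => i _; rewrite mulrA.
Qed.

Lemma pow_mulS n a b : I a -> ideal_pow I n b -> ideal_pow I n.+1 (a * b).
Proof.
by move=> ha hb; exists 1%N, (fun=> a), (fun=> b); split; rewrite ?big_ord1.
Qed.

Lemma pow_one a : I a -> ideal_pow I 1 a.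
Proof. by move=> ha; rewrite -[a]mulr1; apply: pow_mulS. Qed.

Lemma pow_mul m n a b : ideal_pow I m a -> ideal_pow I n b ->
  ideal_pow I (m + n) (a * b).
Proof.
elim: m a => [|m IH] a; first by move=> _ hb; case: (pow_ideal n) => _ _; apply.
case=> r [u [v [hu hv ->]]] hb; rewrite mulr_suml.
have [h0 hD _] := pow_ideal (m.+1 + n).
apply: big_ind => // i _; rewrite -mulrA addSn; apply: pow_mulS => //.
exact: (IH _ (hv i) hb).
Qed.

Lemma pow_exp m n a : ideal_pow I m a -> ideal_pow I (n * m) (a ^+ n).
Proof. by move=> ha; elim: n => // n IH; rewrite exprS mulSn; apply: pow_mul. Qed.

End IdealPowers.

Section PowDet.
Context {k : fieldType} {I : ideal k} (idI : is_ideal I).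
Local Notation S := {mpoly k[4]}.

Lemma pow_det m d (A : 'M[S]_m) : (forall i j, ideal_pow I d (A i j)) ->
  ideal_pow I (m * d) (\det A).
Proof.
move=> hA; rewrite /determinant; apply: (ideal_sum (pow_ideal idI _)) => s _.
apply: (idealMl (pow_ideal idI _)).
rewrite -[m in (m * d)%N]card_ord -sum_nat_const.
by elim/big_rec2: _ => // i y1 y2 _ h; apply: pow_mul.
Qed.

Lemma pow_minors m d (A : 'M[S]_(m, m.+1)) c : (forall i j, ideal_pow I d (A i j)) ->
  ideal_pow I (m * d) (minors A c).
Proof.
move=> hA; rewrite minorsE; apply: (idealMl (pow_ideal idI _)); apply: pow_det => i j.
by rewrite mxE.
Qed.

Lemma pow_adj m d (A : 'M[S]_m.+1) a b : (forall i j, ideal_pow I d (A i j)) ->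
  ideal_pow I (m * d) (\adj A a b).
Proof.
move=> hA; rewrite mxE; apply: (idealMl (pow_ideal idI _)); apply: pow_det => i j.
by rewrite !mxE.
Qed.

End PowDet.

(** * Sections on the blow-up *)

Section Sections.
Context {k : fieldType}.
Local Notation S := {mpoly k[4]}.
Implicit Types (T : tensor k) (D : divisor_class).

Local Notation II T := (ideal_gen (quartic T)).

Lemma hform_homog T g h : gform T g ->
  (forall c, subst g (quartic (tr T) c) = h * quartic T c) ->
  (exists c, subst g (quartic (tr T) c) != 0) -> h \is 40.-homog.
Proof.
move=> [hg _] eh [c c0].
have F0 : quartic T c != 0 by apply: contraNneq c0 => F0; rewrite eh F0 mulr0.
apply: (@dhomog_factor _ _ h (quartic T c) 40 4 F0 (dhomog_quartic T c)).
by rewrite -eh; apply: (dhomog_subst hg (dhomog_quartic _ _)).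
Qed.

(** x_i^4 h F_c is a maximal minor of N'(x_i g), whose entries are combinations of
    cofactors of M(F), so they lie in I^3. *)
Lemma hform_pow T g h f i : gform T g ->
  (forall c, subst g (quartic (tr T) c) = h * quartic T c) ->
  II T f -> ideal_pow (II T) 12 (h * f * 'X_i ^+ 4).
Proof.
move=> [_ eg] eh [r ->].
have idI := ideal_gen_ideal (quartic T).
rewrite mulr_sumr mulr_suml; apply: (ideal_sum (pow_ideal idI 12)) => c _.
have -> : h * (r c * quartic T c) * 'X_i ^+ 4 = r c * ('X_i ^+ 4 * (h * quartic T c)).
  by ring.
apply: (idealMl (pow_ideal idI 12)).
rewrite -eh -(subst_scale _ _ (dhomog_quartic _ c)) subst_quartic.
apply: (@pow_minors _ _ idI 4 3) => b l; rewrite mxE.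
apply: (ideal_sum (pow_ideal idI 3)) => a _.
apply: (idealMr (pow_ideal idI 3)); rewrite -eg adjME.
apply: (@pow_adj _ _ idI 3 1) => u v; rewrite mxE.
apply: pow_one; apply: (ideal_sum idI) => c' _.
by apply: (idealMr idI); apply: ideal_gen_mem.
Qed.

Definition D40 : divisor_class := clH *+ 40 - clE *+ 11.

Lemma D40E m : (D40 *+ m) 0 0 = (40 * m)%N%:Z /\ (D40 *+ m) 0 1 = - (11 * m)%N%:Z.
Proof.
have E i j : D40 i j = (clH i j) *+ 40 - (clE i j) *+ 11.
  by rewrite /D40 [LHS]mxE [in LHS]mulmxnE [X in _ + X]mxE mulmxnE.
by rewrite !mulmxnE !E /clH /clE !mxE /=; split; lia.
Qed.

(** On the chart of x_i and f, the section h^m is (h f x_i^4)^m / (x_i^4 f)^m. *)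
Lemma section_h T g h m : gform T g ->
  (forall c, subst g (quartic (tr T) c) = h * quartic T c) ->
  (exists c, subst g (quartic (tr T) c) != 0) ->
  global_section (II T) (D40 *+ m) (tofrac (h ^+ m)).
Proof.
move=> hg eh c0 i f e If ff f0.
have [D0 D1] := D40E m.
have h40 := hform_homog hg eh c0.
exists (4 * m)%N, m, (m * 12)%N, ((40 + e + 4) * m)%N, ((h * f * 'X_i ^+ 4) ^+ m).
split.
- by rewrite D1; lia.
- by rewrite D0; lia.
- by apply: (pow_exp (ideal_gen_ideal _)); apply: (hform_pow _ hg).
- apply: dhomogMn; apply: dhomogM; first exact: dhomogM.
  by apply: (@dhomogMn _ _ mdeg 1 'X_i 4); rewrite dhomogX /= mdeg1.
have d0 : 'X_i ^+ (4 * m) * f ^+ m != 0.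
  by rewrite mulf_neq0 ?expf_neq0 ?mpolyX_neq0.
apply: (mulIf (_ : tofrac ('X_i ^+ (4 * m) * f ^+ m) != 0)); first by rewrite tofrac_eq0.
rewrite mulfVK ?tofrac_eq0 // -tofracM; congr tofrac.
by rewrite exprM !exprMn; ring.
Qed.

Lemma section_E T : global_section (II T) clE (tofrac 1).
Proof.
move=> i f e If ff f0; exists 0%N, 1%N, 0%N, e, f.
by rewrite /clE !mxE /= mul1r expr1 divff ?tofrac_eq0 // tofrac1; split=> //; lia.
Qed.

(** The section condition for a polynomial, on the charts of a coordinate and a generator
    of the ideal, with the denominators cleared. *)
Definition local_form T D (P : S) : Prop :=
  forall i c, quartic T c != 0 ->
    exists (m n j t : nat), [/\ j%:Z = n%:Z - D 0 1, t%:Z = D 0 0 + m%:Z + (n * 4)%:Z,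
      ideal_pow (II T) j (P * 'X_i ^+ m * quartic T c ^+ n) &
      forms t (P * 'X_i ^+ m * quartic T c ^+ n)].

(** The denominators of a section are powers of the x_i and of the quartics; both families
    are primitive, so no denominator is left. *)
Lemma section_poly T D phi : primitive (quartic T) -> global_section (II T) D phi ->
  exists P, phi = tofrac P /\ local_form T D P.
Proof.
move=> pF sec; have [c0 F0] := primitive_neq0 ord0 pF.
have chart i c (Fc : quartic T c != 0) :=
  sec i _ 4 (ideal_gen_mem _ c) (dhomog_quartic T c) Fc.
have [m0 [n0 [j0 [t0 [G0 [_ _ _ _ e0]]]]]] := chart i0 c0 F0.
set B := 'X_i0 ^+ m0 * quartic T c0 ^+ n0 in e0.
have B0 : B != 0 by rewrite mulf_neq0 ?expf_neq0 ?mpolyX_neq0.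
have key i c : quartic T c != 0 -> exists m n j t : nat, exists G : S,
    [/\ j%:Z = n%:Z - D 0 1, t%:Z = D 0 0 + m%:Z + (n * 4)%:Z,
      ideal_pow (II T) j G, forms t G & G0 * ('X_i ^+ m * quartic T c ^+ n) = G * B].
  move=> Fc; have [m [n [j [t [G [h1 h2 h3 h4 e]]]]]] := chart i c Fc.
  exists m, n, j, t, G; split=> //; apply/eqP.
  have M0 : 'X_i ^+ m * quartic T c ^+ n != 0.
    by rewrite mulf_neq0 ?expf_neq0 ?mpolyX_neq0.
  by rewrite -tofrac_eq (tofracM G0) (tofracM G) -eqr_div ?tofrac_eq0 // -e0 e.
(* G0 / B is a fraction on one chart; every chart gives a power of x_i and of a quartic
   whose product with G0 is divisible by B. *)
have [P eP] : mdvd B G0.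
  apply: (primitive_dvd i0 primitive_vars B0) => i.
  have /choice [mn hmn] : forall c, exists mn : nat * nat,
      mdvd B (G0 * ('X_i ^+ mn.1 * quartic T c ^+ mn.2)).
    move=> c; have [->|Fc] := eqVneq (quartic T c) 0.
      by exists (0%N, 1%N); exists 0; rewrite expr1 !mulr0 mul0r.
    have [m [n [_ [_ [G [_ _ _ _ e]]]]]] := key i c Fc.
    by exists (m, n); exists G.
  exists (\max_c (mn c).1)%N.
  apply: (primitive_dvd ord0 pF B0) => c; exists (mn c).2.
  have le := leq_bigmax (F := fun c => (mn c).1) c.
  rewrite -(subnK le) exprD.
  have -> : forall a b d : S, G0 * (a * b) * d = G0 * (b * d) * a by move=> *; ring.
  exact: mdvd_mulr.
exists P; split.
  by rewrite e0 eP tofracM mulfK ?tofrac_eq0.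
move=> i c Fc; have [m [n [j [t [G [h1 h2 h3 h4 e]]]]]] := key i c Fc.
exists m, n, j, t; suff <- : G = P * 'X_i ^+ m * quartic T c ^+ n by [].
by apply: (mulIf B0); rewrite -e eP; ring.
Qed.

(** The degree of P is determined on any chart; it is natural, although the class has
    integer coordinates. *)
Lemma section_homog T D P : primitive (quartic T) -> P != 0 ->
  local_form T D P ->
  exists2 d : nat, D 0 0 = d%:Z & P \is d.-homog.
Proof.
move=> pF P0 H; have [c0 F0] := primitive_neq0 ord0 pF.
have [m [n [j [t [_ et _ ht]]]]] := H i0 c0 F0.
have M0 : 'X_i0 ^+ m * quartic T c0 ^+ n != 0.
  by rewrite mulf_neq0 ?expf_neq0 ?mpolyX_neq0.
have hM : 'X_i0 ^+ m * quartic T c0 ^+ n \is (1 * m + 4 * n)%N.-homog.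
  apply: dhomogM; apply: dhomogMn; last exact: dhomog_quartic.
  by rewrite dhomogX /= mdeg1.
rewrite /forms -mulrA in ht.
have [tm|tm] := ltnP t (1 * m + 4 * n).
  by rewrite (dhomog_factor_lt M0 hM ht tm) eqxx in P0.
exists (t - (1 * m + 4 * n))%N; first by lia.
by apply: (dhomog_factor M0 hM); rewrite subnK.
Qed.

Lemma pow_subst T g' h' j G :
  (forall c, subst g' (quartic T c) = h' * quartic (tr T) c) ->
  ideal_pow (II T) j G -> mdvd (h' ^+ j) (subst g' G).
Proof.
move=> eh'; elim: j G => [|j IH] G; first by exists (subst g' G); rewrite mulr1.
case=> r [a [b [ha hb ->]]].
have /choice [u hu] : forall i, mdvd (h' ^+ j.+1) (subst g' (a i * b i)).
  move=> i; have [v ev] := IH _ (hb i); have [w ew] := ha i.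
  rewrite rmorphM /= ev ew rmorph_sum /=.
  exists (v * \sum_c subst g' (w c) * quartic (tr T) c).
  have -> : \sum_c subst g' (w c * quartic T c)
          = h' * \sum_c subst g' (w c) * quartic (tr T) c.
    rewrite mulr_sumr; apply: eq_bigr => c _.
    by rewrite rmorphM /= eh' mulrCA.
  by rewrite exprS; ring.
exists (\sum_i u i); rewrite rmorph_sum mulr_suml /=.
by apply: eq_bigr => i _; rewrite hu.
Qed.

(** On each chart, P times powers of x_i and F_c is in I^j, which g' maps into multiples of
    h'^j.  The powers of g'_i and F'_c left over are removed because both families are
    primitive. *)
Lemma section_dvd T D P g' h' (b : nat) : h' != 0 ->
  primitive (quartic T) -> primitive (quartic (tr T)) -> primitive g' ->
  (forall c, subst g' (quartic T c) = h' * quartic (tr T) c) ->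
  D 0 1 = - b%:Z ->
  local_form T D P ->
  mdvd (h' ^+ b) (subst g' P).
Proof.
move=> h0 pF pF' pg eh' eD H.
have B0 : h' ^+ b != 0 by rewrite expf_neq0.
apply: (primitive_dvd i0 pg B0) => i.
have /choice [mn hmn] : forall c, exists mn : nat * nat,
    mdvd (h' ^+ b) (subst g' P * (g' i ^+ mn.1 * quartic (tr T) c ^+ mn.2)).
  move=> c; have [Fc0|Fc] := eqVneq (quartic T c) 0.
    exists (0%N, 1%N); exists 0; rewrite expr1 mul1r.
    have /eqP : h' * quartic (tr T) c = 0 by rewrite -eh' Fc0 rmorph0.
    by rewrite mulf_eq0 (negPf h0) /= => /eqP ->; rewrite mulr0 mul0r.
  have [m [n [j [_ [ej _ hj _]]]]] := H i c Fc.
  have [u eu] := pow_subst eh' hj.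
  exists (m, n), u; apply: (mulIf (expf_neq0 n h0)).
  have -> : u * h' ^+ b * h' ^+ n = u * h' ^+ j.
    by rewrite -mulrA -exprD; congr (_ * _ ^+ _); lia.
  rewrite -eu !rmorphM !rmorphXn /= substX eh' exprMn; ring.
exists (\max_c (mn c).1)%N.
apply: (primitive_dvd ord0 pF' B0) => c; exists (mn c).2.
have le := leq_bigmax (F := fun c => (mn c).1) c.
rewrite -(subnK le) exprD.
have -> : forall a b d : S, subst g' P * (a * b) * d = subst g' P * (b * d) * a.
  by move=> *; ring.
exact: mdvd_mulr.
Qed.

(** The third condition makes the forms g' of the transposed tensor primitive; the last
    one says that the map g is not degenerate, that is h is not zero. *)
Definition good T : Prop :=
  [/\ primitive (quartic T), primitive (quartic (tr T)),
      line_free 12 (fun ab : 'I_4 * 'I_4 => adjM (tr T) ab.1 ab.2) &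
      exists g, gform T g /\ exists c, subst g (quartic (tr T) c) != 0].

End Sections.

(** * The effective cone of a good tensor *)

Section Cone.
Context {k : fieldType}.
Local Notation S := {mpoly k[4]}.
Implicit Types (T : tensor k) (D : divisor_class).
Local Notation II T := (ideal_gen (quartic T)).

Lemma subst_back (q r : 'I_4 -> S) (h P : S) d : (forall i, subst q (r i) = h ^+ 3 * 'X_i) ->
  P \is d.-homog -> subst q (subst r P) = h ^+ (3 * d) * P.
Proof.
move=> inv hP; rewrite subst_comp (subst_eq _ inv) (subst_scale _ _ hP) subst_id.
by rewrite exprM.
Qed.

(** All that the computation of the effective cone uses about a good tensor. *)
Record cremona_data T (g g' : 'I_4 -> S) (h h' : S) : Prop := CremonaData {
  cd_section : forall m, global_section (II T) (D40 *+ m) (tofrac (h ^+ m));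
  cd_g' : forall i, g' i \is 11.-homog;
  cd_primitive : primitive g';
  cd_inv : forall i, subst g (g' i) = h ^+ 3 * 'X_i;
  cd_F : forall c, subst g' (quartic T c) = h' * quartic (tr T) c;
  cd_h : h \is 40.-homog;
  cd_h' : h' \is 40.-homog;
  cd_h0 : h != 0;
  cd_h'0 : h' != 0;
  cd_hh' : subst g' h = h' ^+ 11 }.

Lemma good_cremona T : good T -> exists g g' h h', cremona_data T g g' h h'.
Proof.
move=> [pF pF' lf [g [hg c0]]].
have [g' hg'] := gform_exists (tr T).
have [h eh] := hform_exists hg pF.
have [h' eh'] := hform_exists hg' pF'.
rewrite trK in eh'.
have [hh' h0] := cremona_h hg hg' eh c0 eh'.
have h'0 : h' != 0.
  by apply: contraNneq (expf_neq0 11 h0) => h'0; rewrite -hh' h'0 rmorph0.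
have c0' : exists c, subst g' (quartic T c) != 0.
  have [c Fc] := primitive_neq0 ord0 pF'.
  by exists c; rewrite eh' mulf_neq0.
have homh' : h' \is 40.-homog.
  by apply: (@hform_homog _ (tr T) g' h' hg') => //; rewrite trK.
have hh : subst g' h = h' ^+ 11.
  by have [] := @cremona_h _ (tr T) g' g h' h hg' hg eh' c0' eh.
exists g, g', h, h'; apply: CremonaData.
- by move=> m; apply: section_h hg eh c0.
- by case: hg'.
- exact: primitive_gform hg' lf.
- exact: cremona_inverse hg hg' eh c0.
- exact: eh'.
- exact: hform_homog hg eh c0.
- exact: homh'.
- exact: h0.
- exact: h'0.
- exact: hh.
Qed.

(** Otherwise the degree 11 d of P(g') is smaller than the degree 40 b of h'^b, so P(g')
    vanishes; substituting g gives h^(3 d) P = 0. *)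
Lemma slope_bound T g g' h h' P d b : cremona_data T g g' h h' -> P != 0 ->
  P \is d.-homog -> mdvd (h' ^+ b) (subst g' P) -> (40 * b <= d * 11)%N.
Proof.
move=> cd P0 hP [q eq]; rewrite leqNgt; apply/negP => lt.
have hb : h' ^+ b \is (40 * b).-homog by apply: dhomogMn; apply: (cd_h' cd).
have h0 : h' ^+ b != 0 by rewrite expf_neq0 ?(cd_h'0 cd).
have := dhomog_subst (cd_g' cd) hP; rewrite eq => hq.
have q0 := dhomog_factor_lt h0 hb hq lt.
have /eqP := subst_back (cd_inv cd) hP; rewrite eq q0 mul0r rmorph0 eq_sym.
by rewrite mulf_eq0 expf_eq0 (negPf (cd_h0 cd)) andbF (negPf P0).
Qed.

(** In the extremal case the quotient of P(g') by h'^(11 m) = h(g')^m is a constant c, so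
    P - c h^m is killed by g', hence is zero. *)
Lemma rigid_bound T g g' h h' P m : cremona_data T g g' h h' ->
  P \is (40 * m).-homog -> mdvd (h' ^+ (11 * m)) (subst g' P) ->
  exists c, P = c%:MP * h ^+ m.
Proof.
move=> cd hP [q eq].
have hb : h' ^+ (11 * m) \is (40 * (11 * m)).-homog.
  by apply: dhomogMn; apply: (cd_h' cd).
have h0 : h' ^+ (11 * m) != 0 by rewrite expf_neq0 ?(cd_h'0 cd).
have := dhomog_subst (cd_g' cd) hP; rewrite eq => hq.
have /dhomog_constP [c ec] : q \is 0.-homog.
  apply: (dhomog_factor h0 hb).
  by have -> : (0 + 40 * (11 * m) = 40 * m * 11)%N by lia.
exists c; apply/eqP; rewrite -subr_eq0; set Q := P - _.
have hQ : Q \is (40 * m).-homog.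
  by rewrite rpredB // mul_mpolyC; apply: dhomogZ; apply: dhomogMn; apply: (cd_h cd).
apply/eqP/(mulfI (expf_neq0 (3 * (40 * m)) (cd_h0 cd))).
rewrite mulr0 -(subst_back (cd_inv cd) hQ).
have -> : subst g' Q = 0.
  by rewrite /Q rmorphB rmorphM rmorphXn /= substC (cd_hh' cd) eq ec -exprM subrr.
exact: rmorph0.
Qed.

Lemma good_effective T D : good T -> effective (II T) D ->
  0 <= D 0 0 /\ 0 <= 11 * D 0 0 + 40 * D 0 1.
Proof.
move=> gT [phi [sec phi0]].
have [g [g' [h [h' cd]]]] := good_cremona gT.
case: gT => pF pF' _ _.
have [P [eP lP]] := section_poly pF sec.
have P0 : P != 0 by apply: contraNneq phi0 => P0; rewrite eP P0 tofrac0.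
have [d ed hP] := section_homog pF P0 lP.
split; first by rewrite ed.
have [D1|D1] := leP 0 (D 0 1); first by rewrite ed; lia.
have eb : D 0 1 = - (absz (D 0 1))%:Z by lia.
have := slope_bound cd P0 hP
  (section_dvd (cd_h'0 cd) pF pF' (cd_primitive cd) (cd_F cd) eb lP).
by rewrite ed; lia.
Qed.

Lemma good_rigid T : good T -> rigid (II T) D40.
Proof.
move=> gT; have [g [g' [h [h' cd]]]] := good_cremona gT.
case: gT => pF pF' _ _; split.
  exists (tofrac (h ^+ 1)); split; first by rewrite -[D40]mulr1n; apply: (cd_section cd).
  by rewrite tofrac_eq0 expr1 (cd_h0 cd).
move=> m m0; exists (fun=> tofrac (h ^+ m)); split.
  by move=> _; apply: (cd_section cd).
move=> phi sec; have [P [eP lP]] := section_poly pF sec.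
have [D0 D1] := D40E m.
have [c ec] : exists c, P = c%:MP * h ^+ m.
  have [->|P0] := eqVneq P 0; first by exists 0; rewrite mpolyC0 mul0r.
  have [d ed hP] := section_homog pF P0 lP.
  apply: (rigid_bound cd).
    by have -> : (40 * m = d)%N by apply/eqP; rewrite -eqz_nat -ed D0.
  exact: section_dvd (cd_h'0 cd) pF pF' (cd_primitive cd) (cd_F cd) D1 lP.
have hm0 : tofrac (h ^+ m) != 0 by rewrite tofrac_eq0 expf_neq0 ?(cd_h0 cd).
exists (const_mx c); split; first by rewrite big_ord1 mxE eP ec tofracM.
move=> c' ; rewrite big_ord1 eP ec tofracM => /(mulIf hm0) /eqP.
rewrite tofrac_eq mpolyC_eq => /eqP ->.
by apply/matrixP=> i j; rewrite mxE !ord1.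
Qed.

End Cone.

Section RealCone.
Context {R : realFieldType}.

Lemma real_D40E : real_class R D40 0 0 = 40 /\ real_class R D40 0 1 = - 11.
Proof.
have := D40E 1; rewrite mulr1n => -[e0 e1].
by rewrite /real_class ![map_mx _ _ _ _]mxE e0 e1; split; rewrite ?rmorphN.
Qed.

Lemma real_clEE : real_class R clE 0 0 = 0 /\ real_class R clE 0 1 = 1.
Proof. by rewrite /real_class /clE !mxE. Qed.

Lemma rV2P (v w : 'rV[R]_2) : v 0 0 = w 0 0 -> v 0 1 = w 0 1 -> v = w.
Proof.
move=> h0 h1; apply/rowP=> j; have [->|] := eqVneq j 0; first exact: h0.
case: j => [[|[|]]] // hj _; have -> : Ordinal hj = 1 by apply: val_inj.
exact: h1.
Qed.

Lemma cone2P (v : 'rV[R]_2) : cone2 (real_class R D40) (real_class R clE) v <->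
  0 <= v 0 0 /\ 0 <= 11 * v 0 0 + 40 * v 0 1.
Proof.
have [[D0 D1] [E0 E1]] := (real_D40E, real_clEE).
move: (real_class R D40) (real_class R clE) D0 D1 E0 E1 => p q D0 D1 E0 E1; split.
  by move=> [a [b [a0 b0 ->]]]; rewrite !mxE D0 D1 E0 E1; split; lra.
move=> [v0 v1]; exists (v 0 0 / 40), (v 0 1 + 11 / 40 * v 0 0); split; [lra | lra |].
by apply: rV2P; rewrite !mxE ?D0 ?D1 ?E0 ?E1; lra.
Qed.

Lemma extremal_cone2 :
  spans_extremal_ray (cone2 (real_class R D40) (real_class R clE)) (real_class R D40).
Proof.
have [D0 D1] := real_D40E; split.
- by move=> /matrixP/(_ 0 0); rewrite D0 mxE; lra.
- by apply/cone2P; rewrite D0 D1; split; lra.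
move=> u v /cone2P [u0 u1] /cone2P [v0 v1].
move: (real_class R D40) D0 D1 => p D0 D1 [c [c0 e]].
have /matrixP e' := e; have := e' 0 0; have := e' 0 1.
rewrite !mxE D0 D1 => h1 h0.
split; [exists (u 0 0 / 40) | exists (v 0 0 / 40)]; (split; first lra).
  by apply: rV2P; rewrite !mxE ?D0 ?D1; lra.
by apply: rV2P; rewrite !mxE ?D0 ?D1; lra.
Qed.

Theorem good_conclusion (k : fieldType) (T : tensor k) : good T ->
  let C := ideal_gen (quartic T) in
  [/\ effective C D40, rigid C D40, spans_extremal_ray (Eff R C) (real_class R D40)
    & forall v : 'rV[R]_2,
        Eff R C v <-> cone2 (real_class R D40) (real_class R clE) v].
Proof.
move=> gT C; have rT := good_rigid gT; have eT : effective C D40 by case: rT.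
have effE : effective C clE.
  by exists (tofrac 1); split; [apply: section_E | rewrite tofrac1 oner_eq0].
have EffP v : Eff R C v <-> cone2 (real_class R D40) (real_class R clE) v.
  split=> [[n [D [c [hD ->]]]]|[a [b [a0 b0 ->]]]]; last first.
    exists 2%N, (fun i : 'I_2 => if i == 0 then D40 else clE).
    exists (fun i : 'I_2 => if i == 0 then a else b).
    split=> [i|]; first by case: eqP.
    by rewrite big_ord_recl big_ord1.
  apply/cone2P; rewrite !summxE mulr_sumr mulr_sumr -big_split; split.
    apply: sumr_ge0 => i _; rewrite !mxE; have [/(good_effective gT) [D0 _] c0] := hD i.
    by rewrite mulr_ge0 // ler0z.
  apply: sumr_ge0 => i _; rewrite !mxE; have [/(good_effective gT) [_ D1] c0] := hD i.
  rewrite [X in 0 <= X](_ : _ = c i * (11 * (D i 0 0) + 40 * (D i 0 1))%:~R).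
    by rewrite mulr_ge0 // ler0z.
  by rewrite rmorphD !rmorphM /= !rmorph_nat; ring.
have EffE : Eff R C = cone2 (real_class R D40) (real_class R clE).
  by apply/funext => v; apply/propext.
by split=> //; rewrite EffE; apply: extremal_cone2.
Qed.

End RealCone.

(** * The Hilbert-Burch theorem *)

Section HilbertBurch.
Context {k : fieldType}.
Local Notation S := {mpoly k[4]}.
Context {m : nat} (A : 'M[S]_(m, m.+1)).

Lemma rows_independent c (q : 'I_m -> S) : minors A c != 0 ->
  (forall j, \sum_b q b * A b j = 0) -> forall b, q b = 0.
Proof.
move=> Fc qA b.
have d0 : \det (col' c A) != 0.
  by apply: contraNneq Fc => d0; rewrite minorsE d0 mulr0.
have e : (\row_j q j) *m col' c A = 0.
  apply/matrixP=> i j; rewrite mxE [RHS]mxE -[RHS](qA (lift c j)).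
  by apply: eq_bigr => l _; rewrite !mxE.
have /matrixP/(_ 0 b) := congr1 (mulmx^~ (\adj (col' c A))) e.
rewrite mul0mx -mulmxA mul_mx_adj mul_mx_scalar !mxE => /eqP.
by rewrite mulf_eq0 (negPf d0) => /eqP.
Qed.

(** The adjugate of the c-th minor writes F_c p as a combination of the rows of A.  The
    coefficients for different c are proportional to F, because the rows are independent;
    as F is primitive, F_c can be divided out. *)
Lemma hilbert_burch (p : 'I_m.+1 -> S) : primitive (minors A) ->
  \sum_c p c * minors A c = 0 -> exists q : 'I_m -> S, forall c, p c = \sum_b q b * A b c.
Proof.
move=> pF pF0; have [c0 F0] := primitive_neq0 ord0 pF.
have /choice [q hq] : forall c, exists q : 'I_m -> S,
    forall j, minors A c * p j = \sum_b q b * A b j.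
  move=> c; have [->|Fc] := eqVneq (minors A c) 0.
    by exists (fun=> 0) => j; rewrite mul0r big1 // => b _; rewrite mul0r.
  pose Q := (-1) ^+ c *: ((\row_j p (lift c j)) *m \adj (col' c A)).
  exists (fun b => Q 0 b).
  pose v j := minors A c * p j - \sum_b Q 0 b * A b j.
  have v0 j : v (lift c j) = 0.
    have : (Q *m col' c A) 0 j = minors A c * p (lift c j).
      rewrite /Q -scalemxAl -mulmxA mul_adj_mx mul_mx_scalar scalerA !mxE.
      by rewrite minorsE.
    rewrite mxE /v => <-; apply/eqP; rewrite subr_eq0; apply/eqP.
    by apply: eq_bigr => b _; rewrite [col' _ _ _ _]mxE.
  have sv : \sum_j v j * minors A j = 0.
    under eq_bigr do rewrite mulrBl.
    rewrite sumrB.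
    have -> : \sum_j minors A c * p j * minors A j = 0.
      under eq_bigr do rewrite -mulrA.
      by rewrite -mulr_sumr pF0 mulr0.
    under eq_bigr do rewrite mulr_suml.
    rewrite exchange_big big1 ?subr0 // => b _.
    under eq_bigr do rewrite -mulrA.
    by rewrite -mulr_sumr minors_null mulr0.
  have vc : v c = 0.
    apply: (mulIf Fc); rewrite mul0r -[RHS]sv (bigD1 c) //= big1 ?addr0 // => j.
    by case: (unliftP c j) => [i ->|-> /eqP //]; rewrite v0 mul0r.
  move=> j; apply/eqP; rewrite -subr_eq0; apply/eqP.
  by case: (unliftP c j) => [i|] ->; [apply: v0 | apply: vc].
have compat c c' b : q c b * minors A c' = q c' b * minors A c.
  apply/eqP; rewrite -subr_eq0; apply/eqP.
  apply: (rows_independent (q := fun b => q c b * minors A c' - q c' b * minors A c) F0).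
  move=> j; under eq_bigr do rewrite mulrBl.
  rewrite sumrB; apply/eqP; rewrite subr_eq0; apply/eqP.
  under eq_bigr do rewrite mulrAC.
  rewrite -mulr_suml -hq; under [RHS]eq_bigr do rewrite mulrAC.
  by rewrite -mulr_suml -hq; ring.
have /choice [r hr] : forall b, exists r, forall c, q c b = r * minors A c.
  by move=> b; apply: (pF (fun c => q c b)) => c c'; apply: compat.
exists r => j; apply: (mulfI F0); rewrite hq mulr_sumr.
by apply: eq_bigr => b _; rewrite hr; ring.
Qed.

(** If x_i p = a_i F for all i, then x_j a_i - x_i a_j is a syzygy, so equals q_ij A.  The
    q_ij form a Koszul cocycle on the variables, hence a coboundary, at least for the
    three indices used; correcting a_0 and a_1 by it makes a_0 divisible by x_0. *)
Lemma minors_saturated1 p : primitive (minors A) ->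
  (forall i : 'I_4, ideal_gen (minors A) ('X_i * p)) -> ideal_gen (minors A) p.
Proof.
move=> pF /choice [a ha]; have [c0 F0] := primitive_neq0 ord0 pF.
have /choice [q hq] : forall ij : 'I_4 * 'I_4, exists q : 'I_m -> S, forall c,
    'X_ij.2 * a ij.1 c - 'X_ij.1 * a ij.2 c = \sum_b q b * A b c.
  case=> i j /=; apply: (hilbert_burch (p := fun c => 'X_j * a i c - 'X_i * a j c)) => //.
  under eq_bigr do rewrite mulrBl -!mulrA.
  by rewrite sumrB -!mulr_sumr -!ha; ring.
(* The differences q_ij satisfy the Koszul relation since the rows are independent. *)
have cocycle b : 'X_i2 * q (i0, i1) b - 'X_i1 * q (i0, i2) b + 'X_i0 * q (i1, i2) b = 0.
  apply: (rows_independent (q := fun b => 'X_i2 * q (i0, i1) b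
            - 'X_i1 * q (i0, i2) b + 'X_i0 * q (i1, i2) b) F0) => j.
  under eq_bigr do rewrite mulrDl mulrBl -!mulrA.
  by rewrite big_split sumrB /= -!mulr_sumr -!hq /=; ring.
have /choice [r hr] : forall b, exists r : S * S, q (i0, i1) b = 'X_i1 * r.1 - 'X_i0 * r.2.
  move=> b; have [s es] := kill_mod i1 (q (i0, i1) b).
  have [|s' es'] := @kill_eq0 _ i0 (lsub (kill i1) (q (i0, i1) b)).
    apply: (mulfI (mpolyX_neq0 i2)); rewrite mulr0.
    have e : 'X_i2 * q (i0, i1) b = 'X_i1 * q (i0, i2) b - 'X_i0 * q (i1, i2) b.
      by apply/eqP; rewrite -subr_eq0 -[X in _ == X](cocycle b); apply/eqP; ring.
    have := congr1 (lsub (kill i1)) e.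
    rewrite rmorphB !rmorphM /= !lsub_killX /= mul0r sub0r => /(congr1 (lsub (kill i0))).
    by rewrite rmorphN !rmorphM /= !lsub_killX /= mul0r oppr0.
  by exists (s, - s'); rewrite {1}es es' /=; ring.
pose a0 c := a i0 c - \sum_b (r b).1 * A b c.
pose a1 c := a i1 c - \sum_b (r b).2 * A b c.
have e01 c : 'X_i1 * a0 c = 'X_i0 * a1 c.
  have := hq (i0, i1) c; rewrite /= /a0 /a1 !mulrBr => e.
  have : \sum_b q (i0, i1) b * A b c
      = 'X_i1 * (\sum_b (r b).1 * A b c) - 'X_i0 * \sum_b (r b).2 * A b c.
    by rewrite !mulr_sumr -sumrB; apply: eq_bigr => b _; rewrite hr; ring.
  by rewrite -e => e'; apply/eqP; rewrite -subr_eq0; apply/eqP; rewrite -[RHS](subrr ('X_i1 * a i0 c - 'X_i0 * a i1 c)) {2}e'; ring.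
have /choice [z hz] : forall c, exists z, a0 c = 'X_i0 * z.
  move=> c; apply: kill_eq0; apply: (mulfI (mpolyX_neq0 i1)).
  have := congr1 (lsub (kill i0)) (e01 c).
  by rewrite !rmorphM /= !lsub_killX /= mul0r mulr0.
exists z; apply: (mulfI (mpolyX_neq0 i0)); rewrite ha mulr_sumr.
rewrite -[LHS]subr0.
have {2}<- : \sum_c (\sum_b (r b).1 * A b c) * minors A c = 0.
  under eq_bigr do rewrite mulr_suml.
  rewrite exchange_big big1 // => b _.
  under eq_bigr do rewrite -mulrA.
  by rewrite -mulr_sumr minors_null mulr0.
by rewrite -sumrB; apply: eq_bigr => c _; rewrite mulrA -hz -mulrBl.
Qed.

Lemma minors_saturated : primitive (minors A) -> saturated (ideal_gen (minors A)).
Proof.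
move=> pF p /choice [n hn].
have idI := ideal_gen_ideal (minors A).
have [N] := ubnP (\sum_i n i)%N; elim: N => // N IH in p n hn *; rewrite ltnS => hN.
apply: minors_saturated1 => // j.
have [nj|nj] := posnP (n j).
  by apply: (idealMl idI); have := hn j; rewrite nj expr0 mul1r.
apply: (IH _ (fun l => if l == j then (n j).-1 else n l)).
  move=> l; case: eqP => [->|_].
    by rewrite mulrA -exprSr prednK.
  by rewrite mulrCA; apply: (idealMl idI).
apply: leq_trans hN; rewrite [X in (_ < X)%N](bigD1 j) //= (bigD1 j) //= eqxx.
by rewrite (eq_bigr n) ?ltn_add2r ?prednK // => l /negPf ->.
Qed.

End HilbertBurch.

Section HomogeneousIdeals.
Context {k : fieldType}.
Local Notation S := {mpoly k[4]}.

Lemma ideal_gen_forms (J : finType) (F : J -> S) e d p : (forall c, F c \is e.-homog) ->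
  p \is (d + e).-homog -> ideal_gen F p ->
  exists r, (forall c, r c \is d.-homog) /\ p = \sum_c r c * F c.
Proof.
move=> hF hp [r er]; exists (fun c => pihomog mdeg d (r c)).
split=> [c|]; first exact: pihomogP.
rewrite -(pihomog_dE hp) {1}er raddf_sum /=; apply: eq_bigr => c _.
by rewrite (pihomogMr _ _ (hF c)).
Qed.

Lemma ideal_gen_lt (J : finType) (F : J -> S) e d p : (forall c, F c \is e.-homog) ->
  p \is d.-homog -> (d < e)%N -> ideal_gen F p -> p = 0.
Proof.
move=> hF hp de [r er]; rewrite -(pihomog_dE hp) er raddf_sum /= big1 // => c _.
by rewrite (pihomogMr_lt _ (hF c)).
Qed.

Lemma ideal_gen_homogeneous (J : finType) (F : J -> S) e : (forall c, F c \is e.-homog) ->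
  homogeneous (ideal_gen F).
Proof.
move=> hF p d [r ->]; rewrite raddf_sum /=.
have [de|ed] := ltnP d e.
  by rewrite big1 => [|c _]; [apply: ideal0; apply: ideal_gen_ideal
                             | rewrite (pihomogMr_lt _ (hF c))].
exists (fun c => pihomog mdeg (d - e) (r c)); apply: eq_bigr => c _.
by rewrite -{1}(subnK ed) (pihomogMr _ _ (hF c)).
Qed.

End HomogeneousIdeals.

(** * Graded pieces of an ideal *)

Section Vspaces.
Context {k : fieldType}.

Lemma hom_exists (aT rT : vectType k) (g : aT -> rT) : linear g ->
  exists f : 'Hom(aT, rT), forall v, f v = g v.
Proof.
move=> lg; pose G : {linear aT -> rT} := HB.pack g (GRing.isLinear.Build k aT rT _ g lg).
by exists (linfun G) => v; rewrite lfunE.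
Qed.

(** A subset of a finite-dimensional space that is stable under linear
    combinations is a subspace: take one of maximal dimension inside it. *)
Lemma vspace_of_pred (vT : vectType k) (P : vT -> Prop) :
  P 0 -> (forall c u v, P u -> P v -> P (c *: u + v)) ->
  exists U : {vspace vT}, forall v, v \in U <-> P v.
Proof.
move=> P0 PL.
pose Q n := `[< exists U : {vspace vT}, (forall v, v \in U -> P v) /\ \dim U = n >].
have exQ : exists n, Q n.
  exists 0%N; apply/asboolP; exists 0%VS; split; last exact: dimv0.
  by move=> v; rewrite memv0 => /eqP ->.
have bQ n : Q n -> (n <= \dim {:vT})%N.
  by move/asboolP => [U [_ <-]]; apply/dimvS/subvf.
case: (ex_maxnP exQ bQ) => n /asboolP [U [UP dU]] max.
exists U => v; split; first exact: UP.
move=> Pv; apply: contrapT => /negP vU.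
have : Q (\dim (U + <[v]>)).
  apply/asboolP; exists (U + <[v]>)%VS; split=> // w /memv_addP [u Uu [x /vlineP [c ->] ->]].
  by rewrite addrC; apply: PL => //; apply: UP.
move/max; rewrite -dU leqNgt => /negP; apply.
have [_ lt] := dimv_leqif_sup (addvSl U <[v]>).
rewrite ltn_neqAle dimvS ?addvSl // andbT lt.
by apply: contra vU => /subvP; apply; apply: (subvP (addvSr U <[v]>)); apply: memv_line.
Qed.

End Vspaces.

Section Pieces.
Context {k : fieldType}.
Local Notation S := {mpoly k[4]}.
Local Notation St d := (dhomog 4 k d).

Definition mk d (p : S) : St d := insubd (0 : St d) p.

Lemma mkK d p : p \is d.-homog -> mk d p = p :> S.
Proof. by move=> hp; rewrite /mk insubdK. Qed.

Lemma St_homog d (v : St d) : (v : S) \is d.-homog.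
Proof. exact: dhomog_is_dhomog. Qed.

Lemma St_inj d (u v : St d) : u = v :> S -> u = v.
Proof. exact: val_inj. Qed.

Lemma StL d (c : k) (u v : St d) : (c *: u + v : St d) = c *: (u : S) + v :> S.
Proof. by rewrite linearP. Qed.

Lemma dimSt d : \dim {: St d} = 'C(d + 3, 3).
Proof. by rewrite dimvf -[RHS]bin_sub ?leq_addl // addnK. Qed.

Lemma graded_hom d e (f : S -> S) : linear f ->
  (forall p, p \is d.-homog -> f p \is e.-homog) ->
  exists g : 'Hom(St d, St e), forall v, g v = f v :> S.
Proof.
move=> lf hf.
have H (v : St d) : f v \is e.-homog by apply: hf; apply: St_homog.
have [|g hg] := @hom_exists k (St d) (St e) (fun v => mk e (f v)).
  move=> c u v; apply: St_inj; rewrite (StL c (mk e _)).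
  by rewrite (mkK (H _)) (mkK (H u)) (mkK (H v)) StL lf.
by exists g => v; rewrite hg; apply: mkK.
Qed.

Lemma piece_exists (I : ideal k) d : is_ideal I ->
  exists U : {vspace St d}, forall v, v \in U <-> I v.
Proof.
move=> idI; apply: (vspace_of_pred (P := fun v : St d => I v)).
  by rewrite linear0; apply: ideal0.
by move=> c u v hu hv; rewrite StL; apply: (idealD idI) => //; apply: idealZ.
Qed.

Definition piece (I : ideal k) (idI : is_ideal I) d : {vspace St d} :=
  sval (cid (piece_exists d idI)).

Lemma pieceP (I : ideal k) (idI : is_ideal I) d (v : St d) :
  v \in piece idI d <-> I v.
Proof. by rewrite /piece; case: cid => U /= h; apply: h. Qed.

Lemma mem_piece (I : ideal k) (idI : is_ideal I) d p : p \is d.-homog ->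
  I p -> mk d p \in piece idI d.
Proof. by move=> hp Ip; apply/pieceP; rewrite mkK. Qed.

Lemma St_sum (J : Type) (r : seq J) (P : pred J) d (F : J -> St d) :
  (\sum_(j <- r | P j) F j : St d) = \sum_(j <- r | P j) (F j : S) :> S.
Proof. by rewrite (raddf_sum (@mpoly_of_dhomog _ _ _)). Qed.

Lemma hilbert_function_dim (I : ideal k) (idI : is_ideal I) d r :
  hilbert_function I d r -> (\dim (piece idI d) + r = 'C(d + 3, 3))%N.
Proof.
case=> e [he eP]; pose f i : St d := mk d (e i).
have fE i : f i = e i :> S by rewrite mkK //; apply: he.
pose X := [tuple f i | i < r].
have XE (c : 'I_r -> k) : \sum_i c i *: X`_i = \sum_i c i *: f i.
  by apply: eq_bigr => i _; rewrite -tnth_nth tnth_mktuple.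
have valX (c : 'I_r -> k) : (\sum_i c i *: f i : St d) = \sum_i c i *: e i :> S.
  by rewrite St_sum; apply: eq_bigr => i _; rewrite linearZ /= fE.
have key (c : 'I_r -> k) : I (\sum_i c i *: e i) -> forall i, c i = 0.
  have f0 : forms d (0 : S) by rewrite /forms rpred0.
  move=> Ic i; have [c0 [_ u]] := eP 0 f0.
  have c0E : c0 = 0.
    by apply: u; rewrite big1 ?subr0 => [|j _]; [apply: (ideal0 idI) | rewrite mxE scale0r].
  have : c0 = - \row_j c j.
    apply: u; rewrite sub0r -sumrN.
    by rewrite (eq_bigr (fun j => c j *: e j)) // => j _; rewrite !mxE scaleNr opprK.
  by rewrite c0E => /matrixP/(_ 0 i); rewrite !mxE => /esym/eqP; rewrite oppr_eq0 => /eqP.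
have freeX : free X.
  apply/freeP => c; rewrite XE => /(congr1 (@mpoly_of_dhomog _ _ _)).
  by rewrite valX linear0 => c0; apply: key; rewrite c0; apply: (ideal0 idI).
have cap0 : (piece idI d :&: <<X>> = 0)%VS.
  apply/eqP; rewrite -subv0; apply/subvP=> v; rewrite memv_cap => /andP [/pieceP Iv].
  move=> /coord_span ve; rewrite memv0 ve XE.
  rewrite ve XE valX in Iv.
  by apply/eqP; apply: big1 => i _; rewrite (key _ Iv) scale0r.
rewrite -dimSt.
have <- : (piece idI d + <<X>>)%VS = fullv.
  apply/eqP; rewrite eqEsubv subvf /=; apply/subvP=> v _.
  have [c [Ic _]] := eP v (St_homog v).
  have -> : v = (v - \sum_i c 0 i *: f i) + \sum_i c 0 i *: f i by rewrite subrK.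
  apply: memv_add; first by apply/pieceP; rewrite raddfB /= valX.
  by rewrite -XE; apply: memv_suml => i _; apply: memvZ; apply/memv_span/mem_nth; rewrite size_tuple.
by rewrite dimv_disjoint_sum // (eqnP freeX) size_tuple.
Qed.

Lemma dim_hilbert_function (I : ideal k) (idI : is_ideal I) d r :
  (\dim (piece idI d) + r = 'C(d + 3, 3))%N -> hilbert_function I d r.
Proof.
move=> hr; set U := piece idI d.
have dV : \dim (U^C) = r by rewrite dimv_compl dimSt -hr addKn.
move: (vbasis U^C) (vbasisP U^C); rewrite dV => X XP.
exists (fun i => X`_i : St d); split=> [i|v hv]; first exact: St_homog.
have [u Uu [w Ww vE]] : exists2 u, u \in U & exists2 w, w \in (U^C)%VS & mk d v = u + w.
  by apply/memv_addP; rewrite addv_complf memvf.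
have eX (c : 'rV[k]_r) :
    (\sum_i c 0 i *: X`_i : St d) = \sum_i c 0 i *: (X`_i : S) :> S.
  by rewrite St_sum; apply: eq_bigr => i _; rewrite linearZ.
exists (\row_i coord X i w); split.
  rewrite -eX; under eq_bigr do rewrite mxE.
  rewrite -(coord_basis XP Ww) -(mkK hv) vE raddfD /= addrK.
  by apply/pieceP.
move=> c hc; apply/rowP=> i; rewrite mxE.
have hU : mk d v - \sum_i c 0 i *: X`_i \in U.
  by apply/pieceP; rewrite raddfB /= mkK // eX.
have wE : w = \sum_i c 0 i *: X`_i.
  apply/eqP; rewrite -subr_eq0 -memv0 -(capv_compl U) memv_cap; apply/andP; split.
    have -> : w - \sum_i c 0 i *: X`_i = (mk d v - \sum_i c 0 i *: X`_i) - u.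
      by rewrite vE [u + w]addrC [w + u - _]addrAC addrK.
    by rewrite memvB.
  rewrite memvB // memv_suml // => j _; apply: memvZ.
  by rewrite -(span_basis XP) memv_span // mem_nth ?size_tuple.
rewrite wE linear_sum /= (bigD1 i) //= big1 ?addr0.
  by rewrite linearZ /= coord_free ?(basis_free XP) // eqxx mulr1.
by move=> j /negPf ji; rewrite linearZ /= coord_free ?(basis_free XP) // ji mulr0.
Qed.

End Pieces.

(** * Determinantal ideals in the Hilbert scheme *)

Section Determinantal.
Context {k : fieldType}.
Local Notation S := {mpoly k[4]}.
Local Notation St d := (dhomog 4 k d).

Context (A : 'M[S]_(4, 5)) (hA : forall b c, A b c \is 1.-homog).
Context (pF : primitive (minors A)).
Local Notation I := (ideal_gen (minors A)).
Let idI : is_ideal I := ideal_gen_ideal (minors A).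

Lemma dhomog_minors4 c : minors A c \is 4.-homog.
Proof. exact: (@dhomog_minors _ 4 1). Qed.

Lemma dim_ffunSt n d : \dim {: {ffun 'I_n -> St d}} = (n * 'C(d + 3, 3))%N.
Proof. by rewrite dimvf /dim /= card_ord -(@dimSt k d) dimvf. Qed.

Lemma ffunL n d c (u v : {ffun 'I_n -> St d}) i :
  ((c *: u + v) i : S) = c *: (u i : S) + v i.
Proof. by rewrite !ffunE StL. Qed.

(** The resolution 0 -> S(-5)^4 -> S(-4)^5 -> I -> 0, in degree t + 5. *)
Lemma dim_minors t :
  (\dim (piece idI (t + 5)) + 4 * 'C(t + 3, 3) = 5 * 'C(t + 4, 3))%N.
Proof.
pose f (p : {ffun 'I_5 -> St (t + 1)}) : S := \sum_c (p c : S) * minors A c.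
pose g (q : {ffun 'I_4 -> St t}) c : S := \sum_b (q b : S) * A b c.
have hf p : f p \is (t + 5).-homog.
  apply: rpred_sum => c _; have -> : (t + 5 = t + 1 + 4)%N by lia.
  by apply: dhomogM; [apply: St_homog | apply: dhomog_minors4].
have hg q c : g q c \is (t + 1).-homog.
  by apply: rpred_sum => b _; apply: dhomogM => //; apply: St_homog.
have [|phi hphi] := @hom_exists k _ _ (fun p => mk (t + 5) (f p)).
  move=> c u v; apply: St_inj; rewrite StL !(mkK (hf _)) /f scaler_sumr -big_split.
  by apply: eq_bigr => i _; rewrite ffunL mulrDl scalerAl.
have [|psi hpsi] := @hom_exists k _ _ (fun q => [ffun c => mk (t + 1) (g q c)]).
  move=> c u v; apply/ffunP=> i; apply: St_inj; rewrite ffunL !ffunE !(mkK (hg _ _)).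
  rewrite /g scaler_sumr -big_split.
  by apply: eq_bigr => b _; rewrite ffunL mulrDl scalerAl.
have [c0 F0] := primitive_neq0 ord0 pF.
have im : limg phi = piece idI (t + 5).
  apply/eqP; rewrite eqEsubv; apply/andP; split; apply/subvP=> v.
    move=> /memv_imgP [p _ ->]; rewrite hphi; apply/pieceP; rewrite mkK //.
    by exists (fun c => p c : S).
  move=> /pieceP Iv.
  have [] := @ideal_gen_forms _ _ (minors A) 4 (t + 1) v dhomog_minors4 _ Iv.
    by rewrite -addnA; apply: St_homog.
  move=> r [hr e]; apply/memv_imgP; exists [ffun c => mk (t + 1) (r c)]; first exact: memvf.
  apply: St_inj; rewrite hphi mkK // e /f; apply: eq_bigr => c _.
  by rewrite ffunE mkK.
have ker : lker phi = limg psi.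
  apply/eqP; rewrite eqEsubv; apply/andP; split; apply/subvP=> v.
    rewrite memv_ker hphi => /eqP /(congr1 (@mpoly_of_dhomog _ _ _)); rewrite mkK // => e.
    have [q hq] := hilbert_burch pF e.
    apply/memv_imgP; exists [ffun b => mk t (pihomog mdeg t (q b))]; first exact: memvf.
    rewrite hpsi; apply/ffunP=> c; apply: St_inj; rewrite ffunE mkK //.
    rewrite -(pihomog_dE (St_homog (v c))) hq raddf_sum /=; apply: eq_bigr => b _.
    by rewrite ffunE mkK ?pihomogP // (pihomogMr _ _ (hA b c)).
  move=> /memv_imgP [q _ ->]; rewrite memv_ker hphi hpsi; apply/eqP/St_inj.
  rewrite mkK // /f linear0.
  under eq_bigr do rewrite ffunE mkK // mulr_suml.
  rewrite exchange_big big1 // => b _.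
  by under eq_bigr do rewrite -mulrA; rewrite -mulr_sumr minors_null mulr0.
have inj : (lker psi = 0)%VS.
  apply/eqP; rewrite -subv0; apply/subvP=> q; rewrite memv_ker memv0 hpsi => /eqP e.
  apply/eqP/ffunP=> b; apply: St_inj; rewrite !ffunE linear0.
  apply: (rows_independent (A := A) (q := fun b => q b : S) F0) => j.
  by move/ffunP/(_ j): e; rewrite !ffunE => /(congr1 (@mpoly_of_dhomog _ _ _)); rewrite mkK.
have d1 := limg_ker_dim phi fullv; have d2 := limg_ker_dim psi fullv.
move: d1 d2; rewrite !capfv im ker inj !dim_ffunSt dimv0 add0n => d1 d2.
by rewrite d2 addnC -addnA in d1.
Qed.

Lemma minors_Hilb : Hilb 10 11 I.
Proof.
split=> //; first exact: ideal_gen_homogeneous dhomog_minors4.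
  exact: minors_saturated.
exists 5%N => t; case: (leqP 5 t) => // /subnK <- _; set u := (t - 5)%N.
apply: (dim_hilbert_function (idI := idI)).
have := dim_minors u.
rewrite -[(u + 5 + 3)%N]addnA !addnS !addn0 !binS !bin0.
rewrite !bin1; move: (\dim _) 'C(u, 3) 'C(u, 2) => D b3 b2; lia.
Qed.

End Determinantal.

(** * Evaluation points and coordinate changes *)

Section NonRoot.
Context {k : fieldType}.
Context (k_char0 : [pchar k] =i pred0).

Lemma natr_inj_char0 : injective (fun n : nat => n%:R : k).
Proof.
have H m n : (m <= n)%N -> m%:R = n%:R :> k -> m = n.
  move=> mn /eqP; rewrite eq_sym -subr_eq0 -natrB // => /eqP e.
  by have := (pcharf0P k).1 k_char0 (n - m)%N; rewrite e eqxx => /esym; lia.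
move=> m n; case: (leqP m n) => [|/ltnW] h e; first exact: H.
by apply/esym/H.
Qed.

Lemma poly_nonroot (p : {poly k}) : p != 0 -> exists x, p.[x] != 0.
Proof.
move=> p0; apply: contrapT => H.
have r x : root p x by apply: contrapT => /negP px; apply: H; exists x.
have := max_poly_roots p0 (rs := [seq i%:R | i <- iota 0 (size p)]).
rewrite size_map size_iota ltnn => H'; have : false; last by [].
apply: H'; first by apply/allP => x _; apply: r.
by rewrite map_inj_uniq ?iota_uniq //; apply: natr_inj_char0.
Qed.

Lemma muni_varE n (i : 'I_n.+1) : muni ('X_i : {mpoly k[n.+1]}) =
  if unlift ord_max i is Some j then ('X_j)%:P else 'X.
Proof.
rewrite muniE msuppX big_seq1 mcoeffX eqxx scale1r.
case: unliftP => [j ->|->].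
  have -> : U_(lift ord_max j)%MM ord_max = 0%N :> nat.
    by rewrite mnm1E eq_sym; have := neq_lift ord_max j => /negPf ->.
  rewrite expr0 -mul_polyC mulr1; congr (mpolyX _ _)%:P; apply/mnmP=> l.
  rewrite mnmE !mnm1E; congr nat_of_bool; apply/eqP/eqP => [/(congr1 val) /= |->].
    by rewrite /bump leqNgt ltn_ord add0n => /val_inj.
  by apply: val_inj => /=; rewrite /bump leqNgt ltn_ord add0n.
rewrite mnm1E eqxx expr1 -mul_polyC.
have -> : [multinom U_(ord_max)%MM (widen_ord (leqnSn n) i0) | i0 < n] = 0%MM.
  apply/mnmP=> l; rewrite mnmE mnm0E mnm1E; case: eqP => // /(congr1 val) /= e.
  by have := ltn_ord l; rewrite -e ltnn.
by rewrite mpolyX0 mul1r.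
Qed.

Lemma muni_eq0 n (p : {mpoly k[n.+1]}) : muni p = 0 -> p = 0.
Proof.
suff back : (map_poly (@mwiden n k) (muni p)).['X_ord_max] = p.
  by move=> e; rewrite -back e map_poly0 horner0.
elim/mpoly_ring_ind: p => [c|i|p q hp hq|p q hp hq].
- by rewrite muniC map_polyC /= mwidenC hornerC.
- rewrite muni_varE; case: unliftP => [j ->|->].
    rewrite map_polyC /= mwidenX mnmwiden1 hornerC; congr (mpolyX _ U_(_)%MM).
    by apply: val_inj => /=; rewrite /bump leqNgt ltn_ord add0n.
  by rewrite map_polyX hornerX.
- by rewrite muniD (rmorphD (map_poly (@mwiden n k))) hornerD; congr (_ + _).
- by rewrite muniM (rmorphM (map_poly (@mwiden n k))) hornerM; congr (_ * _).
Qed.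

Lemma meval_muni n (p : {mpoly k[n.+1]}) (v : 'I_n -> k) c :
  (map_poly (meval v) (muni p)).[c] =
  p.@[fun i => if unlift ord_max i is Some j then v j else c].
Proof.
elim/mpoly_ring_ind: p => [a|i|p q hp hq|p q hp hq].
- by rewrite muniC map_polyC /= !mevalC hornerC.
- rewrite muni_varE mevalXU; case: unlift => [j|].
    by rewrite map_polyC /= mevalXU hornerC.
  by rewrite map_polyX hornerX.
- by rewrite muniD (rmorphD (map_poly (meval v))) /= hornerD mevalD; congr (_ + _).
- by rewrite muniM (rmorphM (map_poly (meval v))) /= hornerM mevalM; congr (_ * _).
Qed.

(** A nonzero polynomial does not vanish identically over an infinite field, by induction
    on the number of variables. *)
Lemma mpoly_nonroot n (p : {mpoly k[n]}) : p != 0 -> exists v, p.@[v] != 0.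
Proof.
elim: n p => [|n IH] p p0.
  exists (fun=> 0); move: p0; rewrite (nvar0_mpolyC p) mevalC.
  by apply: contraNneq => ->; rewrite mpolyC0.
have q0 : muni p != 0 by apply: contraNneq p0 => /muni_eq0 ->.
have lc0 : lead_coef (muni p) != 0 by rewrite lead_coef_eq0.
have [v hv] := IH _ lc0.
have /poly_nonroot [c hc] : map_poly (meval v) (muni p) != 0.
  apply: contraNneq hv => e; rewrite /lead_coef.
  by have := congr1 (fun q : {poly k} => q`_(size (muni p)).-1) e; rewrite coef_map coef0 /= => ->.
by rewrite meval_muni in hc; eexists; apply: hc.
Qed.

End NonRoot.

Section CoordinateChange.
Context {k : fieldType}.
Local Notation S := {mpoly k[4]}.
Implicit Types (I : ideal k) (A B : 'M[k]_4).

Lemma lsubK A p : A \in unitmx -> lsub A (lsub (invmx A) p) = p.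
Proof. by move=> uA; rewrite lsub_comp mulVmx // lsub1. Qed.

Lemma lsubVK A p : A \in unitmx -> lsub (invmx A) (lsub A p) = p.
Proof. by move=> uA; rewrite lsub_comp mulmxV // lsub1. Qed.

(** An integral arithmetically Cohen-Macaulay curve, by properties that are visibly stable
    under changes of coordinates. *)
Record curve_ideal I : Prop := CurveIdeal {
  ci_ideal : is_ideal I;
  ci_homog : homogeneous I;
  ci_prime : prime_ideal I;
  ci_ACM : arith_CM_curve I;
  ci_hilb : exists t0, forall t, (t0 <= t)%N -> hilbert_function I t (10 * t + 1 - 11) }.

Lemma curve_ideal_lsub I A : A \in unitmx -> curve_ideal I ->
  curve_ideal (fun p => I (lsub A p)).
Proof.
move=> uA [idI homI [I1 primI] [l1 [l2 [d1 [d2 [f1 f2 r1 r2]]]]] [t0 hf]]; split.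
- split=> [|p q hp hq|p q hq]; first by rewrite rmorph0; apply: (ideal0 idI).
    by rewrite rmorphD; apply: (idealD idI).
  by rewrite rmorphM; apply: (idealMl idI).
- by move=> p d hp; rewrite -pihomog_lsub; apply: homI.
- by split=> [|p q]; [rewrite rmorph1 | rewrite rmorphM; apply: primI].
- exists (lsub (invmx A) l1), (lsub (invmx A) l2), d1, d2; split.
  + exact: dhomog_lsub.
  + exact: dhomog_lsub.
  + by move=> p; rewrite rmorphM /= lsubK //; apply: r1.
  + move=> p [q]; rewrite rmorphB !rmorphM /= !lsubK // => h.
    have [|q' hq'] := r2 (lsub A p); first by exists (lsub A q).
    by exists (lsub (invmx A) q'); rewrite rmorphB rmorphM /= !lsubK.
- exists t0 => t /hf [e [he eP]]; exists (fun i => lsub (invmx A) (e i)).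
  split=> [i|v hv]; first by apply: dhomog_lsub; apply: he.
  have [c [hc uc]] := eP (lsub A v) (dhomog_lsub A hv).
  have E (c' : 'rV[k]_(10 * t + 1 - 11)%N) : lsub A (v - \sum_i c' 0 i *: lsub (invmx A) (e i))
      = lsub A v - \sum_i c' 0 i *: e i.
    rewrite rmorphB (rmorph_sum (lsub A)) /=; congr (_ - _); apply: eq_bigr => i _.
    by rewrite lsubZ lsubK.
  by exists c; split=> [|c']; rewrite E //; apply: uc.
Qed.

(** Any point is a coordinate point in suitable coordinates. *)
Lemma complete_column n (v : 'cV[k]_n.+1) : v != 0 ->
  exists2 B, B \in unitmx & col 0 B = v.
Proof.
move=> v0; pose w := v^T; have w0 : w != 0.
  by apply: contraNneq v0 => w0; rewrite -[v]trmxK -/w w0 trmx0.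
have rw : \rank w = 1%N by apply/eqP; rewrite eqn_leq rank_leq_row lt0n mxrank_eq0.
pose c := col_ebase w 0 0.
have c0 : c != 0.
  have := col_ebase_unit w; rewrite unitmxE det_mx11 unitfE; exact.
exists (c *: row_ebase w)^T.
  by rewrite unitmx_tr unitmxZ ?row_ebase_unit // unitfE.
apply/colP=> i; rewrite !mxE.
have /matrixP/(_ 0 i) := mulmx_ebase w; rewrite rw [in RHS]mxE => <-.
rewrite -mulmxA mxE big_ord1 -/c; congr (_ * _).
rewrite mxE (bigD1 0) //= big1 ?addr0 ?mxE ?mul1r // => j j0.
by rewrite mxE -val_eqE /= in j0 *; rewrite eq_sym (negPf j0) mul0r.
Qed.

Lemma meval_lsub A p v : (lsub A p).@[v] = p.@[fun i => \sum_j A i j * v j].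
Proof.
elim/mpoly_ring_ind: p => [a|i|p q hp hq|p q hp hq].
- by rewrite lsubC !mevalC.
- rewrite lsubX mevalXU (raddf_sum (meval v)); apply: eq_bigr => j _ /=.
  by rewrite mevalZ mevalXU.
- by rewrite !rmorphD /= hp hq.
- by rewrite !rmorphM /= hp hq.
Qed.

Lemma subst_const (v : 'I_4 -> k) p : subst (fun i => (v i)%:MP) p = (p.@[v])%:MP.
Proof.
elim/mpoly_ring_ind: p => [a|i|p q hp hq|p q hp hq].
- by rewrite substC !mevalC.
- by rewrite substX mevalXU.
- by rewrite !rmorphD /= hp hq.
- by rewrite !rmorphM /= hp hq.
Qed.

Lemma subst_ray (u : S) (v : 'I_4 -> k) p d : p \is d.-homog ->
  subst (fun i => u * (v i)%:MP) p = u ^+ d * (p.@[v])%:MP.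
Proof. by move=> hp; rewrite (subst_scale _ _ hp) subst_const. Qed.

Lemma form_decomp d p : p \is d.+1.-homog -> exists l : 'I_4 -> S,
  (forall i, l i \is d.-homog) /\ p = \sum_i 'X_i * l i.
Proof.
move=> hp; have [c [l e]] : exists c (l : 'I_4 -> S), p = c%:MP + \sum_i 'X_i * l i.
  elim/mpoly_ring_ind: p {hp} => [c|i|p q [c [l ->]] [c' [l' ->]]|p q [c [l ->]] [c' [l' ->]]].
  - by exists c, (fun=> 0); rewrite big1 ?addr0 // => i _; rewrite mulr0.
  - exists 0, (fun j => (j == i)%:R); rewrite mpolyC0 add0r (bigD1 i) //= eqxx mulr1.
    by rewrite big1 ?addr0 // => j /negPf ->; rewrite mulr0.
  - exists (c + c'), (fun i => l i + l' i); rewrite mpolyCD.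
    under [in RHS]eq_bigr do rewrite mulrDr.
    by rewrite big_split /=; ring.
  - exists (c * c'), (fun i => l i * (c'%:MP + \sum_i 'X_i * l' i) + c%:MP * l' i).
    under [in RHS]eq_bigr do rewrite mulrDr mulrA mulrCA.
    by rewrite big_split /= -mulr_suml -mulr_sumr mpolyCM; ring.
exists (fun i => pihomog mdeg d (l i)); split=> [i|]; first exact: pihomogP.
rewrite -(pihomog_dE hp) {1}e raddfD /= (@pihomog_ne0 _ _ mdeg 0) ?add0r; first last.
- by rewrite -alg_mpolyC; apply: dhomogZ; apply: dhomog1.
- by [].
rewrite raddf_sum /=; apply: eq_bigr => i _.
rewrite mulrC -[d.+1]addn1 pihomogMr 1?mulrC //.
by rewrite dhomogX /= mdeg1.
Qed.

End CoordinateChange.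

(** * Noether normalisation of a curve *)

Section Noether.
Context {k : fieldType}.
Local Notation S := {mpoly k[4]}.
Local Notation St d := (dhomog 4 k d).
Implicit Types (I J : ideal k) (A B : 'M[k]_4) (p f g : S).

Definition e0 : 'I_4 -> k := fun i => (i == i0)%:R.

Lemma sum_e0 A i : \sum_j A i j * e0 j = A i i0.
Proof.
rewrite (bigD1 i0) //= big1 => [|j j0]; first by rewrite /e0 eqxx mulr1 addr0.
by rewrite /e0 (negPf j0) mulr0.
Qed.

(** J restricts onto all binary forms of high degree, which is the algebraic form of the
    statement that the line x_2 = x_3 = 0 misses the zero set of J. *)
Definition misses_line J : Prop := exists t1, forall t p, (t1 <= t)%N -> p \is t.-homog ->
  exists q, [/\ q \is t.-homog, J q & lsub line p = lsub line q].

Lemma lsub_ray A p d (u : S) (v : 'I_4 -> k) : p \is d.-homog ->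
  (forall i, lsub A 'X_i = u * (v i)%:MP) -> lsub A p = u ^+ d * (p.@[v])%:MP.
Proof.
move=> hp h; rewrite -(subst_ray u v hp) -{1}[p]subst_id.
rewrite [lsub A _]subst_comp; apply: subst_eq => i.
by rewrite -h.
Qed.

Lemma line_point p d : p \is d.-homog ->
  lsub (kill i1) (lsub line p) = 'X_i0 ^+ d * (p.@[e0])%:MP.
Proof.
move=> hp; rewrite lsub_comp; apply: lsub_ray => // i.
rewrite -lsub_comp lineX /e0; case: i => [[|[|[|[|//]]]]] hi /=.
- rewrite lsub_killX /= mpolyC1 mulr1; congr (mpolyX _ U_(_)%MM).
  exact: val_inj.
- by rewrite lsub_killX /= mpolyC0 mulr0.
- by rewrite rmorph0 mpolyC0 mulr0.
- by rewrite rmorph0 mpolyC0 mulr0.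
Qed.

Lemma meval_kill i p (v : 'I_4 -> k) :
  (lsub (kill i) p).@[v] = p.@[fun j => if j == i then 0 else v j].
Proof.
elim/mpoly_ring_ind: p => [a|j|p q hp hq|p q hp hq].
- by rewrite lsubC !mevalC.
- by rewrite lsub_killX [RHS]mevalXU; case: eqP => _; rewrite ?meval0 ?mevalXU.
- by rewrite !rmorphD /= hp hq.
- by rewrite !rmorphM /= hp hq.
Qed.

Lemma homogXn (i : 'I_4) n : ('X_i ^+ n : S) \is n.-homog.
Proof.
by have := @dhomogMn _ _ mdeg 1 ('X_i : S) n; rewrite mul1n; apply; rewrite dhomogX /= mdeg1.
Qed.

Lemma homog_eval0 p d : p \is d.+1.-homog -> p.@[fun=> 0] = 0.
Proof.
move=> /form_decomp [l [_ ->]]; rewrite raddf_sum /= big1 // => i _.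
by rewrite mevalM mevalXU mul0r.
Qed.

(** If f is nonzero at the point (1, 0, 0, 0), then x_0^(n + e) is f times a power of x_0
    modulo x_1, so on the line every form is congruent to one divisible by a high power of
    x_1; and that power is the restriction of a multiple of g. *)
Lemma misses_line_forms J f g e e' c : is_ideal J ->
  f \is e.-homog -> J f -> f.@[e0] != 0 ->
  g \is e'.-homog -> J g -> c != 0 -> lsub line g = 'X_i1 ^+ e' * c%:MP ->
  misses_line J.
Proof.
move=> idJ hf Jf f0 hg Jg c0 eg.
have [X0 X1] : lsub line 'X_i0 = 'X_i0 :> S /\ lsub line 'X_i1 = 'X_i1 :> S.
  by rewrite !lineX.
have hX (i : 'I_4) : ('X_i : S) \is 1.-homog by rewrite dhomogX /= mdeg1.
have key n : forall p, p \is (e + n)%N.-homog -> exists q r,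
    [/\ q \is (e + n)%N.-homog, J q, r \is e.-homog &
        lsub line p = lsub line q + 'X_i1 ^+ n * lsub line r].
  elim: n => [|n IH] p hp.
    exists 0, p; rewrite addn0 in hp; split=> //; first by rewrite rpred0.
      exact: ideal0.
    by rewrite rmorph0 add0r mul1r.
  pose al := p.@[e0] / f.@[e0].
  have hXf : al *: ('X_i0 ^+ n.+1 * f) \is (e + n.+1)%N.-homog.
    by apply: dhomogZ; rewrite addnC; apply: dhomogM => //; apply: homogXn.
  pose w := p - al *: ('X_i0 ^+ n.+1 * f).
  have hw : w \is (e + n.+1)%N.-homog by rewrite rpredB.
  have kw : lsub (kill i1) (lsub line w) = 0.
    rewrite (line_point hw) /w mevalB mevalZ mevalM rmorphXn /= mevalXU.
    by rewrite /e0 eqxx expr1n mul1r divfK // subrr mpolyC0 mulr0.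
  have hsw : lsub line w \is (e + n).+1.-homog by rewrite -addnS; apply: dhomog_lsub.
  have [u hu eu] := kill_homog hsw kw.
  have su : lsub line u = u.
    by apply: (mulfI (mpolyX_neq0 i1)); rewrite -eu -{1}X1 -rmorphM /= -eu line_idem.
  have [q [r [hq Jq hr]]] := IH u hu; rewrite su => e1.
  exists (al *: ('X_i0 ^+ n.+1 * f) + 'X_i1 * q), r; split=> //.
  - apply: rpredD; first exact: hXf.
    have -> : (e + n.+1 = 1 + (e + n))%N by rewrite add1n addnS.
    exact: dhomogM.
  - by apply: (idealD idJ); [apply/(idealZ idJ)/(idealMl idJ) | apply: (idealMl idJ)].
  rewrite rmorphD rmorphM /= X1.
  have -> : p = w + al *: ('X_i0 ^+ n.+1 * f) by rewrite subrK.
  by rewrite rmorphD /= eu e1 (exprS 'X_i1); ring.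
exists (e + e')%N => t p le hp.
have le1 : (e <= t)%N by apply: leq_trans le; apply: leq_addr.
have le2 : (e' <= t - e)%N by rewrite leq_subRL.
rewrite -(subnKC le1) in hp; have [q [r [hq Jq hr eqr]]] := key _ _ hp.
exists (q + c^-1 *: ('X_i1 ^+ (t - e - e') * g * r)); split.
- rewrite subnKC // in hq; rewrite rpredD //; apply: dhomogZ.
  have h : 'X_i1 ^+ (t - e - e') * g * r \is (t - e - e' + e' + e)%N.-homog.
    by apply: dhomogM => //; apply: dhomogM => //; apply: homogXn.
  by rewrite !subnK in h.
- apply: (idealD idJ) => //; apply: (idealZ idJ); apply: (idealMr idJ).
  exact: (idealMl idJ).
rewrite eqr rmorphD /= lsubZ !rmorphM rmorphXn /= X1 eg; congr (_ + _).
rewrite -{1}(subnK le2) exprD -mul_mpolyC.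
have cc : (c^-1)%:MP * c%:MP = 1 :> S by rewrite -mpolyCM mulVf // mpolyC1.
rewrite -[LHS]mul1r -cc; ring.
Qed.

Context (k_char0 : [pchar k] =i pred0).

(** The Hilbert polynomial grows linearly and the number of forms cubically. *)
Lemma curve_small_form I t0 : curve_ideal I -> exists t f,
  [/\ (t0 <= t)%N, f \is t.+1.-homog, I f & f != 0].
Proof.
move=> [idI _ _ _ [t1 hf]].
pose t := (maxn t0 t1 + 20)%N.
have l0 : (t0 <= t)%N by rewrite /t; lia.
have l1 : (t1 <= t.+1)%N by rewrite /t; lia.
have := hilbert_function_dim idI (hf _ l1).
have l20 : (20 <= t)%N by rewrite /t; lia.
have : (10 * t.+1 + 1 - 11 < 'C(t.+1 + 3, 3))%N.
  move: l20; clearbody t => {l0 l1}; elim: t => // t IH.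
  rewrite leq_eqVlt => /orP [/eqP <- //|]; rewrite ltnS => /[dup] h20 /IH {IH}.
  rewrite [in X in _ -> X]addSn [in X in _ -> X]binS.
  have : (10 <= 'C(t.+1 + 3, 2))%N.
    by rewrite addnS binS bin1 addSn; apply: leq_trans (leq_addl _ _); lia.
  by move: 'C(_, 3) 'C(_, 2) => u v; lia.
move=> lt dimE.
exists t, (vpick (piece idI t.+1) : St t.+1); split=> //.
- exact: St_homog.
- by apply/(pieceP idI)/memv_pick.
- have : piece idI t.+1 != 0%VS by rewrite -dimv_eq0; lia.
  by rewrite -vpick0; apply: contraNneq => e; apply/eqP/St_inj; rewrite e linear0.
Qed.

(** The forms not involving x_0 have quadratic growth, so they meet the ideal: this is the
    cone over the projection of the curve from the point (1, 0, 0, 0). *)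
Lemma curve_cone_form J t0 : curve_ideal J -> exists t g,
  [/\ (t0 <= t)%N, g \is t.+1.-homog, J g, g != 0 & lsub (kill i0) g = g].
Proof.
move=> [idJ _ _ _ [t1 hf]].
pose t := (maxn t0 t1 + 20)%N.
have l0 : (t0 <= t)%N by rewrite /t; lia.
have l1 : (t1 <= t.+1)%N by rewrite /t; lia.
have dimE := hilbert_function_dim idJ (hf _ l1).
have l20 : (20 <= t)%N by rewrite /t; lia.
have lt : (10 * t.+1 + 1 - 11 < 'C(t + 3, 2))%N.
  move: l20; clearbody t => {l0 l1 dimE}; elim: t => // t IH.
  rewrite leq_eqVlt => /orP [/eqP <- //|]; rewrite ltnS => /[dup] h20 /IH {IH}.
  rewrite [in X in _ -> X]addSn [in X in _ -> X]binS.
  by rewrite bin1; lia.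
have lK : linear (lsub (kill i0) : S -> S) by move=> c u v; rewrite rmorphD /= lsubZ.
have [K hK] := graded_hom lK (fun p => @dhomog_lsub k (kill i0) p t.+1).
have lM : linear (fun p : S => 'X_i0 * p) by move=> c u v; rewrite mulrDr scalerAr.
have hM1 p : p \is t.-homog -> 'X_i0 * p \is t.+1.-homog.
  by move=> hp; rewrite -[t.+1]add1n; apply: dhomogM => //; rewrite dhomogX /= mdeg1.
have [M hM] := graded_hom lM hM1.
have kerK : (lker K <= limg M)%VS.
  apply/subvP=> v; rewrite memv_ker => /eqP /(congr1 (@mpoly_of_dhomog _ _ _)).
  rewrite hK linear0 => /(kill_homog (St_homog v)) [q hq e].
  apply/memv_imgP; exists (mk t q); first exact: memvf.
  by apply: St_inj; rewrite hM mkK.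
have dM : (\dim (lker K) <= 'C(t + 3, 3))%N.
  apply: leq_trans (dimvS kerK) _; rewrite -(@dimSt k t).
  by rewrite -(limg_ker_dim M fullv) leq_addl.
have dK := limg_ker_dim K fullv; rewrite capfv dimSt addSn binS in dK.
have dS := dimv_sum_cap (piece idJ t.+1) (limg K).
have dle : (\dim (piece idJ t.+1 + limg K) <= 'C(t.+1 + 3, 3))%N.
  by rewrite -(@dimSt k); apply/dimvS/subvf.
rewrite addSn binS in dimE dle.
set g := vpick (piece idJ t.+1 :&: limg K).
have : g \in (piece idJ t.+1 :&: limg K)%VS by apply: memv_pick.
rewrite memv_cap => /andP [/pieceP Jg /memv_imgP [h _ eg]].
have g0 : g != 0.
  rewrite vpick0 -dimv_eq0; move: dimE dM dK dS dle lt; clear.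
  move: (\dim (_ + _)) (\dim (_ :&: _)) (\dim (piece _ _)) (\dim (lker _)) (\dim (limg _)).
  move: 'C(_, 3) 'C(_, 2) => a b c d e f g; lia.
exists t, (g : St t.+1); split=> //.
- exact: St_homog.
- by rewrite eg hK lsub_comp kill_idem.
Qed.

(** Two projections: from a point off a surface containing the curve, then from a point off
    the cone over the projected curve.  The line joins the two points. *)
Lemma noether I : curve_ideal I -> exists2 A, A \in unitmx &
  misses_line (fun p => I (lsub A p)).
Proof.
move=> cI.
have [e [f [_ hf If f0]]] := curve_small_form 0 cI.
have [a fa] := mpoly_nonroot k_char0 f0.
have a0 : \col_i a i != 0 :> 'cV[k]_4.
  apply: contraNneq fa => a0; rewrite -(homog_eval0 hf); apply/eqP/meval_eq => i.
  by have /colP/(_ i) := a0; rewrite !mxE.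
have [B uB cB] := complete_column a0.
have uB' : invmx B \in unitmx by rewrite unitmx_inv.
have cJ := curve_ideal_lsub uB' cI.
set J := (fun p : S => I (lsub (invmx B) p)) in cJ.
have [e' [g [_ hg Jg g0 kg]]] := curve_cone_form 0 cJ.
have [b gb] := mpoly_nonroot k_char0 g0.
pose w : 'cV[k]_3 := \col_i b (lift i0 i).
pose b' i := if i == i0 then 0 else b i.
have gb' : g.@[b'] != 0.
  by rewrite -kg meval_kill in gb.
have w0 : w != 0.
  apply: contraNneq gb' => w0; rewrite -(homog_eval0 hg); apply/eqP/meval_eq => i.
  rewrite /b'; case: (unliftP i0 i) => [j|] -> //.
  rewrite eq_sym (negPf (neq_lift _ _)).
  by have /colP/(_ j) := w0; rewrite !mxE.
have [B3 uB3 cB3] := complete_column w0.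
pose B2 : 'M[k]_(1 + 3) := block_mx 1%:M 0 0 B3.
have uB2 : B2 \in unitmx.
  by rewrite unitmxE det_ublock unitrM -!unitmxE unitmx1 uB3.
have B20 (i : 'I_4) : B2 i i0 = (i == i0)%:R.
  case: (@splitP 1 3 i) => j ij.
    have -> : i = lshift 3 j by apply: val_inj.
    have -> : i0 = lshift 3 (0 : 'I_1) by apply: val_inj.
    by rewrite block_mxEul mxE !ord1.
  have -> : i = rshift 1 j by apply: val_inj.
  have -> : i0 = lshift 3 (0 : 'I_1) by apply: val_inj.
  by rewrite block_mxEdl mxE.
have B21 (i : 'I_4) : B2 i i1 = b' i.
  have e1 : i1 = rshift 1 (0 : 'I_3) by apply: val_inj.
  rewrite e1; case: (@splitP 1 3 i) => j ij.
    have -> : i = lshift 3 j by apply: val_inj.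
    by rewrite block_mxEur mxE /b' !ord1.
  have -> : i = rshift 1 j by apply: val_inj.
  rewrite block_mxEdr; have /colP/(_ j) := cB3; rewrite !mxE => ->.
  rewrite /b'; have -> : lift i0 j = rshift 1 j by apply: val_inj.
  by [].
(* B moves a to the first coordinate point; B2 fixes that point and moves b, with its
   first coordinate set to 0, to the second one. *)
exists (invmx B2 *m invmx B); first by rewrite unitmx_mul unitmx_inv uB2.
have lineE i : lsub line (lsub B2 'X_i) = 'X_i0 * (B2 i i0)%:MP + 'X_i1 * (B2 i i1)%:MP.
  rewrite lsubX (raddf_sum (lsub line)) (bigD1 i0) //= (bigD1 i1) //= big1 => [|j].
    by rewrite addr0 !lsubZ !lineX /= -!mul_mpolyC; congr (_ + _); apply: mulrC.
  rewrite lsubZ lineX => /andP [j0 j1]; suff -> : (j == i2) || (j == i3) by rewrite scaler0.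
  by case: j j0 j1 => [[|[|[|[|]]]]].
have -> : (fun p => I (lsub (invmx B2 *m invmx B) p)) = (fun p => J (lsub (invmx B2) p)).
  by apply/funext => p; rewrite /J lsub_comp.
have uB2' : invmx B2 \in unitmx by rewrite unitmx_inv.
have [idJ2 _ _ _ _] := curve_ideal_lsub uB2' cJ.
apply: (misses_line_forms (f := lsub B2 (lsub B f)) (g := lsub B2 g) idJ2 (c := g.@[b'])).
- by apply: dhomog_lsub; apply: dhomog_lsub; apply: hf.
- by rewrite /J lsubVK // lsubVK.
- rewrite !meval_lsub; apply: contraNneq fa => <-; apply/eqP/meval_eq => i.
  have /colP/(_ i) := cB; rewrite !mxE => <-.
  by under eq_bigr do rewrite sum_e0 B20; rewrite (sum_e0 B).
- by apply: dhomog_lsub; apply: hg.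
- by rewrite /= lsubVK.
- exact: gb'.
rewrite -{1}kg !lsub_comp; apply: (lsub_ray hg) => i.
rewrite -lsub_comp lsub_killX -lsub_comp; have [i_0|i_0] := eqVneq i i0.
  by rewrite !rmorph0 /b' i_0 eqxx mpolyC0 mulr0.
by rewrite lineE B20 B21 (negPf i_0) mpolyC0 mulr0 add0r.
Qed.

End Noether.

(** * Regular sequences modulo the ideal of a curve *)

Section Multiplication.
Context {k : fieldType}.
Local Notation S := {mpoly k[4]}.
Local Notation St d := (dhomog 4 k d).

Lemma mulX_exists (i : 'I_4) d : exists f : 'Hom(St d, St d.+1),
  forall v, f v = 'X_i * (v : S) :> S.
Proof.
have lM : linear (fun p : S => 'X_i * p) by move=> c u v; rewrite mulrDr scalerAr.
apply: (graded_hom lM) => p hp; rewrite -[d.+1]add1n; apply: dhomogM => //.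
by rewrite dhomogX /= mdeg1.
Qed.

Definition mulX i d : 'Hom(St d, St d.+1) := sval (cid (mulX_exists i d)).

Lemma mulXE i d (v : St d) : mulX i d v = 'X_i * (v : S) :> S.
Proof. by rewrite /mulX; case: cid => f /= ->. Qed.

Lemma rho_exists d : exists f : 'Hom(St d, St d), forall v, f v = lsub line (v : S) :> S.
Proof.
have lL : linear (lsub line : S -> S) by move=> c u v; rewrite rmorphD /= lsubZ.
by apply: (graded_hom lL) => p; apply: dhomog_lsub.
Qed.

Definition rho d : 'Hom(St d, St d) := sval (cid (rho_exists d)).

Lemma rhoE d (v : St d) : rho d v = lsub line (v : S) :> S.
Proof. by rewrite /rho; case: cid => f /= ->. Qed.

Lemma dim_mulX i d (U : {vspace St d}) : \dim (mulX i d @: U) = \dim U.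
Proof.
apply: limg_dim_eq; apply/eqP; rewrite -subv0; apply/subvP=> v.
rewrite memv_cap memv_ker memv0 => /andP [_ /eqP/(congr1 (@mpoly_of_dhomog _ _ _))].
rewrite mulXE linear0 => e; apply/eqP/St_inj; rewrite linear0.
by apply: (mulfI (mpolyX_neq0 i)); rewrite mulr0.
Qed.

Lemma line_kernel d (p : S) : p \is d.+1.-homog -> lsub line p = 0 ->
  exists u v, [/\ u \is d.-homog, v \is d.-homog & p = 'X_i2 * u + 'X_i3 * v].
Proof.
move=> hp p0; have hk : lsub (kill i2) p \is d.+1.-homog by apply: dhomog_lsub.
have [|v hv ev] := kill_homog (i := i3) hk; first by rewrite lsub_comp.
have hpk : p - lsub (kill i2) p \is d.+1.-homog by rewrite rpredB.
have [|u hu eu] := kill_homog (i := i2) hpk.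
  by rewrite rmorphB /= lsub_comp kill_idem subrr.
by exists u, v; split=> //; rewrite -eu -ev subrK.
Qed.

End Multiplication.

Section Koszul.
Context {k : fieldType}.
Local Notation S := {mpoly k[4]}.
Context (I : ideal k) (cI : curve_ideal I).
Let idI := ci_ideal cI.

(** The first Koszul cohomology of the coordinate ring on the four variables vanishes in
    depth two: with l_1 = sum m_j x_j a regular element, the candidate quotient of p by x is
    t_1 / l_1 for t_1 = sum m_j p_j, and the second regular element shows that l_1 divides
    t_1. *)
Lemma koszul_vanishing (p : 'I_4 -> S) : (forall i j, I ('X_j * p i - 'X_i * p j)) ->
  exists q, forall i, I (p i - 'X_i * q).
Proof.
have [l1 [l2 [d1 [d2 [f1 f2 r1 r2]]]]] := ci_ACM cI.
have [m1 [_ e1]] := form_decomp f1; have [m2 [_ e2]] := form_decomp f2.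
move=> hp.
have lp (l : S) (m : 'I_4 -> S) i : l = \sum_j 'X_j * m j ->
    I (l * p i - 'X_i * \sum_j m j * p j).
  move=> ->; rewrite mulr_suml mulr_sumr -sumrB; apply: (ideal_sum idI) => j _.
  have -> : 'X_j * m j * p i - 'X_i * (m j * p j) = m j * ('X_j * p i - 'X_i * p j) by ring.
  exact: (idealMl idI).
pose t1 := \sum_j m1 j * p j; pose t2 := \sum_j m2 j * p j.
have h1 i : I (l1 * p i - 'X_i * t1) by apply: lp.
have h2 i : I (l2 * p i - 'X_i * t2) by apply: lp.
have h12 : I (l2 * t1 - l1 * t2).
  apply: r1; rewrite {1}e1 mulr_suml; apply: (ideal_sum idI) => i _.
  have -> : 'X_i * m1 i * (l2 * t1 - l1 * t2)
    = m1 i * (l1 * (l2 * p i - 'X_i * t2) - l2 * (l1 * p i - 'X_i * t1)) by ring.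
  by apply/(idealMl idI)/(idealB idI); apply: (idealMl idI).
have [|q hq] := r2 t1; first by exists t2.
exists q => i; apply: r1.
have -> : l1 * (p i - 'X_i * q) = (l1 * p i - 'X_i * t1) + 'X_i * (t1 - l1 * q) by ring.
by apply: (idealD idI) => //; apply: (idealMl idI).
Qed.

End Koszul.

Section Regular.
Context {k : fieldType}.
Local Notation S := {mpoly k[4]}.
Local Notation St d := (dhomog 4 k d).
Context (I : ideal k) (cI : curve_ideal I) (ml : misses_line I).
Let idI := ci_ideal cI.
Local Notation P := (piece idI).

Lemma curve_dim : exists t0, forall t, (t0 <= t)%N ->
  (\dim (P t) + (10 * t + 1 - 11) = 'C(t + 3, 3))%N.
Proof.
have [t0 hf] := ci_hilb cI; exists t0 => t /hf h.
exact: hilbert_function_dim.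
Qed.

Lemma misses_line_split : exists t1, forall t (p : S), (t1 <= t)%N -> p \is t.+1.-homog ->
  exists q u v, [/\ q \is t.+1.-homog, I q, u \is t.-homog, v \is t.-homog &
    p = q + ('X_i2 * u + 'X_i3 * v)].
Proof.
have [t1 h] := ml; exists t1 => t p le hp.
have [q [hq Iq e]] := h t.+1 p (leqW le) hp.
have hpq : p - q \is t.+1.-homog by rewrite rpredB.
have [|u [v [hu hv euv]]] := line_kernel hpq; first by rewrite rmorphB /= e subrr.
by exists q, u, v; split=> //; rewrite -euv addrC subrK.
Qed.

(** If x_i were in I, then in high degree the forms modulo I would all be multiples of x_j,
    and the Hilbert function would stop growing, whereas it grows by 10 at each step. *)
Lemma curve_no_linear i j : (i == i2) && (j == i3) || (i == i3) && (j == i2) -> ~ I 'X_i.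
Proof.
move=> ij Ii.
have [t0 hd] := curve_dim; have [t1 sp] := misses_line_split.
pose t := (maxn t0 t1).+1.
have [l0 l0' l1] : [/\ (t0 <= t)%N, (t0 <= t.+1)%N & (t1 <= t)%N] by rewrite /t; split; lia.
have full : (P t.+1 + mulX j t @: fullv)%VS = fullv.
  apply/eqP; rewrite eqEsubv subvf /=; apply/subvP=> v _.
  have [q [u [w [hq Iq hu hw e]]]] := sp t v l1 (St_homog v).
  have Hadd (x y : S) : x \is t.-homog -> y \is t.-homog -> I ('X_i * x) ->
      (v : S) = q + ('X_i * x + 'X_j * y) -> v \in (P t.+1 + mulX j t @: fullv)%VS.
    move=> hx hy Ix ev.
    have -> : v = (mk t.+1 (q + 'X_i * x)) + mulX j t (mk t y).
      apply: St_inj; rewrite raddfD /= mulXE !mkK //; first by rewrite ev addrA.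
      rewrite rpredD // -[t.+1]add1n; apply: dhomogM => //.
      by rewrite dhomogX /= mdeg1.
    apply: memv_add; last by apply/memv_img/memvf.
    apply: (mem_piece idI); last by apply: (idealD idI).
    rewrite rpredD // -[t.+1]add1n; apply: dhomogM => //.
    by rewrite dhomogX /= mdeg1.
  case/orP: ij => /andP [/eqP ei /eqP ej].
    by apply: (Hadd u w) => //; [rewrite ei mulrC in Ii *; apply: (idealMl idI) | rewrite ei ej].
  apply: (Hadd w u) => //; first by rewrite mulrC; apply: (idealMl idI).
  by rewrite ei ej e [_ * w + _]addrC.
have cap : (mulX j t @: P t <= P t.+1 :&: mulX j t @: fullv)%VS.
  apply/subvP=> v /memv_imgP [w /pieceP Iw ->]; rewrite memv_cap memv_img ?memvf // andbT.
  by apply/pieceP; rewrite mulXE; apply: (idealMl idI).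
have dc := dimvS cap; have ds := dimv_sum_cap (P t.+1) (mulX j t @: fullv).
rewrite full !dim_mulX !dimSt in dc ds.
have tpos : (0 < t)%N by [].
move: dc ds (hd _ l0) (hd _ l0') tpos; clear.
move: (\dim (P t)) (\dim (P t.+1)) (\dim (_ :&: _)) 'C(t + 3, 3) 'C(t.+1 + 3, 3).
by clearbody t => a b c u v; lia.
Qed.

Lemma curve_cancel2 (p : S) : I ('X_i2 * p) -> I p.
Proof. by case/(ci_prime cI).2 => // /(@curve_no_linear i2 i3) []. Qed.

Lemma curve_cancel3 (p : S) : I ('X_i3 * p) -> I p.
Proof. by case/(ci_prime cI).2 => // /(@curve_no_linear i3 i2) []. Qed.

Local Notation J := (add_principal I 'X_i2).

(** Depth two: after the regular element x_2 no element is killed by all variables. *)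
Lemma curve_socle (p : S) : (forall i, J ('X_i * p)) -> J p.
Proof.
move=> /choice [q hq].
have [|r hr] := @koszul_vanishing _ _ cI q.
  move=> i j; apply: curve_cancel2.
  have -> : 'X_i2 * ('X_j * q i - 'X_i * q j)
     = 'X_i * ('X_j * p - 'X_i2 * q j) - 'X_j * ('X_i * p - 'X_i2 * q i) by ring.
  by apply: (idealB idI); apply: (idealMl idI).
exists r; apply: curve_cancel2.
have -> : 'X_i2 * (p - 'X_i2 * r) = ('X_i2 * p - 'X_i2 * q i2) + 'X_i2 * (q i2 - 'X_i2 * r) by ring.
by apply: (idealD idI) => //; apply: (idealMl idI).
Qed.

Lemma J_ideal : is_ideal J.
Proof.
split=> [|p q [r hr] [s hs]|p q [r hr]].
- by exists 0; rewrite mulr0 subr0; apply: (ideal0 idI).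
- exists (r + s); have -> : p + q - 'X_i2 * (r + s) = (p - 'X_i2 * r) + (q - 'X_i2 * s) by ring.
  exact: (idealD idI).
- exists (p * r); have -> : p * q - 'X_i2 * (p * r) = p * (q - 'X_i2 * r) by ring.
  exact: (idealMl idI).
Qed.

(** x_2 is a nonzerodivisor modulo I. *)
Lemma dim_J t : (\dim (piece J_ideal t.+1) + \dim (P t) = \dim (P t.+1) + 'C(t + 3, 3))%N.
Proof.
have e1 : piece J_ideal t.+1 = (P t.+1 + mulX i2 t @: fullv)%VS.
  apply/eqP; rewrite eqEsubv; apply/andP; split; apply/subvP=> v.
    move=> /pieceP [r hr].
    have hX : ('X_i2 : S) \is 1.-homog by rewrite dhomogX /= mdeg1.
    have hXr : 'X_i2 * pihomog mdeg t r \is t.+1.-homog.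
      by rewrite -[t.+1]add1n; apply: dhomogM => //; apply: pihomogP.
    have -> : v = mk t.+1 ((v : S) - 'X_i2 * pihomog mdeg t r) + mulX i2 t (mk t (pihomog mdeg t r)).
      apply: St_inj; rewrite raddfD /= mulXE !mkK ?pihomogP ?subrK //.
      by rewrite rpredB // St_homog.
    apply: memv_add; last by apply/memv_img/memvf.
    apply: (mem_piece idI); first by rewrite rpredB // St_homog.
    have E : pihomog mdeg t.+1 ('X_i2 * r) = 'X_i2 * pihomog mdeg t r.
      by rewrite -[t.+1]addn1 mulrC (pihomogMr _ _ hX) mulrC.
    by have := ci_homog cI t.+1 hr; rewrite raddfB /= (pihomog_dE (St_homog v)) E.
  move=> /memv_addP [u /pieceP Iu [w /memv_imgP [x _ ->] ->]]; apply/pieceP.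
  by exists (x : S); rewrite raddfD /= mulXE addrK.
have e2 : (P t.+1 :&: mulX i2 t @: fullv)%VS = (mulX i2 t @: P t)%VS.
  apply/eqP; rewrite eqEsubv; apply/andP; split; apply/subvP=> v.
    rewrite memv_cap => /andP [/pieceP Iv /memv_imgP [w _ ew]].
    rewrite ew memv_img //; apply/pieceP/curve_cancel2.
    by rewrite -mulXE -ew.
  move=> /memv_imgP [w /pieceP Iw ->]; rewrite memv_cap memv_img ?memvf // andbT.
  by apply/pieceP; rewrite mulXE; apply: (idealMl idI).
by have := dimv_sum_cap (P t.+1) (mulX i2 t @: fullv); rewrite e2 -e1 !dim_mulX dimSt.
Qed.

(** In high degree multiplication by x_3 on S/(I, x_2) is onto, since the line misses the
    curve, and both sides have dimension 10, so it is injective.  The statement descends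
    to low degrees because there is no socle. *)
Lemma J_regular t (q : S) : q \is t.-homog -> J ('X_i3 * q) -> J q.
Proof.
have [t0 hd] := curve_dim; have [t1 sp] := misses_line_split.
(* Above T the Hilbert function of I is known in three consecutive degrees. *)
pose T := (maxn t0 t1).+2.
suff base s (p : S) : (T <= s)%N -> p \is s.-homog -> J ('X_i3 * p) -> J p.
  have [n] := ubnP (T - t)%N; elim: n => // n IH in t q *; rewrite ltnS => le hq Jq.
  have [Tt|tT] := leqP T t; first exact: (base t).
  apply: curve_socle => i; apply: (IH t.+1).
  - by move: le tT; clearbody T; clear; lia.
  - by rewrite -[t.+1]add1n; apply: dhomogM => //; rewrite dhomogX /= mdeg1.
  - by rewrite mulrCA; apply: (idealMl J_ideal).
case: s => // s Ts hp Jp.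
have full : (piece J_ideal s.+2 + mulX i3 s.+1 @: fullv)%VS = fullv.
  apply/eqP; rewrite eqEsubv subvf /=; apply/subvP=> v _.
  have [|q0 [u [w [hq' Iq hu hw e]]]] := sp s.+1 v _ (St_homog v).
    by move: Ts; rewrite /T; clear; lia.
  have hXu : 'X_i2 * u \is s.+2.-homog.
    by rewrite -[s.+2]add1n; apply: dhomogM => //; rewrite dhomogX /= mdeg1.
  have -> : v = mk s.+2 (q0 + 'X_i2 * u) + mulX i3 s.+1 (mk s.+1 w).
    by apply: St_inj; rewrite raddfD /= mulXE !mkK ?e ?addrA // rpredD.
  apply: memv_add; last by apply/memv_img/memvf.
  apply: mem_piece; first by rewrite rpredD.
  by exists u; rewrite addrK.
have sub : (mulX i3 s.+1 @: piece J_ideal s.+1 <= piece J_ideal s.+2 :&: mulX i3 s.+1 @: fullv)%VS.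
  apply/subvP=> v /memv_imgP [w /pieceP Jw ->]; rewrite memv_cap memv_img ?memvf // andbT.
  by apply/pieceP; rewrite mulXE; apply: (idealMl J_ideal).
have eq : (mulX i3 s.+1 @: piece J_ideal s.+1 = piece J_ideal s.+2 :&: mulX i3 s.+1 @: fullv)%VS.
  apply/eqP; rewrite eqEdim sub /= dim_mulX.
  have ds := dimv_sum_cap (piece J_ideal s.+2) (mulX i3 s.+1 @: fullv).
  rewrite full !dim_mulX !dimSt in ds.
  have d1 := dim_J s; have d2 := dim_J s.+1.
  have [l0 l1 l2] : [/\ (t0 <= s)%N, (t0 <= s.+1)%N & (t0 <= s.+2)%N].
    by move: Ts; rewrite /T; clear; split; lia.
  have := hd _ l0; have := hd _ l1; have := hd _ l2.
  have s0 : (0 < s)%N by move: Ts l0 l1 l2; rewrite /T; clear; lia.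
  move: ds d1 d2 s0; clear.
  move: (\dim (P s)) (\dim (P s.+1)) (\dim (P s.+2)) (\dim (_ :&: _)) (\dim (piece _ _))
    (\dim (piece _ _)) => a b c d e f.
  move: 'C(s + 3, 3) 'C(s.+1 + 3, 3) 'C(s.+2 + 3, 3) => u v w; lia.
have : mulX i3 s.+1 (mk s.+1 p) \in (mulX i3 s.+1 @: piece J_ideal s.+1)%VS.
  rewrite eq memv_cap memv_img ?memvf // andbT.
  by apply/pieceP; rewrite mulXE mkK.
move=> /memv_imgP [w /pieceP Jw /(congr1 (@mpoly_of_dhomog _ _ _))].
by rewrite !mulXE mkK // => /(mulfI (mpolyX_neq0 i3)) ->.
Qed.

(** The forms x_2 and x_3 are a regular sequence modulo I, so their relations with values in
    I come from I up to the Koszul relation. *)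
Lemma curve_regular t (p q : S) : p \is t.-homog -> q \is t.-homog ->
  I ('X_i2 * p + 'X_i3 * q) -> exists p' q', [/\ p' \is t.-homog, q' \is t.-homog,
    I p', I q' & 'X_i2 * p + 'X_i3 * q = 'X_i2 * p' + 'X_i3 * q'].
Proof.
move=> hp hq Ipq.
have [|r Ir] := J_regular hq.
  by exists (- p); rewrite mulrN opprK addrC.
have Ip' : I (p + 'X_i3 * r).
  apply: curve_cancel2.
  have -> : 'X_i2 * (p + 'X_i3 * r) = ('X_i2 * p + 'X_i3 * q) - 'X_i3 * (q - 'X_i2 * r) by ring.
  by apply: (idealB idI) => //; apply: (idealMl idI).
exists (pihomog mdeg t (p + 'X_i3 * r)), (pihomog mdeg t (q - 'X_i2 * r)).
split; try exact: pihomogP; try exact: (ci_homog cI).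
have hX (i : 'I_4) : ('X_i : S) \is 1.-homog by rewrite dhomogX /= mdeg1.
have hpq : 'X_i2 * p + 'X_i3 * q \is (t + 1).-homog.
  by rewrite rpredD // addnC; apply: dhomogM.
rewrite -{1}(pihomog_dE hpq).
have -> : 'X_i2 * p + 'X_i3 * q = (p + 'X_i3 * r) * 'X_i2 + (q - 'X_i2 * r) * 'X_i3 by ring.
by rewrite raddfD /= !(pihomogMr _ _ (hX _)); ring.
Qed.

End Regular.

(** * The h-vector *)

Section SecondDifference.
Context {k : fieldType}.
Local Notation S := {mpoly k[4]}.
Local Notation St d := (dhomog 4 k d).
Context (I : ideal k) (idI : is_ideal I).
Context (cancel2 : forall p, I ('X_i2 * p) -> I p) (cancel3 : forall p, I ('X_i3 * p) -> I p).
Context (regular : forall t (p q : S), p \is t.-homog -> q \is t.-homog ->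
  I ('X_i2 * p + 'X_i3 * q) -> exists p' q', [/\ p' \is t.-homog, q' \is t.-homog,
    I p', I q' & 'X_i2 * p + 'X_i3 * q = 'X_i2 * p' + 'X_i3 * q']).
Local Notation P := (piece idI).

(** The regularity of (x_2, x_3), read in one degree. *)
Lemma line_kernel_piece t :
  (P t.+1 :&: lker (rho t.+1) = mulX i2 t @: P t + mulX i3 t @: P t)%VS.
Proof.
apply/eqP; rewrite eqEsubv; apply/andP; split; apply/subvP=> v.
  rewrite memv_cap memv_ker => /andP [/pieceP Iv /eqP/(congr1 (@mpoly_of_dhomog _ _ _))].
  rewrite rhoE linear0 => /(line_kernel (St_homog v)) [u [w [hu hw e]]].
  rewrite e in Iv; have [u' [w' [hu' hw' Iu' Iw' e']]] := regular hu hw Iv.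
  have -> : v = mulX i2 t (mk t u') + mulX i3 t (mk t w').
    by apply: St_inj; rewrite raddfD /= !mulXE !mkK // e.
  by apply: memv_add; apply: memv_img; apply: mem_piece.
move=> /memv_addP [u /memv_imgP [a /pieceP Ia ->] [w /memv_imgP [b /pieceP Ib ->] ->]].
rewrite memv_cap memv_ker; apply/andP; split.
  by apply/pieceP; rewrite raddfD /= !mulXE; apply: (idealD idI); apply: (idealMl idI).
apply/eqP/St_inj; rewrite rhoE raddfD /= !mulXE !rmorphM /= !lineX /=.
by rewrite !mul0r addr0.
Qed.

Definition line_dim t := \dim (rho t @: P t).

Lemma second_difference0 : \dim (P 0) = line_dim 0.
Proof.
rewrite /line_dim -(limg_ker_dim (rho 0) (P 0)).
have -> : (P 0 :&: lker (rho 0) = 0)%VS; last by rewrite dimv0.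
apply/eqP; rewrite -subv0; apply/subvP=> v; rewrite memv_cap memv_ker => /andP [_ /eqP].
move=> /(congr1 (@mpoly_of_dhomog _ _ _)); rewrite rhoE linear0.
have /dhomog_constP [c e] := St_homog v; rewrite e lsubC => c0.
by rewrite memv0; apply/eqP/St_inj; rewrite e c0 linear0.
Qed.

Lemma dim_kernel t : (\dim (P t.+1) + \dim (mulX i2 t @: P t :&: mulX i3 t @: P t)
  = line_dim t.+1 + 2 * \dim (P t))%N.
Proof.
have d1 := limg_ker_dim (rho t.+1) (P t.+1); rewrite line_kernel_piece in d1.
have d2 := dimv_sum_cap (mulX i2 t @: P t) (mulX i3 t @: P t).
rewrite !dim_mulX in d2; rewrite -d1 /line_dim addnC addnA [(_ :&: _)%VS]capvC.
rewrite [(mulX i3 t @: _ :&: _)%VS]capvC [(\dim (_ :&: _) + _)%N]addnC d2; lia.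
Qed.

Lemma second_difference1 : (\dim (P 1) = line_dim 1 + 2 * \dim (P 0))%N.
Proof.
rewrite -dim_kernel; have -> : (mulX i2 0 @: P 0 :&: mulX i3 0 @: P 0 = 0)%VS.
  apply/eqP; rewrite -subv0; apply/subvP=> v.
  rewrite memv_cap => /andP [/memv_imgP [a _ ->] /memv_imgP [b _ e]].
  have /(congr1 (lsub (kill i2))) := congr1 (@mpoly_of_dhomog _ _ _) e.
  rewrite !mulXE !rmorphM /= !lsub_killX /= mul0r => /esym/eqP.
  have /dhomog_constP [c eb] := St_homog b.
  rewrite eb lsubC mulf_eq0 (negPf (mpolyX_neq0 _)) /= => /eqP c0.
  rewrite memv0; apply/eqP/St_inj; rewrite e mulXE eb c0.
  by rewrite mulr0 linear0.
by rewrite dimv0 addn0.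
Qed.

(** The Koszul complex of (x_2, x_3) on I is exact, except that its cokernel is the
    restriction of I to the line. *)
Lemma second_difference t :
  (\dim (P t.+2) + \dim (P t) = line_dim t.+2 + 2 * \dim (P t.+1))%N.
Proof.
rewrite -dim_kernel; congr (_ + _)%N.
rewrite -(dim_mulX i3 (P t)) -(dim_mulX i2 (mulX i3 t @: P t)); congr (\dim _).
apply/eqP; rewrite eqEsubv; apply/andP; split; apply/subvP=> v.
  move=> /memv_imgP [w /memv_imgP [x /pieceP Ix ->] ->].
  rewrite memv_cap; apply/andP; split.
    by apply: memv_img; apply/pieceP; rewrite mulXE; apply: (idealMl idI).
  apply/memv_imgP; exists (mulX i2 t x).
    by apply/pieceP; rewrite mulXE; apply: (idealMl idI).
  by apply: St_inj; rewrite !mulXE mulrCA.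
rewrite memv_cap => /andP [/memv_imgP [a /pieceP Ia ->] /memv_imgP [b /pieceP Ib e]].
apply: memv_img.
have /(congr1 (lsub (kill i3))) := congr1 (@mpoly_of_dhomog _ _ _) e.
rewrite !mulXE !rmorphM /= !lsub_killX /= mul0r => e0.
have [|x hx ex] := kill_homog (St_homog a) (i := i3).
  by apply: (mulfI (mpolyX_neq0 i2)); rewrite mulr0.
apply/memv_imgP; exists (mk t x); last by apply: St_inj; rewrite mulXE mkK.
by apply: mem_piece => //; apply: cancel3; rewrite -ex.
Qed.

End SecondDifference.

Section LineDimension.
Context {k : fieldType}.
Local Notation S := {mpoly k[4]}.
Local Notation St d := (dhomog 4 k d).

Definition unit_ideal : ideal k := fun=> True.
Lemma unit_idealP : is_ideal unit_ideal. Proof. by []. Qed.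

Lemma piece_unit t : piece unit_idealP t = fullv :> {vspace St t}.
Proof. by apply/eqP; rewrite eqEsubv subvf /=; apply/subvP=> v _; apply/pieceP. Qed.

(** The second difference for the unit ideal counts the binary forms. *)
Lemma dim_rho t : \dim (limg (rho t : 'Hom(St t, St t))) = t.+1.
Proof.
have reg u (p q : S) : p \is u.-homog -> q \is u.-homog ->
    unit_ideal ('X_i2 * p + 'X_i3 * q) -> exists p' q', [/\ p' \is u.-homog, q' \is u.-homog,
    unit_ideal p', unit_ideal q' & 'X_i2 * p + 'X_i3 * q = 'X_i2 * p' + 'X_i3 * q'].
  by move=> hp hq _; exists p, q.
have E u : line_dim unit_idealP u = \dim (limg (rho u : 'Hom(St u, St u))).
  by rewrite /line_dim piece_unit.
case: t => [|[|t]].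
- by have := second_difference0 unit_idealP; rewrite E piece_unit dimSt => <-.
- have := @second_difference1 _ _ unit_idealP reg.
  by rewrite E !piece_unit !dimSt /= !binS !bin0 !bin1 !bin_small //; lia.
have := @second_difference _ _ unit_idealP (fun _ _ => Logic.I) reg t.
rewrite E !piece_unit !dimSt !addSn !addnS !addn0 !binS !bin0 !bin1.
by move: (\dim _) 'C(_, 3) 'C(_, 2) => a b c; lia.
Qed.

End LineDimension.

Section HVector.
Context (i r : nat -> nat) (t0 : nat).
Context (i0 : i 0 = r 0) (i1 : (i 1 = r 1 + 2 * i 0)%N).
Context (iS : forall t, (i t.+2 + i t = r t.+2 + 2 * i t.+1)%N).
Context (rle : forall t, (r t <= t.+1)%N).
Context (it : forall t, (t0 <= t)%N -> (i t + (10 * t + 1 - 11) = 'C(t + 3, 3))%N).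

Let h j : int := j.+1%:Z - (r j)%:Z.
Let H t : int := 'C(t + 3, 3)%:Z - (i t)%:Z.

Let H_diff t : H t.+1 - H t = \sum_(j < t.+2) h j.
Proof.
elim: t => [|t IH].
  rewrite !big_ord_recr big_ord0 /= /H /h i1 i0 /= add0n.
  by rewrite !binS !bin0 !bin1 !bin_small //; lia.
rewrite big_ord_recr /= -IH /H /h.
have := iS t; rewrite !addSn !addnS !addn0 !binS !bin0 !bin1.
by move: (i _) (i _) (i _) (r _) 'C(_, 3) 'C(_, 2) => a b c d e f; lia.
Qed.

Let H_sum t : H t = \sum_(j < t.+1) (t.+1%:Z - j%:Z) * h j.
Proof.
elim: t => [|t IH].
  rewrite big_ord_recr big_ord0 /= /H /h i0 add0n binn; lia.
rewrite -[LHS](subrK (H t)) H_diff IH big_ord_recr [in RHS]big_ord_recr /=.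
have -> : \sum_(j < t.+1) (t.+2%:Z - j%:Z) * h j
    = \sum_(j < t.+1) h j + \sum_(j < t.+1) (t.+1%:Z - j%:Z) * h j.
  by rewrite -big_split; apply: eq_bigr => j _ /=; rewrite (intS t.+1); ring.
by rewrite (intS t.+1); ring.
Qed.

(** Among the h-vectors of degree 10 only (1, 2, 3, 4) has genus 11: the weights
    7 - 2j are positive exactly for j < 4, and the weighted sum reaches its
    maximum, 30. *)
Lemma hvector t : r t = if (t < 4)%N then 0 else t.+1.
Proof.
pose T := (maxn t0 t + 5)%N.
have h0 j : 0 <= h j by rewrite /h; have := rle j; lia.
have sum1 : \sum_(j < T.+1) h j = 10.
  have -> : T = T.-1.+1 by rewrite /T; lia.
  rewrite -H_diff /H.
  have l1 : (t0 <= T.-1)%N by rewrite /T; lia.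
  have l2 : (t0 <= T.-1.+1)%N by rewrite /T; lia.
  have := it l1; have := it l2.
  have : (0 < T.-1)%N by rewrite /T; lia.
  move: (T.-1) => u; move: (i _) (i _) 'C(_, 3) 'C(_, 3) => a b c d; lia.
have sum2 : \sum_(j < T.+1) (T.+1%:Z - j%:Z) * h j = 10 * T%:Z - 10.
  have l1 : (t0 <= T)%N by rewrite /T; lia.
  rewrite -H_sum /H; have := it l1; have : (0 < T)%N by rewrite /T; lia.
  move: (i _) 'C(_, 3) => a b; clear; lia.
(* 30 = 2 (10 T - 10) + 10 (5 - 2 T), the combination in which T cancels. *)
have sum3 : \sum_(j < T.+1) (7 - 2 * j%:Z) * h j = 30.
  have -> : \sum_(j < T.+1) (7 - 2 * j%:Z) * h j
     = 2 * (\sum_(j < T.+1) (T.+1%:Z - j%:Z) * h j) + (5 - 2 * T%:Z) * \sum_(j < T.+1) h j.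
    rewrite !mulr_sumr -big_split; apply: eq_bigr => j _ /=.
    by rewrite (intS T); ring.
  by rewrite sum1 sum2; ring.
(* f is the contribution of the largest value h j = j + 1 where the weight is positive,
   and of h j = 0 elsewhere; its sum, 7 + 10 + 9 + 4, is also 30. *)
pose f j : int := if (j < 4)%N then (7 - 2 * j%:Z) * j.+1%:Z else 0.
have sumf : \sum_(j < T.+1) f j = 30.
  have -> : T.+1 = (4 + (maxn t0 t + 2))%N by rewrite /T; lia.
  rewrite big_split_ord /= [X in _ + X]big1 ?addr0.
    by rewrite !big_ord_recr big_ord0.
  by move=> j _; rewrite /f ltnNge leq_addr.
have g0 (j : 'I_T.+1) : true -> 0 <= f j - (7 - 2 * j%:Z) * h j.
  move=> _; rewrite /f; have := h0 j; have := rle j; rewrite /h.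
  case: ltnP => j4; last first.
    move=> _ hj; rewrite sub0r -mulNr mulr_ge0 //; lia.
  move=> rj _; rewrite -mulrBr mulr_ge0 //; lia.
have g_sum : \sum_(j < T.+1) (f j - (7 - 2 * j%:Z) * h j) = 0.
  by rewrite sumrB sumf sum3 subrr.
have tT : (t < T.+1)%N by rewrite /T; lia.
have := psumr_eq0P g0 g_sum (i := Ordinal tT) isT; rewrite /= /f.
case: ltnP => t4.
  rewrite -mulrBr /h => /eqP; rewrite mulf_eq0 => /orP [/eqP|/eqP]; lia.
rewrite sub0r => /eqP; rewrite oppr_eq0 mulf_eq0 /h => /orP [/eqP|/eqP]; lia.
Qed.

End HVector.

Section Determinantal.
Context {k : fieldType}.
Local Notation S := {mpoly k[4]}.
Local Notation St d := (dhomog 4 k d).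

Lemma linear_form (p : S) : p \is 1.-homog -> p = \sum_a 'X_a * (p@_U_(a))%:MP.
Proof.
move=> /form_decomp [l [hl ->]]; apply: eq_bigr => i _; congr (_ * _).
have /choice [c hc] : forall i, exists c, l i = c%:MP by move=> j; apply: dhomog_constP.
rewrite hc; congr (_%:MP); rewrite (raddf_sum (mcoeff U_(i))) (bigD1 i) //= big1.
  by rewrite addr0 hc mulrC mul_mpolyC mcoeffZ mcoeffXU eqxx mulr1.
by move=> j /negPf ji; rewrite hc mulrC mul_mpolyC mcoeffZ mcoeffXU ji mulr0.
Qed.

Lemma tensor_of_matrix (A : 'M[S]_(4, 5)) : (forall b c, A b c \is 1.-homog) ->
  exists T : tensor k, quartic T = minors A.
Proof.
move=> hA; exists (fun a b c => (A b c)@_U_(a)); rewrite quarticE; congr minors.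
by apply/matrixP=> b c; rewrite mxE [RHS]linear_form.
Qed.

Definition binary (c : 'I_5) : S := 'X_i0 ^+ (4 - c) * 'X_i1 ^+ c.

Lemma binary_homog c : binary c \is 4.-homog.
Proof.
have c4 : (c <= 4)%N by rewrite -ltnS ltn_ord.
by have := dhomogM (homogXn (k := k) i0 (4 - c)) (homogXn i1 c); rewrite subnK.
Qed.

Lemma binary_line c : lsub line (binary c) = binary c.
Proof. by rewrite /binary rmorphM !rmorphXn /= !lineX. Qed.

Lemma binary_free (a : 'I_5 -> k) : \sum_c a c *: binary c = 0 -> forall c, a c = 0.
Proof.
pose m (c : 'I_5) : 'X_{1..4} := (U_(i0) *+ (4 - c) + U_(i1) *+ c)%MM.
have bE c : binary c = 'X_[m c] by rewrite /binary !mpolyXn -mpolyXD.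
move=> /(congr1 (mcoeff (m _)))/[swap] c => /(_ c).
rewrite mcoeff0 (raddf_sum (mcoeff _)) (bigD1 c) //= big1 ?addr0.
  by rewrite mcoeffZ bE mcoeffX eqxx mulr1.
move=> d dc; rewrite mcoeffZ bE mcoeffX; case: eqP => [/mnmP/(_ i1)|_]; last by rewrite mulr0.
rewrite /m !mnmDE !mulmnE !mnm1E /= !mul0n !mul1n !add0n => /val_inj e.
by rewrite e eqxx in dc.
Qed.

Lemma line_free_binary (G : 'I_5 -> S) : (forall c, lsub line (G c) = binary c) ->
  line_free 4 G.
Proof.
move=> hG; exists 0%N, (fun c => (c == ord0)%:R), (fun c => (c == ord_max)%:R).
have hom (b : bool) : (b%:R : S) \is 0.-homog.
  by case: b; [apply: dhomog1 | apply: dhomog0].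
split=> // [].
  rewrite (bigD1 ord0) //= big1 => [|i /negPf ->]; last by rewrite mul0r.
  by rewrite mul1r addr0 hG /binary mulr1.
rewrite (bigD1 ord_max) //= big1 => [|i /negPf ->]; last by rewrite mul0r.
by rewrite ?eqxx mul1r addr0 hG /binary subnn mul1r.
Qed.

End Determinantal.

(** * Curves are determinantal *)

Section CurveDeterminantal.
Context {k : fieldType}.
Local Notation S := {mpoly k[4]}.
Local Notation St d := (dhomog 4 k d).
Context (I : ideal k) (cI : curve_ideal I) (ml : misses_line I).
Let idI := ci_ideal cI.
Local Notation P := (piece idI).

Lemma curve_line_dim t : line_dim idI t = if (t < 4)%N then 0%N else t.+1.
Proof.
have reg := curve_regular cI ml.
have [t0 hd] := curve_dim cI.
apply: (@hvector (fun t => \dim (P t)) (line_dim idI) t0) => [|||u|//].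
- exact: second_difference0.
- exact: second_difference1.
- by move=> u; apply: second_difference => //; apply: curve_cancel3.
- by rewrite /line_dim -(@dim_rho k u); apply/dimvS/limgS/subvf.
Qed.

Lemma curve_no_cubic t : (t < 4)%N -> P t = 0%VS.
Proof.
move=> t4; apply/eqP; rewrite -dimv_eq0; apply/eqP.
have reg := curve_regular cI ml.
have e0 := second_difference0 idI.
have e1 := second_difference1 idI reg.
have eS := second_difference idI (curve_cancel3 cI ml) reg.
have := eS 0; have := eS 1; rewrite !curve_line_dim /= in e0 e1 *.
have {}e1 : \dim (P 1) = 0%N by rewrite e1 e0.
rewrite e1 e0 !(addn0, add0n, muln0) => e3 e2; rewrite e2 muln0 in e3.
by case: t t4 => [|[|[|[|//]]]].
Qed.

Lemma dim_quartics : \dim (P 4) = 5.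
Proof.
have := second_difference idI (curve_cancel3 cI ml) (curve_regular cI ml) 2.
by rewrite curve_line_dim /= (@curve_no_cubic 2) // (@curve_no_cubic 3) // !dimv0 !addn0.
Qed.

(** From degree four on, I restricts onto all binary forms: this is the h-vector. *)
Lemma curve_line_onto t : (3 < t)%N -> (rho t @: P t)%VS = limg (rho t).
Proof.
move=> t4; apply/eqP; rewrite eqEdim limgS ?subvf //= dim_rho.
by have := curve_line_dim t; rewrite /line_dim ltnNge t4 /= => ->.
Qed.

Lemma quartics_exist : exists F : 'I_5 -> St 4,
  (forall c, F c \in P 4) /\ forall c, lsub line (F c : S) = binary c.
Proof.
have /choice [F hF] : forall c, exists v : St 4, v \in P 4 /\ lsub line (v : S) = binary c.
  move=> c; have : rho 4 (mk 4 (binary c : S)) \in limg (rho 4) by apply: memv_img; apply: memvf.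
  rewrite -curve_line_onto // => /memv_imgP [v Pv e]; exists v; split=> //.
  by rewrite -rhoE -e rhoE mkK ?binary_line ?binary_homog.
by exists F; split=> c; have [] := hF c.
Qed.

Context (F : 'I_5 -> St 4) (PF : forall c, F c \in P 4)
  (lF : forall c, lsub line (F c : S) = binary c).
Let f c : S := F c.

Lemma quartics_span v : v \in P 4 -> exists a : 'I_5 -> k, (v : S) = \sum_c a c *: f c.
Proof.
pose X := [tuple F c | c < 5].
have XE (c : 'I_5) : X`_c = F c by rewrite -tnth_nth tnth_mktuple.
have freeX : free X.
  apply/freeP => a; under eq_bigr do rewrite XE.
  move=> /(congr1 (fun v : St 4 => lsub line (v : S))); rewrite linear0 rmorph0 => e.
  apply: binary_free; rewrite -[RHS]e St_sum rmorph_sum; apply: eq_bigr => c _.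
  by rewrite linearZ /= lsubZ lF.
have spanX : <<X>>%VS = P 4.
  apply/eqP; rewrite eqEdim (eqnP freeX) size_tuple dim_quartics leqnn andbT.
  apply/span_subvP => _ /mapP [c _ ->]; exact: PF.
rewrite -spanX => /coord_span e; exists (fun c => coord X c v).
by rewrite e St_sum; apply: eq_bigr => c _; rewrite linearZ /= XE -e.
Qed.

(** The binary quartics generate all binary forms of degree at least four. *)
Lemma quartics_line n (p : S) : p \is (4 + n).-homog -> exists v,
  [/\ v \is (4 + n).-homog, ideal_gen f v & lsub line p = lsub line v].
Proof.
elim: n p => [|n IH] p hp.
  rewrite addn0 in hp *.
  have : rho 4 (mk 4 p) \in limg (rho 4) by apply: memv_img; apply: memvf.
  rewrite -curve_line_onto // => /memv_imgP [v Pv e].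
  have [a ea] := quartics_span Pv.
  exists (v : S); split; first exact: St_homog.
    by rewrite ea; exists (fun c => (a c)%:MP); apply: eq_bigr => c _; rewrite mul_mpolyC.
  by rewrite -(rhoE v) -e rhoE mkK.
rewrite addnS in hp *; have [l [hl e]] := form_decomp hp.
have /choice [v hv] : forall i, exists v,
    [/\ v \is (4 + n).-homog, ideal_gen f v & lsub line (l i) = lsub line v].
  by move=> i; apply: IH.
exists (\sum_i 'X_i * v i); split.
- apply: rpred_sum => i _; rewrite -[(4 + n).+1]add1n.
  by apply: dhomogM; [rewrite dhomogX /= mdeg1 | case: (hv i)].
- apply: (ideal_sum (ideal_gen_ideal f)) => i _; apply: (idealMl (ideal_gen_ideal f)).
  by case: (hv i).
rewrite e !rmorph_sum; apply: eq_bigr => i _; rewrite !rmorphM /=.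
by have [_ _ ->] := hv i.
Qed.

Lemma quartics_sub p : ideal_gen f p -> I p.
Proof.
move=> [r ->]; apply: (ideal_sum idI) => c _; apply: (idealMl idI).
exact/(pieceP idI).
Qed.

(** Subtract a combination of the quartics with the same restriction to the line; the rest
    is x_2 a + x_3 b with a and b in I of smaller degree. *)
Lemma quartics_generate t (p : S) : p \is t.-homog -> I p -> ideal_gen f p.
Proof.
elim: t p => [|t IH] p hp Ip.
  have := mem_piece idI hp Ip; rewrite curve_no_cubic // memv0 => /eqP/(congr1 (@mpoly_of_dhomog _ _ _)).
  by rewrite mkK // linear0 => ->; apply: (ideal0 (ideal_gen_ideal f)).
have [t3|t3] := ltnP t.+1 4.
  have := mem_piece idI hp Ip; rewrite curve_no_cubic // memv0 => /eqP/(congr1 (@mpoly_of_dhomog _ _ _)).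
  by rewrite mkK // linear0 => ->; apply: (ideal0 (ideal_gen_ideal f)).
have [v [hv fv e]] : exists v, [/\ v \is t.+1.-homog, ideal_gen f v & lsub line p = lsub line v].
  by rewrite -(subnKC t3) in hp *; apply: quartics_line.
have hpv : p - v \is t.+1.-homog by rewrite rpredB.
have Ipv : I (p - v) by apply: (idealB idI) => //; apply: quartics_sub.
have [|a [b [ha hb eab]]] := line_kernel hpv; first by rewrite rmorphB /= e subrr.
rewrite eab in Ipv; have [a' [b' [ha' hb' Ia Ib e']]] := curve_regular cI ml ha hb Ipv.
rewrite -(subrK v p) eab e'; have idf := ideal_gen_ideal f.
by apply: (idealD idf) => //; apply: (idealD idf); apply: (idealMl idf); apply: IH.
Qed.

Lemma quartics_gen : I = ideal_gen f.
Proof.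
apply/funext => p; apply/propext; split; last exact: quartics_sub.
move=> Ip; rewrite (pihomog_partitionE (leqnn (msize p))).
apply: (ideal_sum (ideal_gen_ideal f)) => d _; apply: (@quartics_generate d).
  exact: pihomogP.
exact: (ci_homog cI).
Qed.

(** The linear syzygies lift the relations x_1 y_b = x_0 y_(b+1) between the binary
    quartics y_c = x_0^(4-c) x_1^c. *)
Lemma linear_syzygies : exists A : 'M[S]_(4, 5), [/\ forall b c, A b c \is 1.-homog,
  forall b, \sum_c A b c * f c = 0 &
  forall b c, lsub line (A b c) = 'X_i1 * (c == widen_ord (leqnSn 4) b)%:R
                                  - 'X_i0 * (c == lift ord0 b)%:R].
Proof.
have hX (i : 'I_4) : ('X_i : S) \is 1.-homog by rewrite dhomogX /= mdeg1.
have key (b : 'I_4) : exists u : ('I_5 -> k) * ('I_5 -> k),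
    'X_i1 * f (widen_ord (leqnSn 4) b) - 'X_i0 * f (lift ord0 b)
    = 'X_i2 * (\sum_c u.1 c *: f c) + 'X_i3 * (\sum_c u.2 c *: f c).
  set w := _ - _; have hw : w \is 5.-homog.
    by rewrite rpredB //; apply: (@dhomogM _ _ mdeg 1 _ 4) => //; apply: St_homog.
  have Iw : I w.
    by apply: (idealB idI); apply: (idealMl idI); apply/(pieceP idI)/PF.
  have [|a [c [ha hc e]]] := line_kernel hw.
    rewrite rmorphB !rmorphM /= !lineX /= /f !lF /binary lift0 /=.
    have b3 : (b <= 3)%N by rewrite -ltnS.
    by rewrite subSS (subSn b3) !exprS; ring.
  rewrite e in Iw *; have [a' [c' [ha' hc' Ia Ic e']]] := curve_regular cI ml ha hc Iw.
  have [u1 eu1] := quartics_span (mem_piece idI ha' Ia).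
  have [u2 eu2] := quartics_span (mem_piece idI hc' Ic).
  exists (u1, u2) => /=.
  by rewrite -eu1 -eu2 !mkK.
have /choice [u hu] := key.
pose A : 'M[S]_(4, 5) := \matrix_(b, c) ('X_i1 * (c == widen_ord (leqnSn 4) b)%:R
   - 'X_i0 * (c == lift ord0 b)%:R - 'X_i2 * ((u b).1 c)%:MP - 'X_i3 * ((u b).2 c)%:MP).
exists A; split=> [b c|b|b c].
- rewrite mxE; have hC a : (a%:MP : S) \is 0.-homog.
    by rewrite -alg_mpolyC; apply: dhomogZ; apply: dhomog1.
  have hB (x : bool) : (x%:R : S) \is 0.-homog.
    by case: x; [apply: dhomog1 | apply: dhomog0].
  by rewrite !rpredB //; apply: (@dhomogM _ _ mdeg 1 _ 0).
- under eq_bigr do rewrite mxE !mulrBl -!mulrA.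
  have one d : \sum_c (c == d)%:R * f c = f d.
    by rewrite (bigD1 d) //= eqxx mul1r big1 ?addr0 // => c /negPf ->; rewrite mul0r.
  rewrite !sumrB -!mulr_sumr !one hu.
  under eq_bigr do rewrite -mul_mpolyC.
  under [in X in _ + _ * X - _ - _]eq_bigr do rewrite -mul_mpolyC.
  by ring.
- rewrite mxE !rmorphB !rmorphM /= !lineX /= !rmorph_nat !mul0r !subr0.
  by [].
Qed.

(** On the line the matrix is bidiagonal: its first minor is x_0^4, and the others follow
    because they span the kernel together with the binary quartics. *)
Lemma syzygies_minors (A : 'M[S]_(4, 5)) :
  (forall b, \sum_c A b c * f c = 0) ->
  (forall b c, lsub line (A b c) = 'X_i1 * (c == widen_ord (leqnSn 4) b)%:R
                                  - 'X_i0 * (c == lift ord0 b)%:R) ->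
  forall c, lsub line (minors A c) = binary c.
Proof.
move=> Af lA c; rewrite -minors_map.
have BE b d : map_mx (lsub line) A b d = lsub line (A b d) by rewrite mxE.
set B := map_mx _ A in BE *.
have Bb b : \sum_c B b c * binary c = 0.
  transitivity (lsub line (\sum_c A b c * f c)); last by rewrite Af rmorph0.
  rewrite (rmorph_sum (lsub line)); apply: eq_bigr => d _.
  by rewrite BE rmorphM /= /f lF.
have m0 : minors B ord0 = 'X_i0 ^+ 4.
  rewrite minorsE expr0 mul1r det_trig.
    transitivity (\prod_(i < 4) - ('X_i0 : S)).
      apply: eq_bigr => i _; rewrite mxE BE lA eqxx mulr1.
      have -> : (lift ord0 i == widen_ord (leqnSn 4) i) = false.
        by rewrite -val_eqE /= /bump add1n gtn_eqF.
      by rewrite mulr0 sub0r.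
    by rewrite big_const card_ord /= mulr1; ring.
  apply/is_trig_mxP => i j ij; rewrite mxE BE lA.
  rewrite -!val_eqE /= /bump /= !add1n eqSS [(j == i :> nat)]gtn_eqF //.
  by rewrite gtn_eqF ?mulr0 ?subr0 // ltnS ltnW.
have := kernel_minors (y := binary) c ord0 Bb.
rewrite m0 /binary subn0 expr0 mulr1 => e.
by apply: (mulIf (expf_neq0 4 (mpolyX_neq0 i0))); rewrite e mulrC.
Qed.

(** The quartics and the minors of their linear syzygies are proportional, and both families
    are primitive, so each divides the other. *)
Lemma quartics_minors : exists T : tensor k,
  I = ideal_gen (quartic T) /\ line_free 4 (quartic T).
Proof.
have [A [hA Af lA]] := linear_syzygies.
have lm := syzygies_minors Af lA.
have hf c : f c \is 4.-homog by apply: St_homog.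
have hm c : minors A c \is 4.-homog by apply: (@dhomog_minors _ 4 1).
have pf : primitive f by apply: (line_free_primitive hf); apply: line_free_binary.
have pm : primitive (minors A) by apply: (line_free_primitive hm); apply: line_free_binary.
have cross i j : f i * minors A j = f j * minors A i.
  by rewrite mulrC [RHS]mulrC (kernel_minors (y := f) j i Af).
have [h1 e1] := pm f cross.
have [|h2 e2] := pf (minors A).
  by move=> i j; rewrite mulrC cross mulrC.
have [T eT] := tensor_of_matrix hA; exists T; rewrite eT; split.
  rewrite quartics_gen; apply/funext => p; apply/propext; split=> -[r ->].
    exists (fun c => r c * h1); apply: eq_bigr => c _; by rewrite e1 mulrA.
  exists (fun c => r c * h2); apply: eq_bigr => c _; by rewrite e2 mulrA.
exact: line_free_binary.
Qed.

End CurveDeterminantal.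

Section Determinantal.
Context {k : fieldType} (k_char0 : [pchar k] =i pred0).
Local Notation S := {mpoly k[4]}.

Theorem curve_determinantal (I : ideal k) : curve_ideal I -> exists (T : tensor k) A,
  [/\ A \in unitmx, line_free 4 (fun c => lsub A (quartic T c)) & I = ideal_gen (quartic T)].
Proof.
move=> cI; have [A uA ml] := noether k_char0 cI.
have cJ := curve_ideal_lsub uA cI.
have [F [PF lF]] := quartics_exist cJ ml.
have [T [eJ lf]] := quartics_minors ml PF lF.
have [T' eT'] : exists T', forall c, quartic T' c = lsub A (quartic T c).
  have [|T' eT'] := @tensor_of_matrix k (map_mx (lsub A) (Nmx (constT T) (fun a => 'X_a))).
    move=> b c; rewrite mxE; apply: dhomog_lsub; apply: dhomog_Nmx => a.
    by rewrite dhomogX /= mdeg1.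
  by exists T' => c; rewrite eT' minors_map quarticE.
exists T', (invmx A); split; first by rewrite unitmx_inv.
  have -> : (fun c => lsub (invmx A) (quartic T' c)) = quartic T.
    by apply/funext => c; rewrite eT' lsubVK.
  exact: lf.
apply/funext => p; apply/propext.
have EJ q : I (lsub A q) <-> ideal_gen (quartic T) q by rewrite -eJ.
rewrite -{1}(lsubK p uA) EJ; split=> -[r e].
  exists (fun c => lsub A (r c)); rewrite -[LHS](lsubK p uA) e rmorph_sum.
  by apply: eq_bigr => c _; rewrite eT' rmorphM.
exists (fun c => lsub (invmx A) (r c)); rewrite e rmorph_sum.
by apply: eq_bigr => c _; rewrite eT' rmorphM /= lsubVK.
Qed.

End Determinantal.

(** * Polynomial families *)

Section MapTensors.
Context {K K' : comNzRingType} (f : {rmorphism K -> K'}).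

Lemma map_quartic (T : tensor K) c :
  map_mpoly f (quartic T c) = quartic (fun a b c => f (T a b c)) c.
Proof.
rewrite !quarticE -minors_map; congr (minors _ c); apply/matrixP=> i j.
rewrite !mxE rmorph_sum; apply: eq_bigr => a _.
by rewrite rmorphM /= map_mpolyX map_mpolyC.
Qed.

Lemma map_adjM (T : tensor K) a b :
  map_mpoly f (adjM T a b) = adjM (fun a b c => f (T a b c)) a b.
Proof.
transitivity (map_mx (map_mpoly f) (adjM T) a b); first by rewrite [RHS]mxE.
rewrite !adjME map_mx_adj; congr (\adj _ a b); apply/matrixP=> i j.
rewrite !mxE rmorph_sum; apply: eq_bigr => c _.
by rewrite rmorphM /= map_quartic map_mpolyC.
Qed.

End MapTensors.

Section PolynomialFunctions.
Context {k : fieldType} {n : nat}.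
Local Notation S := {mpoly k[4]}.
Local Notation pt := ('I_n -> k).

Definition polyfun (phi : pt -> k) : Prop := exists f : {mpoly k[n]}, forall v, phi v = f.@[v].

(** P is the specialisation of one form with polynomial coefficients, so that determinants
    can be computed before specialising. *)
Definition polyfam (P : pt -> S) : Prop :=
  exists Q : {mpoly {mpoly k[n]}[4]}, forall v, P v = map_mpoly (meval v) Q.

Lemma polyfun_const c : polyfun (fun=> c).
Proof. by exists c%:MP => v; rewrite mevalC. Qed.

Lemma polyfun_coord i : polyfun (fun v => v i).
Proof. by exists 'X_i => v; rewrite mevalXU. Qed.

Lemma polyfunD phi psi : polyfun phi -> polyfun psi -> polyfun (fun v => phi v + psi v).
Proof. by move=> [f hf] [g hg]; exists (f + g) => v; rewrite mevalD hf hg. Qed.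

Lemma polyfunM phi psi : polyfun phi -> polyfun psi -> polyfun (fun v => phi v * psi v).
Proof. by move=> [f hf] [g hg]; exists (f * g) => v; rewrite mevalM hf hg. Qed.

Lemma polyfun_sum (J : finType) (phi : J -> pt -> k) :
  (forall j, polyfun (phi j)) -> polyfun (fun v => \sum_j phi j v).
Proof.
move=> /choice [f hf]; exists (\sum_j f j) => v.
by rewrite (raddf_sum (meval v)); apply: eq_bigr => j _; rewrite hf.
Qed.

Lemma polyfun_det m (A : pt -> 'M[k]_m) : (forall i j, polyfun (fun v => A v i j)) ->
  polyfun (fun v => \det (A v)).
Proof.
move=> hA; have /choice [f hf] : forall ij : 'I_m * 'I_m, exists f : {mpoly k[n]},
  forall v, A v ij.1 ij.2 = f.@[v] by case=> i j; apply: hA.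
exists (\det (\matrix_(i, j) f (i, j))) => v.
rewrite -(det_map_mx (meval v)); congr (\det _).
by apply/matrixP=> i j; rewrite !mxE (hf (i, j)).
Qed.

Lemma polyfun_cofactor m (A : pt -> 'M[k]_m) i j : (forall i j, polyfun (fun v => A v i j)) ->
  polyfun (fun v => cofactor (A v) i j).
Proof.
move=> hA; rewrite /cofactor; apply: polyfunM; first exact: polyfun_const.
apply: polyfun_det => a b; under [in X in polyfun X]eq_fun do rewrite !mxE.
exact: hA.
Qed.

Lemma polyfam_coef P m : polyfam P -> polyfun (fun v => (P v)@_m).
Proof. by move=> [Q hQ]; exists (Q@_m) => v; rewrite hQ mcoeff_map_mpoly. Qed.

Lemma polyfam_quartic (T : pt -> tensor k) c :
  (forall a b c, polyfun (fun v => T v a b c)) -> polyfam (fun v => quartic (T v) c).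
Proof.
move=> hT; have /choice [f hf] : forall abc : 'I_4 * 'I_4 * 'I_5, exists f : {mpoly k[n]},
  forall v, T v abc.1.1 abc.1.2 abc.2 = f.@[v] by case=> [[a b] d]; apply: hT.
exists (quartic (fun a b c => f (a, b, c)) c) => v.
rewrite map_quartic; congr (quartic _ c).
by apply/funext => a; apply/funext => b; apply/funext => d; rewrite (hf (a, b, d)).
Qed.

Lemma polyfam_adjM (T : pt -> tensor k) i j :
  (forall a b c, polyfun (fun v => T v a b c)) -> polyfam (fun v => adjM (T v) i j).
Proof.
move=> hT; have /choice [f hf] : forall abc : 'I_4 * 'I_4 * 'I_5, exists f : {mpoly k[n]},
  forall v, T v abc.1.1 abc.1.2 abc.2 = f.@[v] by case=> [[a b] d]; apply: hT.
exists (adjM (fun a b c => f (a, b, c)) i j) => v.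
rewrite map_adjM; congr (adjM _ i j).
by apply/funext => a; apply/funext => b; apply/funext => d; rewrite (hf (a, b, d)).
Qed.

Lemma polyfam_mulC p P : polyfam P -> polyfam (fun v => p * P v).
Proof.
move=> [Q hQ]; exists (map_mpoly (@mpolyC n k) p * Q) => v.
rewrite rmorphM /= -hQ; congr (_ * _).
apply/mpolyP => m; rewrite mcoeff_map_mpoly mcoeff_map_mpoly.
by rewrite [RHS]mevalC.
Qed.

Lemma polyfam_sum (J : finType) (P : J -> pt -> S) :
  (forall j, polyfam (P j)) -> polyfam (fun v => \sum_j P j v).
Proof.
move=> /choice [Q hQ]; exists (\sum_j Q j) => v.
by rewrite rmorph_sum; apply: eq_bigr => j _; rewrite hQ.
Qed.

(** The coefficients that express the unit vectors at v1 give, at other points, a square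
    matrix whose determinant is the certificate. *)
Lemma span_open (J : finType) m (u : J -> pt -> 'I_m -> k) (v1 : pt) :
  (forall r j, polyfun (fun v => u r v j)) ->
  (forall l, exists c : J -> k, forall j, \sum_r c r * u r v1 j = (l == j)%:R) ->
  exists phi, [/\ polyfun phi, phi v1 != 0 & forall v, phi v != 0 ->
    forall l, exists c : J -> k, forall j, \sum_r c r * u r v j = (l == j)%:R].
Proof.
move=> pu /choice [C hC].
pose B v : 'M[k]_m := \matrix_(l, j) \sum_r C l r * u r v j.
exists (fun v => \det (B v)); split.
- apply: polyfun_det => l j; under [in X in polyfun X]eq_fun do rewrite mxE.
  by apply: polyfun_sum => r; apply: polyfunM => //; apply: polyfun_const.
- have -> : B v1 = 1%:M by apply/matrixP=> l j; rewrite !mxE hC.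
  by rewrite det1 oner_neq0.
move=> v Bv l; exists (fun r => \sum_i invmx (B v) l i * C i r) => j.
have uB : B v \in unitmx by rewrite unitmxE unitfE.
have /matrixP/(_ l j) := mulVmx uB; rewrite [RHS]mxE => <-.
rewrite mxE; under eq_bigr do rewrite mulr_suml.
rewrite exchange_big; apply: eq_bigr => i _; rewrite mxE mulr_sumr.
by apply: eq_bigr => r _; rewrite mulrA.
Qed.

Lemma polyfun_meval m (f : {mpoly k[m]}) (phi : 'I_m -> pt -> k) :
  (forall j, polyfun (phi j)) -> polyfun (fun v => f.@[fun j => phi j v]).
Proof.
move=> hphi; elim/mpoly_ring_ind: f => [c|j|f g hf hg|f g hf hg].
- by under [in X in polyfun X]eq_fun do rewrite mevalC; apply: polyfun_const.
- by under [in X in polyfun X]eq_fun do rewrite mevalXU; apply: hphi.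
- by under [in X in polyfun X]eq_fun do rewrite mevalD; apply: polyfunD.
- by under [in X in polyfun X]eq_fun do rewrite mevalM; apply: polyfunM.
Qed.

Lemma polyfun_mulmx m p q (A : pt -> 'M[k]_(m, p)) (B : pt -> 'M[k]_(p, q)) :
  (forall i j, polyfun (fun v => A v i j)) -> (forall i j, polyfun (fun v => B v i j)) ->
  forall i j, polyfun (fun v => (A v *m B v) i j).
Proof.
move=> hA hB i j; under [in X in polyfun X]eq_fun do rewrite mxE.
by apply: polyfun_sum => l; apply: polyfunM.
Qed.

(** Solving by Cramer's rule: completing M v1 to an invertible matrix by constants, the
    chosen basis U1 of its left kernel extends to a polynomial family of matrices, which
    stay kernel bases wherever the kernel does not shrink. *)
Lemma kernel_family r s d (M : pt -> 'M[k]_(r, s)) (v1 : pt) (U1 : 'M[k]_(d, r)) :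
  (forall i j, polyfun (fun v => M v i j)) -> row_free U1 -> U1 *m M v1 = 0 ->
  (forall u : 'rV_r, u *m M v1 = 0 -> (u <= U1)%MS) ->
  exists phi (U : pt -> 'M[k]_(d, r)), [/\ polyfun phi, phi v1 != 0,
    forall i j, polyfun (fun v => U v i j), U v1 = U1 &
    forall v, phi v != 0 -> forall V : 'M[k]_(d, r), row_free V -> V *m M v = 0 ->
      U v *m M v = 0 /\ row_free (U v)].
Proof.
move=> pM fU1 U1M maxU1; set rho := \rank (M v1).
have hd : (r - rho <= d)%N.
  rewrite -mxrank_ker -(eqnP fU1); apply: mxrankS; apply/row_subP => i.
  by apply: maxU1; rewrite -row_mul mulmx_ker row0.
have [rs rr] : (rho <= s)%N /\ (rho <= r)%N by rewrite rank_leq_col rank_leq_row.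
pose L := col_ebase (M v1); pose N := row_ebase (M v1).
have uL : L \in unitmx by apply: col_ebase_unit.
have uN : N \in unitmx by apply: row_ebase_unit.
have eM : M v1 = L *m pid_mx rho *m N by rewrite mulmx_ebase.
pose cp : 'M[k]_r := copid_mx rho.
(* Constant changes of the columns and constant additional columns make M v1 invertible. *)
pose X v := M v *m (invmx N *m pid_mx rho) + L *m cp.
have X1 : X v1 = L.
  rewrite /X eM -!mulmxA (mulmxA N) mulmxV // mul1mx pid_mx_id //.
  by rewrite -mulmxDr /cp /copid_mx addrC subrK mulmx1.
have pX i j : polyfun (fun v => X v i j).
  rewrite /X; under [in X in polyfun X]eq_fun do rewrite mxE.
  apply: polyfunD; last exact: polyfun_const.
  by apply: polyfun_mulmx => // a b; apply: polyfun_const.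
have dL : \det L != 0 by rewrite -unitfE -unitmxE.
pose K := (\det L)^-1 *: (U1 *m L).
exists (fun v => \det (X v)), (fun v => K *m \adj (X v)); split.
- exact: polyfun_det.
- by rewrite X1.
- apply: (@polyfun_mulmx d r r (fun=> K)) => a b; first exact: polyfun_const.
  under [in X in polyfun X]eq_fun do rewrite mxE; exact: polyfun_cofactor.
- by rewrite X1 /K -scalemxAl -mulmxA mul_mx_adj mul_mx_scalar scalerA mulVf ?scale1r.
move=> v dX V fV VM.
have uX : X v \in unitmx by rewrite unitmxE unitfE.
have fL : row_free K.
  by rewrite /row_free /K mxrank_scale_nz ?invr_neq0 // mxrankMfree ?row_free_unit.
have Kcp : (K <= cp)%MS.
  apply/submxP; exists K; rewrite /cp /copid_mx mulmxBr mulmx1.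
  suff -> : K *m (pid_mx rho : 'M_r) = 0 by rewrite subr0.
  have UL : U1 *m L *m (pid_mx rho : 'M_(r, s)) = 0.
    by apply: (can_inj (mulmxK uN)); rewrite mul0mx -!mulmxA [L *m _]mulmxA -eM.
  have -> : (pid_mx rho : 'M_r) = (pid_mx rho : 'M[k]_(r, s)) *m (pid_mx rho : 'M_(s, r)).
    by rewrite pid_mx_id.
  by rewrite mulmxA /K -!scalemxAl UL mul0mx scaler0.
(* V X v and K span the same row space, that of the projector cp. *)
have VX : V *m X v = V *m L *m cp by rewrite /X mulmxDr mulmxA VM mul0mx add0r mulmxA.
have cpV : (cp <= V *m X v)%MS.
  have : (V *m X v <= cp)%MS by rewrite VX submxMl.
  move/mxrank_leqif_sup/geq_leqif <-.
  by rewrite rank_copid_mx // mxrankMfree ?row_free_unit // (eqnP fV).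
have /submxP [Y eY] := submx_trans Kcp cpV.
have eU : K *m \adj (X v) = \det (X v) *: (Y *m V).
  by rewrite eY -!mulmxA mul_mx_adj mul_mx_scalar -scalemxAr.
split; first by rewrite eU -scalemxAl -mulmxA VM mulmx0 scaler0.
rewrite /row_free eqn_leq rank_leq_row -{1}(eqnP fL) /=.
have <- : \rank (K *m \adj (X v) *m X v) = \rank K.
  by rewrite -mulmxA mul_adj_mx mul_mx_scalar mxrank_scale_nz.
exact: mxrankM_maxl.
Qed.

End PolynomialFunctions.

(** * Open conditions on polynomial families of forms *)

Section OpenConditions.
Context {k : fieldType} {n : nat}.
Local Notation S := {mpoly k[4]}.
Local Notation pt := ('I_n -> k).

Lemma mpoly_sum_bound (p : S) d : (msize p <= d)%N ->
  p = \sum_(m : 'X_{1..4 < d}) p@_m *: 'X_[m].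
Proof.
move=> hd; apply/mpolyP => m; rewrite raddf_sum /=.
have [md|md] := ltnP (mdeg m) d.
  rewrite (bigD1 (BMultinom md)) //= mcoeffZ mcoeffX eqxx mulr1 big1 ?addr0 //.
  by move=> m' ne; rewrite mcoeffZ mcoeffX; case: eqP => [e|]; rewrite ?mulr0 //;
     case/eqP: ne; apply: val_inj.
rewrite big1 => [|m' _]; first by apply/memN_msupp_eq0/msize_mdeg_ge/(leq_trans hd).
rewrite mcoeffZ mcoeffX; case: eqP => [e|]; rewrite ?mulr0 //.
by have := bmdeg m'; rewrite e ltnNge md.
Qed.

Lemma homog_msize_le (p : S) d : p \is d.-homog -> (msize p <= d.+1)%N.
Proof.
move=> /dhomogP hp; rewrite mmeasureE; apply/bigmax_leqP_seq => m hm _.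
by have /= -> := hp m hm.
Qed.

(** For a right inverse D of the coefficient matrix at v1, the determinant of the product of
    the coefficient matrix with D is the certificate. *)
Lemma free_open (N : nat) (E : 'I_N -> pt -> S) (v1 : pt) :
  (forall i, polyfam (E i)) ->
  (forall c : 'rV[k]_N, \sum_i c 0 i *: E i v1 = 0 -> c = 0) ->
  exists phi, [/\ polyfun phi, phi v1 != 0 & forall v, phi v != 0 ->
    forall c : 'rV[k]_N, \sum_i c 0 i *: E i v = 0 -> c = 0].
Proof.
move=> pE free1; pose D := (\max_i msize (E i v1))%N.
have hD i : (msize (E i v1) <= D)%N by apply: leq_bigmax.
pose M v : 'M[k]_(N, #|{: 'X_{1..4 < D}}|) := \matrix_(i, j) (E i v)@_(bmnm (enum_val j)).
have ME v (c : 'rV[k]_N) j : (c *m M v) 0 j = (\sum_i c 0 i *: E i v)@_(bmnm (enum_val j)).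
  by rewrite mxE raddf_sum; apply: eq_bigr => i _; rewrite /= mcoeffZ mxE.
have fM : row_free (M v1).
  apply/row_freeP/row_freeP; rewrite -kermx_eq0; apply/eqP/row_matrixP => i; rewrite row0.
  apply: free1; rewrite [LHS](@mpoly_sum_bound _ D); last first.
    apply: leq_trans (msize_sum _ _ _) _; apply/bigmax_leqP => j _.
    exact: leq_trans (msizeZ_le _ _) (hD j).
  apply: big1 => m _; rewrite -[m in LHS]enum_rankK -ME -row_mul mulmx_ker row0 mxE.
  by rewrite scale0r.
have [D' eD] := row_freeP fM.
exists (fun v => \det (M v *m D')); split; last 1 first.
- move=> v; rewrite -unitfE -unitmxE => u c e.
  have : c *m M v = 0 by apply/rowP => j; rewrite ME e mcoeff0 mxE.
  move/(congr1 (mulmx^~ D')); rewrite mul0mx -mulmxA => e'.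
  by rewrite -(mulmxK u c) e' mul0mx.
- apply: polyfun_det; apply: polyfun_mulmx => i j; last exact: polyfun_const.
  under [in X in polyfun X]eq_fun do rewrite mxE; exact: polyfam_coef.
- by rewrite eD det1 oner_neq0.
Qed.

Lemma mcoeff_line (p : S) m : (lsub line p)@_m = p@_m *+ ((m i2 == 0%N) && (m i3 == 0%N)).
Proof.
rewrite {1}[p]mpolyE rmorph_sum raddf_sum /=; set b := _ && _.
have prod4 (f : 'I_4 -> S) : \prod_i f i = f i0 * f i1 * f i2 * f i3.
  rewrite 3!big_ord_recr big_ord1 /=.
  by congr (f _ * f _ * f _ * f _); apply: val_inj.
have X m' : lsub line 'X_[m'] = 'X_[m'] *+ ((m' i2 == 0%N) && (m' i3 == 0%N)) :> S.
  rewrite mpolyXE_id prod4 !rmorphM !rmorphXn /= !lineX /=.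
  case: (m' i2) (m' i3) => [|a] [|b'] /=; rewrite ?expr0 ?mulr1n ?mulr0n //.
  - by rewrite exprS mul0r mulr0.
  - by rewrite exprS mul0r mulr0 mul0r.
  - by rewrite [X in _ * X * _]exprS mul0r mulr0 mul0r.
under eq_bigr do rewrite lsubZ X mcoeffZ mcoeffMn mcoeffX.
have [mp|mp] := boolP (m \in msupp p).
  rewrite (bigD1_seq m) //= eqxx big1 => [|m' /negPf ->]; last by rewrite mul0rn mulr0.
  by rewrite addr0 mulrnAr mulr1.
rewrite (memN_msupp_eq0 mp) mul0rn big_seq big1 // => m' hm'.
by case: eqP => [e|]; rewrite ?mul0rn ?mulr0 //; rewrite e (negPf mp) in hm'.
Qed.

Lemma mcoeff_pihomog (p : S) d m : mdeg m = d -> (pihomog mdeg d p)@_m = p@_m.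
Proof.
move=> hm; case: _ / hm.
have hk : (mdeg m < maxn (msize p) (mdeg m).+1)%N by rewrite leq_max ltnSn orbT.
have homE e : e != mdeg m -> (pihomog mdeg e p)@_m = 0.
  move=> ne; have /dhomogP he := pihomogP mdeg e p; apply/memN_msupp_eq0/negP => /he /= e'.
  by case/eqP: ne; rewrite -e'.
have := congr1 (mcoeff m) (pihomog_partitionE (leq_maxl (msize p) (mdeg m).+1)).
move=> ->; rewrite [RHS](raddf_sum (mcoeff m)) (bigD1 (Ordinal hk)) //=.
by rewrite big1 ?addr0 // => e; rewrite -val_eqE /= => /homE.
Qed.

Let mono (D j : nat) : 'X_{1..4} := (U_(i0) *+ j + U_(i1) *+ (D - j))%MM.

Lemma monoE D j i : mono D j i = if i == i0 then j else if i == i1 then (D - j)%N else 0%N.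
Proof.
rewrite mnmDE !mulmnE !mnm1E (eq_sym i0) (eq_sym i1).
have [->|_] := eqVneq i i0; first by rewrite /= mul1n mul0n addn0.
by case: (i == i1); rewrite /= ?mul1n ?mul0n.
Qed.

Lemma mono_inj D j m : (j <= D)%N -> mdeg m = D -> m i2 = 0%N -> m i3 = 0%N -> m i0 = j ->
  m = mono D j.
Proof.
move=> jD dm m2 m3 m0; apply/mnmP => i; rewrite monoE.
have : mdeg m = (m i0 + m i1 + m i2 + m i3)%N.
  rewrite mdegE 3!big_ord_recr big_ord1 /=.
  by congr (m _ + m _ + m _ + m _)%N; apply: val_inj.
rewrite m2 m3 m0 dm !addn0 => e.
case: (eqVneq i i0) => [-> //|n0]; case: (eqVneq i i1) => [->|n1]; first by rewrite e addKn.
case: (eqVneq i i2) => [-> //|n2]; case: (eqVneq i i3) => [-> //|n3].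
by case: i n0 n1 n2 n3 => [[|[|[|[|//]]]] ?].
Qed.

(** Freeness on the line says that the multiples of the forms span all binary forms of
    some degree. *)
Lemma line_free_open (I : finType) d (G : I -> pt -> S) (v1 : pt) :
  (forall i, polyfam (G i)) -> (forall i v, G i v \is d.-homog) ->
  line_free d (fun i => G i v1) ->
  exists phi, [/\ polyfun phi, phi v1 != 0 & forall v, phi v != 0 ->
    line_free d (fun i => G i v)].
Proof.
move=> pG hG [s [a [b [ha hb ea eb]]]].
have split2 (x y : nat) : (x <= y <= x + x)%N -> x = (y - x + (x + x - y))%N by lia.
pose t := (s + d)%N; pose D := (t + t)%N.
have dD : (d <= D)%N by rewrite /D /t; lia.
pose J := (I * 'X_{1..4 < (D - d).+1})%type.
pose u (r : J) v (j : 'I_D.+1) := ('X_[bmnm r.2] * G r.1 v)@_(mono D j).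
have sumE (c : J -> k) v (j : 'I_D.+1) : \sum_r c r * u r v j =
    (\sum_i (\sum_(m : 'X_{1..4 < (D - d).+1}) c (i, m) *: 'X_[m]) * G i v)@_(mono D j).
  rewrite raddf_sum; transitivity (\sum_i \sum_m c (i, m) * u (i, m) v j).
    by rewrite pair_bigA; apply: eq_bigr => -[].
  apply: eq_bigr => i _.
  rewrite mulr_suml raddf_sum; apply: eq_bigr => m _.
  by rewrite -scalerAl /= mcoeffZ.
have [r j|l|phi [pphi phi1 H]] := @span_open _ _ J D.+1 u v1.
- by apply: polyfam_coef; apply: polyfam_mulC.
- pose lift_to (w : I -> S) (q : S) := fun i => w i * q.
  have spans (w : I -> S) (q : S) : (forall i, w i \is s.-homog) -> q \is t.-homog ->
      lsub line (\sum_i w i * G i v1) * lsub line q = 'X_[mono D l] ->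
      exists c : J -> k, forall j, \sum_r c r * u r v1 j = (l == j)%:R.
    move=> hw hq e; exists (fun r => (w r.1 * q)@_(bmnm r.2)) => j; rewrite sumE /=.
    rewrite (eq_bigr (fun i => w i * G i v1 * q)) => [|i _]; last first.
      rewrite -mpoly_sum_bound; first by rewrite mulrAC.
      have -> : (D - d = s + t)%N by rewrite /D /t; lia.
      exact/homog_msize_le/dhomogM.
    rewrite -mulr_suml.
    have := congr1 (mcoeff (mono D j)) e; rewrite -rmorphM mcoeff_line.
    rewrite !monoE /= mulr1n => ->.
    rewrite mcoeffX; congr (_%:R); congr nat_of_bool; apply/eqP/eqP => [/mnmP/(_ i0)|->//].
    by rewrite !monoE /= => /val_inj.
  (* In degree D = 2 t each monomial x_0^l x_1^(D - l) is divisible by x_0^t or x_1^t. *)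
  have l_le : (l <= D)%N by rewrite -ltnS.
  have monoX : 'X_[mono D l] = 'X_i0 ^+ l * 'X_i1 ^+ (D - l) :> S.
    by rewrite mpolyXD !mpolyXn.
  have hX i j : ('X_i0 ^+ i * 'X_i1 ^+ j : S) \is (i + j).-homog.
    by apply: dhomogM; apply: homogXn.
  have [tl|tl] := leqP t l.
    apply: (spans a ('X_i0 ^+ (l - t) * 'X_i1 ^+ (D - l))) => //.
      suff {2}-> : t = (l - t + (D - l))%N by apply: hX.
      by apply: split2; rewrite tl l_le.
    rewrite ea rmorphM !rmorphXn /= !lineX /= monoX mulrA -exprD.
    by rewrite subnKC.
  apply: (spans b ('X_i0 ^+ l * 'X_i1 ^+ (t - l))) => //.
    suff {2}-> : t = (l + (t - l))%N by apply: hX.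
    by rewrite subnKC // ltnW.
  rewrite eb rmorphM !rmorphXn /= !lineX /= monoX mulrCA -exprD.
  by rewrite -/t addnBA // ltnW.
exists phi; split=> // v /H {}H.
have power (l : 'I_D.+1) : exists c : I -> S, (forall i, c i \is (D - d).-homog) /\
    lsub line (\sum_i c i * G i v) = 'X_[mono D l].
  have [c hc] := H l.
  pose w i := \sum_(m : 'X_{1..4 < (D - d).+1}) c (i, m) *: 'X_[m] : S.
  exists (fun i => pihomog mdeg (D - d) (w i)); split=> [i|]; first exact: pihomogP.
  have -> : \sum_i pihomog mdeg (D - d) (w i) * G i v = pihomog mdeg D (\sum_i w i * G i v).
    rewrite raddf_sum; apply: eq_bigr => i _ /=.
    by rewrite -{2}(subnK dD) pihomogMr.
  have /dhomogP hom := dhomog_lsub line (pihomogP mdeg D (\sum_i w i * G i v)).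
  apply/mpolyP => m; rewrite mcoeffX.
  have [dm|dm] := eqVneq (mdeg m) D; last first.
    rewrite memN_msupp_eq0; last by apply/negP => /hom /eqP; rewrite (negPf dm).
    case: eqP => // e; rewrite -e in dm.
    have lD : (l <= D)%N by rewrite -ltnS.
    by move: dm; rewrite /mono mdegD !mdegMn !mdeg1 !mul1n subnKC // eqxx.
  rewrite mcoeff_line mcoeff_pihomog //.
  case: eqP => [m2|m2] /=; last first.
    by case: eqP => // e; case: m2; rewrite -e monoE.
  case: eqP => [m3|m3] /=; last first.
    by case: eqP => // e; case: m3; rewrite -e monoE.
  have m0 : (m i0 < D.+1)%N by rewrite ltnS -dm mdegE (bigD1 i0) //= leq_addr.
  rewrite (@mono_inj D (m i0) m) //.
  have := hc (Ordinal m0); rewrite sumE /= mulr1n => ->.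
  congr (_%:R); congr nat_of_bool; apply/eqP/eqP => [->//|/mnmP/(_ i0)].
  by rewrite !monoE /= => e; apply: val_inj.
have [a' [ha' ea']] := power ord_max; have [b' [hb' eb']] := power ord0.
exists (D - d)%N, a', b'; rewrite subnK //; split=> //.
  by rewrite ea' mpolyXD -!mpolyXn /= subnn expr0 mulr1.
by rewrite eb' mpolyXD -!mpolyXn /= subn0 expr0 mul1r.
Qed.

End OpenConditions.

(** * Frames and closed sets of the Hilbert scheme *)

Section Frames.
Context {k : fieldType}.
Local Notation S := {mpoly k[4]}.
Local Notation St d := (dhomog 4 k d).
Context (I : ideal k) (idI : is_ideal I) (t N : nat).
Implicit Types (e : 'I_N -> S).

Definition free_forms e : Prop := forall c : 'rV[k]_N, \sum_i c 0 i *: e i = 0 -> c = 0.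

Lemma frame_free e : frame I t e -> free_forms e.
Proof.
move=> [_ /(_ 0)[|c0 [_ u]]]; first by split; [apply: rpred0 | apply: (ideal0 idI)].
move=> c hc; rewrite -(u c) ?(u 0) //; last by rewrite hc subrr.
by rewrite big1 ?subrr // => i _; rewrite mxE scale0r.
Qed.

Lemma frame_of_free e : (forall i, e i \is t.-homog /\ I (e i)) -> free_forms e ->
  \dim (piece idI t) = N -> frame I t e.
Proof.
move=> he fe dI; pose X := [tuple mk t (e i) | i < N].
have XE (c : 'I_N -> k) : (\sum_i c i *: X`_i : St t) = \sum_i c i *: e i :> S.
  rewrite St_sum; apply: eq_bigr => i _; rewrite -tnth_nth tnth_mktuple linearZ /= mkK //.
  exact: (he i).1.
have freeX : free X.
  apply/freeP => c /(congr1 (@mpoly_of_dhomog _ _ _)); rewrite XE linear0 => c0 i.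
  have /rowP/(_ i) : \row_j c j = 0.
    by apply: fe; rewrite -[RHS]c0; apply: eq_bigr => j _; rewrite mxE.
  by rewrite !mxE.
have spanX : <<X>>%VS = piece idI t.
  apply/eqP; rewrite eqEdim (eqnP freeX) size_tuple dI leqnn andbT.
  apply/span_subvP => _ /mapP [i _ ->]; have [h1 h2] := he i; exact: mem_piece.
split=> [i|v [hv Iv]]; first by have := he i.
have vX : mk t v \in <<X>>%VS by rewrite spanX; apply: mem_piece.
have vE : v = \sum_i coord X i (mk t v) *: e i by rewrite -XE -(coord_span vX) mkK.
exists (\row_i coord X i (mk t v)); split=> [|c hc].
  by rewrite {1}vE; under [X in _ - X]eq_bigr do rewrite mxE; rewrite subrr.
apply/eqP; rewrite -subr_eq0; apply/eqP/fe.
under eq_bigr do rewrite mxE [X in _ + X]mxE scalerBl mxE.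
by rewrite sumrB -vE hc.
Qed.

Lemma frame_exists : \dim (piece idI t) = N -> exists e, frame I t e.
Proof.
move=> dI; move: (vbasis (piece idI t)) (vbasisP (piece idI t)); rewrite dI => X XP.
exists (fun i => (X`_i : St t) : S); apply: frame_of_free => // [i|c hc].
  split; first exact: St_homog.
  by apply/(pieceP idI); rewrite -(span_basis XP) memv_span // mem_nth ?size_tuple.
apply/rowP => i; rewrite mxE.
have /freeP := basis_free XP; apply; apply: St_inj; rewrite linear0 -[RHS]hc St_sum.
by apply: eq_bigr => j _; rewrite linearZ.
Qed.

Definition act (A : 'M[k]_N) e i := \sum_j A i j *: e j.

Lemma sum_act (c : 'rV[k]_N) A e : \sum_i c 0 i *: act A e i = \sum_j (c *m A) 0 j *: e j.
Proof.
under eq_bigr do rewrite scaler_sumr.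
rewrite exchange_big; apply: eq_bigr => j _; rewrite mxE scaler_suml.
by apply: eq_bigr => i _; rewrite scalerA.
Qed.

Lemma frame_span e p : frame I t e -> p \is t.-homog -> I p ->
  exists c : 'rV[k]_N, p = \sum_i c 0 i *: e i.
Proof.
move=> [_ eP] hp Ip; have [c [/eqP]] := eP p (conj hp Ip).
by rewrite subr_eq0 => /eqP -> _; exists c.
Qed.

Lemma frame_change e e' : frame I t e -> frame I t e' ->
  exists2 A, A \in unitmx & forall i, e' i = act A e i.
Proof.
have key f f' : frame I t f -> frame I t f' -> exists A, forall i, f' i = act A f i.
  move=> hf [hf' _]; have /choice [c hc] : forall i, exists c : 'rV[k]_N, f' i = \sum_j c 0 j *: f j.
    by move=> i; have [h1 h2] := hf' i; apply: frame_span.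
  by exists (\matrix_(i, j) c i 0 j) => i; rewrite hc; apply: eq_bigr => j _; rewrite mxE.
move=> he he'; have [A hA] := key _ _ he he'; have [B hB] := key _ _ he' he.
exists A => //; suff /mulmx1_unit [] : B *m A = 1%:M by [].
apply/row_matrixP => i; apply/eqP; rewrite -subr_eq0; apply/eqP/(frame_free he).
under eq_bigr do rewrite mxE [X in _ + X]mxE scalerBl row_mul.
rewrite sumrB -sum_act.
under eq_bigr do rewrite -hA mxE.
rewrite -/(act B e' i) -hB (bigD1 i) //= !mxE eqxx scale1r big1 ?addr0 ?subrr // => j /negPf ji.
by rewrite !mxE eq_sym ji scale0r.
Qed.

Lemma frame_act e A : A \in unitmx -> frame I t e -> frame I t (act A e).
Proof.
move=> uA [he eP]; split=> [i|v hv].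
  split; first by apply: rpred_sum => j _; apply: rpredZ; have [] := he j.
  by apply: (ideal_sum idI) => j _; apply: (idealZ idI); have [] := he j.
have [c [hc uc]] := eP v hv; exists (c *m invmx A); split=> [|c'].
  by rewrite sum_act mulmxKV.
by rewrite sum_act => /uc ->; rewrite mulmxK.
Qed.

End Frames.

Section ClosedSets.
Context {k : fieldType}.
Local Notation S := {mpoly k[4]}.
Local Notation closed := (@hilb_closed k 10 11).
Local Notation t := (gotzmann 10 11).
Local Notation N := (grass_rank 10 11).
Local Notation n := #|frame_index t N|.

(** Multiply the equations of the two sets. *)
Lemma hilb_closedU Z1 Z2 : closed Z1 -> closed Z2 -> closed (fun I => Z1 I \/ Z2 I).
Proof.
move=> [F1 h1] [F2 h2]; exists (fun f => exists f1 f2, [/\ F1 f1, F2 f2 & f = f1 * f2]).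
move=> I e hI he; rewrite (h1 I e hI he) (h2 I e hI he); split.
  by case=> h f [f1 [f2 [hf1 hf2 ->]]]; rewrite mevalM;
    [rewrite (h _ hf1) mul0r | rewrite (h _ hf2) mulr0].
move=> h; apply: contrapT => /not_orP [/existsNP [f1 /not_implyP [hf1 n1]]].
move=> /existsNP [f2 /not_implyP [hf2 n2]].
have /eqP : (f1 * f2).@[frame_coords e] = 0 by apply: h; exists f1, f2.
by rewrite mevalM mulf_eq0 => /orP [] /eqP.
Qed.

Lemma frame_coordsE (e : 'I_N -> S) i m :
  frame_coords e (enum_rank (i, m) : 'I_n) = (e i)@_(bmnm m).
Proof. by rewrite /frame_coords enum_rankK. Qed.

(** A polynomial in the frame entries defines a closed set once it is required to vanish
    on all frames, which is to say on a GL_N-orbit. *)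
Lemma frame_zeros_closed (G : {mpoly k[n]}) :
  closed (fun I => forall e : 'I_N -> S, frame I t e -> G.@[frame_coords e] = 0).
Proof.
exists (fun f => exists2 A : 'M[k]_N, A \in unitmx &
  forall e : 'I_N -> S, f.@[frame_coords e] = G.@[frame_coords (act A e)]).
move=> I e [idI _ _ _] he; split=> [h f [A uA ->]|h e' he'].
  exact/h/frame_act.
have [A uA hA] := frame_change idI he he'.
have -> : e' = act A e by apply/funext.
pose sub (j : 'I_n) : {mpoly k[n]} :=
  \sum_l A (enum_val j).1 l *: 'X_(enum_rank (l, (enum_val j).2)).
have ex : forall g : {mpoly k[n]}, exists f : {mpoly k[n]}, forall e : 'I_N -> S,
    f.@[frame_coords e] = g.@[frame_coords (act A e)].
  elim/mpoly_ring_ind => [c|j|p q [f hf] [f' hf']|p q [f hf] [f' hf']].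
  - by exists c%:MP => e0; rewrite !mevalC.
  - exists (sub j) => e0; rewrite mevalXU /frame_coords /act !raddf_sum /=.
    by apply: eq_bigr => l _; rewrite mevalZ mevalXU mcoeffZ enum_rankK.
  - by exists (f + f') => e0; rewrite !mevalD hf hf'.
  - by exists (f * f') => e0; rewrite !mevalM hf hf'.
have [f hf] := ex G; rewrite -hf; apply: h; by exists A.
Qed.

End ClosedSets.

(** * The determinantal locus *)

Section DeterminantalLocus.
Context {k : fieldType}.
Local Notation S := {mpoly k[4]}.
Local Notation t := (gotzmann 10 11).
Local Notation N := (grass_rank 10 11).
Local Notation closed := (@hilb_closed k 10 11).
Local Notation n := #|{: 'I_4 * 'I_4 * 'I_5}|.
Implicit Types (T : tensor k) (v : 'I_n -> k).

Definition tens v : tensor k := fun a b c => v (enum_rank (a, b, c)).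

Lemma tens_onto T : exists v, tens v = T.
Proof.
exists (fun i => let: (a, b, c) := enum_val i in T a b c).
by apply/funext => a; apply/funext => b; apply/funext => c; rewrite /tens enum_rankK.
Qed.

Lemma polyfun_tens a b c : polyfun (fun v => tens v a b c).
Proof. exact: polyfun_coord. Qed.

(** The action on tensors of a change of the variables x. *)
Definition tact (A : 'M[k]_4) T : tensor k := fun a b c => \sum_j A j a * T j b c.

Lemma lsub_quartic A T c : lsub A (quartic T c) = quartic (tact A T) c.
Proof.
rewrite !quarticE -minors_map; congr (minors _ c); apply/matrixP=> b d.
rewrite !mxE (rmorph_sum (lsub A)) /=.
under eq_bigr do rewrite rmorphM /= lsubX lsubC mulr_suml.
rewrite exchange_big; apply: eq_bigr => j _ /=.
rewrite /constT /tact (raddf_sum (@mpolyC _ _)) mulr_sumr.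
by apply: eq_bigr => i _; rewrite /= mpolyCM -mul_mpolyC; ring.
Qed.

(** Some line of P^3 misses the zero set of the quartics. *)
Definition gen_line T := exists2 A, A \in unitmx & line_free 4 (fun c => lsub A (quartic T c)).

Definition det_locus : ideal k -> Prop := fun I => exists2 T, gen_line T & I = ideal_gen (quartic T).

Lemma Nmx_homog T b c : Nmx (constT T) (fun a => 'X_a) b c \is 1.-homog.
Proof. by apply: dhomog_Nmx => a; rewrite dhomogX /= mdeg1. Qed.

Lemma gen_line_primitive T : gen_line T -> primitive (quartic T).
Proof.
move=> [A uA lf]; apply: (primitive_lsub uA); apply: line_free_primitive lf => c.
exact/dhomog_lsub/dhomog_quartic.
Qed.

Lemma det_locus_Hilb I : det_locus I -> Hilb 10 11 I.
Proof.
move=> [T /gen_line_primitive pF ->]; rewrite quarticE in pF *.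
exact: (minors_Hilb (@Nmx_homog T)).
Qed.

Lemma det_locus_dim T : gen_line T ->
  \dim (piece (ideal_gen_ideal (quartic T)) t) = N.
Proof.
move=> /gen_line_primitive; rewrite quarticE => pF.
suff H u : \dim (piece (ideal_gen_ideal (minors (Nmx (constT T) (fun a => 'X_a)))) (u + 5)) =
    ('C(u + 5 + 3, 3) - (10 * (u + 5) + 1 - 11))%N by apply: (H 30).
have := dim_minors (@Nmx_homog T) pF u.
rewrite -[(u + 5 + 3)%N]addnA !addnS !addn0 !binS !bin0 !bin1.
by move: (\dim _) 'C(u, 3) 'C(u, 2) => D b3 b2; lia.
Qed.

Lemma gotzmannE : t = (31 + 4)%N. Proof. by []. Qed.

(** The determinantal locus is parametrised by tensors, and to lie in it outside a
    closed set is an open condition on the tensor: a frame at one tensor extends to a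
    polynomial family of frames. *)
Lemma det_locus_open Z v1 : closed Z -> gen_line (tens v1) ->
  ~ Z (ideal_gen (quartic (tens v1))) -> exists q, [/\ polyfun q, q v1 != 0 &
  forall v, q v != 0 -> gen_line (tens v) /\ ~ Z (ideal_gen (quartic (tens v)))].
Proof.
move=> [F hF] gl nZ; have W1 : det_locus (ideal_gen (quartic (tens v1))) by exists (tens v1).
have idI v := ideal_gen_ideal (quartic (tens v)).
have [e he] := frame_exists (det_locus_dim gl).
have [f [Ff f0]] : exists f, F f /\ f.@[frame_coords e] != 0.
  apply: contrapT => H; apply: nZ; apply/(hF _ e (det_locus_Hilb W1) he) => f Ff.
  by apply/eqP/negP => /negP f0; apply: H; exists f.
have /choice [w hw] : forall i, exists w : 'I_5 -> S, (forall c, w c \is 31.-homog) /\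
    e i = \sum_c w c * quartic (tens v1) c.
  move=> i; have [h1 h2] := he.1 i; apply: (ideal_gen_forms (@dhomog_quartic _ _) _ h2).
  by rewrite -gotzmannE.
pose E i v := \sum_c w i c * quartic (tens v) c.
have E1 : (fun i => E i v1) = e by apply/funext => i; rewrite (hw i).2.
have pE i : polyfam (E i).
  by apply: polyfam_sum => c; apply/polyfam_mulC/polyfam_quartic => a b d; apply: polyfun_tens.
have [A uA lf] := gl.
have [q1 [pq1 q1n q1P]] : exists q, [/\ polyfun q, q v1 != 0 & forall v, q v != 0 ->
    line_free 4 (fun c => lsub A (quartic (tens v) c))].
  apply: line_free_open => // [c|c v]; last exact/dhomog_lsub/dhomog_quartic.
  under [in X in polyfam X]eq_fun do rewrite lsub_quartic.
  apply: polyfam_quartic => a b d; apply: polyfun_sum => j.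
  by apply: polyfunM; [apply: polyfun_const | apply: polyfun_tens].
have [|q2 [pq2 q2n q2P]] := free_open pE (v1 := v1).
  by move=> c hc; apply: (frame_free (idI v1) he); rewrite -E1.
pose q3 v := f.@[fun j => (E (enum_val j).1 v)@_(bmnm (enum_val j).2)].
exists (fun v => q1 v * (q2 v * q3 v)); split.
- apply: polyfunM => //; apply: polyfunM => //; apply: polyfun_meval => j.
  exact: polyfam_coef.
- rewrite !mulf_neq0 // /q3; have -> : (fun j : 'I_#|frame_index t N| =>
    (E (enum_val j).1 v1)@_(bmnm (enum_val j).2)) = frame_coords e.
    by rewrite -E1.
  exact: f0.
move=> v; rewrite !mulf_eq0 !negb_or => /and3P [/q1P l1 /q2P l2 q3n].
have gl' : gen_line (tens v) by exists A.
have W' : det_locus (ideal_gen (quartic (tens v))) by exists (tens v).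
have hE : frame (ideal_gen (quartic (tens v))) t (fun i => E i v).
  apply: (frame_of_free _ l2 (det_locus_dim gl')) => i.
  split; last by exists (w i).
  rewrite gotzmannE; apply: rpred_sum => c _; apply: dhomogM; first exact: (hw i).1.
  exact: dhomog_quartic.
split=> // /(hF _ _ (det_locus_Hilb W') hE) /(_ f Ff) e0.
by case/eqP: q3n; rewrite -[RHS]e0.
Qed.

End DeterminantalLocus.

Section Component.
Context {k : fieldType} (k_char0 : [pchar k] =i pred0).
Local Notation closed := (@hilb_closed k 10 11).

Lemma polyfun_common n (q1 q2 : ('I_n -> k) -> k) v1 v2 : polyfun q1 -> polyfun q2 ->
  q1 v1 != 0 -> q2 v2 != 0 -> exists v, q1 v != 0 /\ q2 v != 0.
Proof.
move=> [f1 h1] [f2 h2]; rewrite h1 h2 => n1 n2.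
have [|v] := mpoly_nonroot k_char0 (p := f1 * f2).
  apply: mulf_neq0; first by apply: contraNneq n1 => ->; rewrite meval0.
  by apply: contraNneq n2 => ->; rewrite meval0.
by rewrite mevalM mulf_eq0 negb_or => /andP [a b]; exists v; rewrite h1 h2.
Qed.

(** Two nonempty open subsets of the space of tensors meet. *)
Lemma det_locus_irreducible Z1 Z2 : closed Z1 -> closed Z2 ->
  (forall I : ideal k, det_locus I -> Z1 I \/ Z2 I) ->
  (forall I : ideal k, det_locus I -> Z1 I) \/ (forall I : ideal k, det_locus I -> Z2 I).
Proof.
move=> c1 c2 H; apply: contrapT => /not_orP [].
move=> /existsNP [_ /not_implyP [[T1 g1 ->] n1]] /existsNP [_ /not_implyP [[T2 g2 ->] n2]].
have [v1 e1] := tens_onto T1; have [v2 e2] := tens_onto T2.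
rewrite -e1 -e2 in g1 n1 g2 n2.
have [q1 [p1 q1n P1]] := det_locus_open c1 g1 n1.
have [q2 [p2 q2n P2]] := det_locus_open c2 g2 n2.
have [v [/P1 [gv nv1] /P2 [_ nv2]]] := polyfun_common p1 p2 q1n q2n.
by have [] := H (ideal_gen (quartic (tens v))); first by exists (tens v).
Qed.

Lemma curve_ideal_of (I : ideal k) : Hilb 10 11 I -> smooth_irreducible_ACM I -> curve_ideal I.
Proof. by move=> [idI hI _ [t0 hP]] [pI _ aI]; split=> //; exists t0. Qed.

Lemma curve_det_locus (I : ideal k) : Hilb 10 11 I -> smooth_irreducible_ACM I -> det_locus I.
Proof.
move=> hI sI; have [T [A [uA lf ->]]] := curve_determinantal k_char0 (curve_ideal_of hI sI).
by exists T => //; exists A.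
Qed.

(** A component whose general member is arithmetically Cohen-Macaulay is the closure of
    the determinantal locus, which is irreducible. *)
Lemma det_locus_component (H : ideal k -> Prop) : hilb_component 10 11 H ->
  general_in 10 11 H smooth_irreducible_ACM -> forall I, det_locus I -> H I.
Proof.
move=> [[HH _ irrH] maxH] [Z0 [cZ0 [I0 [HI0 nI0]] gZ0]].
pose H' I := Hilb 10 11 I /\ forall Z, closed Z -> (forall J, det_locus J -> Z J) -> Z I.
suff : forall I, H' I -> H I.
  by move=> h I hI; apply: h; split=> [|Z _]; [apply: det_locus_Hilb | apply].
have HH' I : H I -> H' I.
  move=> HI; split; [exact: HH | move=> Z cZ WZ].
  have [|h|h] := irrH Z0 Z cZ0 cZ; last exact: h.
    move=> J HJ; have [|nJ] := pselect (Z0 J); [by left | right].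
    by apply: WZ; apply: curve_det_locus; [apply: HH | apply: gZ0].
  by case: nI0; apply: h.
apply: maxH => //; split; first by move=> I [].
  by exists I0; apply: HH'.
move=> Z1 Z2 c1 c2 h12; have [I hI|h|h] := det_locus_irreducible c1 c2.
- by apply: h12; split=> [|Z _]; [apply: det_locus_Hilb | apply].
- by left=> I [_]; apply.
- by right=> I [_]; apply.
Qed.

End Component.

(** * Explicit tensors *)

Section Examples.
Context {k : fieldType}.
Local Notation S := {mpoly k[4]}.

Lemma meval_quartic (T : tensor k) x c : (quartic T c).@[x] = minors (Nmx T x) c.
Proof.
rewrite quarticE -minors_map; congr (minors _ c); apply/matrixP=> i j.
rewrite !mxE (raddf_sum (meval x)); apply: eq_bigr => a _.
by rewrite /= mevalM mevalXU mevalC.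
Qed.

Lemma meval_adjM (T : tensor k) x a b :
  (adjM T a b).@[x] = \adj (Mmx T (fun c => (quartic T c).@[x])) a b.
Proof.
transitivity (map_mx (meval x) (adjM T) a b); first by rewrite [RHS]mxE.
rewrite adjME map_mx_adj; congr (\adj _ a b); apply/matrixP=> i j.
rewrite !mxE (raddf_sum (meval x)); apply: eq_bigr => c _.
by rewrite /= mevalM mevalC.
Qed.

(** On the line x_2 = x_3 = 0 the matrix N(x) has rows x_1 e_b - x_0 e_(b+1). *)
Definition bidiag (T : tensor k) : Prop := forall b c,
  T i0 b c = - (c == lift ord0 b)%:R /\ T i1 b c = (c == widen_ord (leqnSn 4) b)%:R.

Lemma bidiag_line T : bidiag T -> forall c, lsub line (quartic T c) = binary c.
Proof.
move=> hT c; pose A : 'M[S]_(4, 5) := \matrix_(b, c) ('X_i1 * (c == widen_ord (leqnSn 4) b)%:R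
   - 'X_i0 * (c == lift ord0 b)%:R).
have lA b d : lsub line (A b d) = 'X_i1 * (d == widen_ord (leqnSn 4) b)%:R
   - 'X_i0 * (d == lift ord0 b)%:R.
  by rewrite mxE rmorphB !rmorphM /= !lineX /= !rmorph_nat.
have -> : lsub line (quartic T c) = lsub line (minors A c).
  rewrite quarticE -!minors_map; congr (minors _ c); apply/matrixP=> b d.
  transitivity (lsub line (A b d)); last by rewrite [RHS]mxE.
  rewrite lA !mxE (rmorph_sum (lsub line)) 3!big_ord_recl big_ord1 /=.
  rewrite !rmorphM /= !lineX !lsubC /= /constT.
  have -> : lift ord0 (lift ord0 (lift ord0 ord0)) = i3 :> 'I_4 by apply: val_inj.
  have -> : lift ord0 (lift ord0 ord0) = i2 :> 'I_4 by apply: val_inj.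
  have -> : lift ord0 ord0 = i1 :> 'I_4 by apply: val_inj.
  have [-> ->] := hT b d.
  by rewrite /= mpolyCN !mpolyC_nat; ring.
apply: (@syzygies_minors _ (fun c => mk 4 (binary c))) => // [d|b].
  by rewrite mkK ?binary_line ?binary_homog.
have one d : \sum_c (c == d)%:R * (binary c : S) = binary d.
  by rewrite (bigD1 d) //= eqxx mul1r big1 ?addr0 // => e /negPf ->; rewrite mul0r.
under eq_bigr do rewrite mkK ?binary_homog // mxE mulrBl -!mulrA.
rewrite sumrB -!mulr_sumr !one /binary lift0 /=.
have b3 : (b <= 3)%N by rewrite -ltnS.
by rewrite subSS (subSn b3) !exprS; ring.
Qed.

Lemma bidiag_line_free T : bidiag T -> line_free 4 (quartic T).
Proof. by move=> /bidiag_line; apply: line_free_binary. Qed.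

(** For this symmetric tensor N(1, 0, 0, 0) is the identity with a zero column, so that g
    maps (1, 0, 0, 0) to itself and F does not vanish there. *)
Lemma symmetric_example : exists T : tensor k,
  (quartic (tr T) ord_max).@[fun b => (adjM T i0 b).@[fun i => (i == i0)%:R]] != 0.
Proof.
pose w := widen_ord (leqnSn 4).
pose T : tensor k := fun a b c =>
  if a == i0 then (c == w b)%:R else if b == i0 then (c == w a)%:R
  else ((c == ord_max) && (a == b))%:R.
exists T.
have id_minor (A : 'M[k]_(4, 5)) : (forall b c, A b c = (c == w b)%:R) ->
    forall c, minors A c = (c == ord_max)%:R.
  move=> hA c; case: (unliftP ord_max c) => [j ->|->].
    have : \sum_c A j c * minors A c = 0 by apply: minors_null.
    rewrite (bigD1 (w j)) //= hA eqxx mul1r big1 ?addr0 => [|i /negPf ne].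
      have -> : lift ord_max j = w j.
        by apply: val_inj; rewrite /= /bump leqNgt ltn_ord.
      by move=> ->; rewrite -val_eqE /= ltn_eqF.
    by rewrite hA ne mul0r.
  have e : col' ord_max A = 1%:M.
    apply/matrixP=> i j; rewrite !mxE hA -val_eqE /= /bump leqNgt ltn_ord add0n.
    by rewrite eq_sym.
  by rewrite eqxx minorsE e det1 /=; ring.
have F b : (quartic T b).@[fun i => (i == i0)%:R] = (b == ord_max)%:R.
  rewrite meval_quartic; apply: id_minor => a c; rewrite mxE (bigD1 i0) //= mul1r.
  by rewrite big1 ?addr0 // => i /negPf ->; rewrite mul0r.
set M := Mmx T (fun c => (quartic T c).@[fun i => (i == i0)%:R]).
have ME b a : M b a = ((a == b) && (a != i0))%:R.
  rewrite mxE (bigD1 ord_max) //= F eqxx mul1r big1 ?addr0 => [|c /negPf ne]; last first.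
    by rewrite F ne mul0r.
  have wm (d : 'I_4) : (ord_max == w d) = false by rewrite -val_eqE /= gtn_eqF.
  rewrite /T !wm; have [->|a0] /= := eqVneq a i0; first by rewrite andbF.
  by rewrite andbT; case: eqVneq => [->|_] //; rewrite (negPf a0).
have Z b : (adjM T i0 b).@[fun i => (i == i0)%:R] = (b == i0)%:R.
  rewrite meval_adjM -/M; have [->|b0] := eqVneq b i0.
    rewrite mxE /cofactor (_ : row' _ _ = 1%:M) ?det1 ?mulr1 //.
    by apply/matrixP=> i j; rewrite 2![LHS]mxE [RHS]mxE ME (inj_eq lift_inj) eq_sym andbT.
  transitivity ((\adj M *m M) i0 b); last by rewrite mul_adj_mx mxE eq_sym (negPf b0).
  rewrite [RHS]mxE (bigD1 b) // big1 => [|i ne]; last by rewrite ME eq_sym (negPf ne) mulr0.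
  by rewrite ME eqxx b0 mulr1 Monoid.mulm1.
have -> : (fun b => (adjM T i0 b).@[fun i => (i == i0)%:R]) = (fun b => (b == i0)%:R).
  by apply/funext.
rewrite meval_quartic id_minor ?eqxx ?oner_neq0 // => b c.
rewrite mxE (bigD1 i0) //= mul1r big1 ?addr0 => [|i /negPf ->]; last by rewrite mul0r.
by rewrite /tr /T /=; case: eqVneq => [->|].
Qed.

Lemma det3 (K : comNzRingType) (A : 'M[K]_3) (f : nat -> nat -> K) :
  (forall i j, A i j = f i j) -> \det A =
  f 0 0 * (f 1 1 * f 2 2 - f 1 2 * f 2 1) - f 0 1 * (f 1 0 * f 2 2 - f 1 2 * f 2 0)
  + f 0 2 * (f 1 0 * f 2 1 - f 1 1 * f 2 0).
Proof.
move=> hA; rewrite (expand_det_row _ 0) !big_ord_recl big_ord0 /cofactor.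
rewrite !(expand_det_row _ 0) !big_ord_recl !big_ord0 /cofactor !det_mx11 !mxE !hA /=.
by rewrite /bump /=; ring.
Qed.

(** On the line, with coordinates p = x_0 and q = x_1, the first row of the adjugate is p g_b
    with g_0 = p^4 q (p^6 - q^6), g_1 = p^5 (2 q^6 - p^6), g_2 = 2 q^5 (q^6 - p^6) and
    g_3 = p q^4 (p^6 - 2 q^6).  The ideal of these binary forms contains p^17 and 2 q^17. *)
Lemma adjugate_example : 2%:R != 0 :> k ->
  exists T : tensor k, line_free 12 (fun ab => adjM T ab.1 ab.2).
Proof.
move=> two; pose dl (j : nat) (c : 'I_5) : k := (c == j :> nat)%:R.
pose T : tensor k := fun a b c => match val a, val b with
  | 0, j => - dl j.+1 c | 1, j => dl j c | 2, 0 => 2%:R * dl 4 c | 2, 2 => dl 0 c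
  | 3, 1 => dl 4 c | 3, 3 => dl 0 c | _, _ => 0 end.
pose p : S := 'X_i0; pose q : S := 'X_i1; pose y j : S := p ^+ (4 - j) * q ^+ j.
pose m (b a : nat) : S := match a, b with
  | 0, j => - y j.+1 | 1, j => y j | 2, 0 => 2%:R * y 4 | 2, 2 => y 0
  | 3, 1 => y 4 | 3, 3 => y 0 | _, _ => 0 end.
exists T; have hT : bidiag T.
  by move=> b c; split.
pose M := Mmx (constT T) (@binary k).
have sumE x j : (j < 5)%N -> \sum_c binary c * (x * dl j c)%:MP = x%:MP * y j :> S.
  move=> j5; rewrite (bigD1 (Ordinal j5)) //= big1 => [|c ne].
    by rewrite addr0 /dl eqxx mulr1 mulrC.
  by rewrite /dl; case: eqVneq => [e|_]; [case/eqP: ne; apply: val_inj | rewrite mulr0 mulr0].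
have sum1 j : (j < 5)%N -> \sum_c binary c * (dl j c)%:MP = y j :> S.
  by move=> j5; rewrite -[RHS]mul1r -(sumE 1) //; apply: eq_bigr => c _; rewrite mul1r.
have ME b a : M b a = m b a.
  rewrite mxE /constT /T; have b4 := ltn_ord b.
  case: a => [[|[|[|[|//]]]] pa] /=.
  - under eq_bigr do rewrite -mulN1r.
    by rewrite sumE // mpolyCN mulN1r.
  - by rewrite sum1 // ltnW.
  - case: b b4 => [[|[|[|[|//]]]] pb] /= _.
    + by rewrite sumE // mpolyC_nat.
    + by rewrite big1 // => c _; rewrite mulr0.
    + by rewrite sum1.
    + by rewrite big1 // => c _; rewrite mulr0.
  - case: b b4 => [[|[|[|[|//]]]] pb] /= _.
    + by rewrite big1 // => c _; rewrite mulr0.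
    + by rewrite sum1.
    + by rewrite big1 // => c _; rewrite mulr0.
    + by rewrite sum1.
have adjE a b : lsub line (adjM T a b) = \adj M a b.
  rewrite [LHS]subst_adjM; congr (\adj _ a b); apply/matrixP=> i j; rewrite !mxE.
  by apply: eq_bigr => c _; rewrite -(bidiag_line hT).
have row0 b : lsub line (adjM T i0 b) = (-1) ^+ b * \det (row' b (col' i0 M)).
  by rewrite adjE mxE /cofactor addn0.
have minorE (b : 'I_4) (i j : 'I_3) : (row' b (col' i0 M)) i j = m (bump b i) j.+1.
  by rewrite 2![LHS]mxE ME.
have minorD b := @det3 _ (row' b (col' i0 M)) (fun i j => m (bump b i) j.+1) (minorE b).
have R0 : lsub line (adjM T i0 i0) = p ^+ 11 * q - p ^+ 5 * q ^+ 7.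
  by rewrite row0 minorD /bump /m /y /=; ring.
have R1 : lsub line (adjM T i0 i1) = 2%:R * p ^+ 6 * q ^+ 6 - p ^+ 12.
  by rewrite row0 minorD /bump /m /y /=; ring.
have R2 : lsub line (adjM T i0 i2) = p * (2%:R * q ^+ 11 - 2%:R * p ^+ 6 * q ^+ 5).
  by rewrite row0 minorD /bump /m /y /=; ring.
have R3 : lsub line (adjM T i0 i3) = p * (p ^+ 7 * q ^+ 4 - 2%:R * p * q ^+ 10).
  by rewrite row0 minorD /bump /m /y /=; ring.
have [g [_ eg]] := gform_exists T.
have qrow b (w : S) : lsub line (adjM T i0 b) = p * w -> lsub line (adjM T i1 b) = q * w.
  rewrite !eg !rmorphM /= !lineX /= => /(mulfI (mpolyX_neq0 i0)) ->; by [].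
(* The combinations that give p^18 and q^18, found by elimination in the ideal of the g_b. *)
pose a (ab : 'I_4 * 'I_4) : S := if ab == (i0, i0) then 4%:R * p * q ^+ 5
  else if ab == (i0, i1) then 2%:R * q ^+ 6 - p ^+ 6 else 0.
pose b (ab : 'I_4 * 'I_4) : S := if ab == (i1, i2) then (2%:R^-1)%:MP * (q ^+ 6 - p ^+ 6)
  else if ab == (i1, i3) then - (p ^+ 5 * q) else 0.
have pairs (u v : 'I_4 * 'I_4) (x z : S) : u != v -> \sum_ab
    (if ab == u then x else if ab == v then z else 0) * adjM T ab.1 ab.2 =
    x * adjM T u.1 u.2 + z * adjM T v.1 v.2.
  move=> uv; rewrite (bigD1 u) // (bigD1 v) /=; last by rewrite eq_sym.
  rewrite !eqxx (eq_sym v) (negPf uv).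
  by rewrite big1 ?addr0 // => w /andP [/negPf -> /negPf ->]; rewrite mul0r.
have hp n : (p ^+ n : S) \is n.-homog by apply: homogXn.
have hq n : (q ^+ n : S) \is n.-homog by apply: homogXn.
have hpq i j : (p ^+ i * q ^+ j : S) \is (i + j).-homog by apply: dhomogM.
have hC (c : k) (w : S) : w \is 6.-homog -> c%:MP * w \is 6.-homog.
  by move=> hw; rewrite mul_mpolyC; apply: dhomogZ.
have hN (j : nat) (w : S) : w \is 6.-homog -> j%:R * w \is 6.-homog.
  by move=> hw; rewrite -mpolyC_nat; apply: hC.
exists 6%N, a, b; split=> [ab|ab||].
- rewrite /a; case: eqP => _; [|case: eqP => _; last exact: rpred0].
    by rewrite -mulrA; apply/hN/(hpq 1).
  by apply: rpredB; [apply/hN/hq | apply: hp].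
- rewrite /b; case: eqP => _; [|case: eqP => _; last exact: rpred0].
    by apply/hC/rpredB; [apply: hq | apply: hp].
  by rewrite rpredN; apply: (hpq 5 1).
- rewrite pairs //= (rmorphD (lsub line)) !(rmorphM (lsub line)) /= R0 R1.
  rewrite (rmorphB (lsub line)) !(rmorphXn (lsub line), rmorphM (lsub line)).
  by rewrite !(rmorph_nat (lsub line)) /= !lineX /= -/p -/q; ring.
- rewrite pairs //= (rmorphD (lsub line)) !(rmorphM (lsub line)) /=.
  rewrite (qrow _ _ R2) (qrow _ _ R3) (rmorphB (lsub line)) (rmorphN (lsub line)).
  rewrite !(rmorphXn (lsub line), rmorphM (lsub line)) /= lsubC !lineX /= -/p -/q.
  have h2 : (2%:R^-1)%:MP * 2%:R = 1 :> S by rewrite -mpolyC_nat -mpolyCM mulVf.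
  transitivity (((2%:R^-1)%:MP * 2%:R) * (q ^+ 6 - p ^+ 6) * q * (q ^+ 11 - p ^+ 6 * q ^+ 5)
    - p ^+ 5 * q * (q * (p ^+ 7 * q ^+ 4 - 2%:R * p * q ^+ 10))); first by ring.
  by rewrite h2; ring.
Qed.

End Examples.

(** * The general tensor is good *)

Section GenericTensors.
Context {k : fieldType} (k_char0 : [pchar k] =i pred0).
Local Notation S := {mpoly k[4]}.
Local Notation n := #|{: 'I_4 * 'I_4 * 'I_5}|.

Lemma meval_subst (q : 'I_4 -> S) x p : (subst q p).@[x] = p.@[fun i => (q i).@[x]].
Proof.
elim/mpoly_ring_ind: p => [c|i|p r hp hr|p r hp hr].
- by rewrite substC !mevalC.
- by rewrite substX mevalXU.
- by rewrite rmorphD /= !mevalD hp hr.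
- by rewrite rmorphM /= !mevalM hp hr.
Qed.

Lemma polyfam_meval m (P : ('I_m -> k) -> S) (x : 'I_4 -> ('I_m -> k) -> k) :
  polyfam P -> (forall i, polyfun (x i)) -> polyfun (fun v => (P v).@[fun i => x i v]).
Proof.
move=> [Q hQ] px; under [in X in polyfun X]eq_fun do rewrite hQ.
elim/mpoly_ring_ind: Q {hQ} => [c|i|p r hp hr|p r hp hr].
- by exists c => v; rewrite map_mpolyC mevalC.
- by under [in X in polyfun X]eq_fun do rewrite map_mpolyX mevalXU; apply: px.
- by under [in X in polyfun X]eq_fun do rewrite rmorphD mevalD; apply: polyfunD.
- by under [in X in polyfun X]eq_fun do rewrite rmorphM mevalM; apply: polyfunM.
Qed.

Definition generically (P : tensor k -> Prop) : Prop := exists phi : ('I_n -> k) -> k,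
  [/\ polyfun phi, exists v, phi v != 0 & forall v, phi v != 0 -> P (tens v)].

Lemma generically_and P Q : generically P -> generically Q ->
  generically (fun T => P T /\ Q T).
Proof.
move=> [f [pf [v1 f1] hP]] [g [pg [v2 g2] hQ]].
have [v [fv gv]] := polyfun_common k_char0 pf pg f1 g2.
exists (fun v => f v * g v); split; first exact: polyfunM.
  by exists v; rewrite mulf_neq0.
by move=> w; rewrite mulf_eq0 negb_or => /andP [/hP ? /hQ ?].
Qed.

Lemma generically_imp P Q : (forall T, P T -> Q T) -> generically P -> generically Q.
Proof. by move=> PQ [f [pf ef hP]]; exists f; split=> // v /hP /PQ. Qed.

Lemma generically_tr P : generically P -> generically (fun T => P (tr T)).
Proof.
pose w v : 'I_n -> k := fun i => let: (a, b, c) := enum_val i in tens v b a c.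
have wE v : tens (w v) = tr (tens v).
  by apply/funext => a; apply/funext => b; apply/funext => c; rewrite {1}/tens /w enum_rankK.
have ww v : w (w v) = v.
  apply/funext => i; rewrite /w; case ei: (enum_val i) => [[a b] c].
  by rewrite /tens enum_rankK /tens -ei enum_valK.
move=> [f [[F pF] [v0 fv0] hP]]; exists (fun v => f (w v)); split.
- under [in X in polyfun X]eq_fun do rewrite pF.
  apply: polyfun_meval => i; rewrite /w; case: (enum_val i) => [[a b] c].
  exact: polyfun_tens.
- by exists (w v0); rewrite ww.
- by move=> v /hP; rewrite wE.
Qed.

Lemma generic_line : generically (fun T => line_free 4 (quartic T)).
Proof.
pose T : tensor k := fun a b c => if a == i0 then - (c == lift ord0 b)%:R
  else (c == widen_ord (leqnSn 4) b)%:R.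
have [v1 e1] := tens_onto T.
have := @line_free_open k n _ 4 (fun c v => quartic (tens v) c) v1.
case=> [c|c v||phi [pphi n1 hphi]].
- by apply: polyfam_quartic => *; apply: polyfun_tens.
- exact: dhomog_quartic.
- by rewrite e1; apply: bidiag_line_free.
by exists phi; split=> //; exists v1.
Qed.

Lemma generic_adjugate : generically (fun T => line_free 12 (fun ab => adjM T ab.1 ab.2)).
Proof.
have two : 2%:R != 0 :> k.
  by apply: contraTneq isT => /(@natr_inj_char0 k k_char0 2 0).
have [T lT] := adjugate_example two; have [v1 e1] := tens_onto T.
have := @line_free_open k n _ 12 (fun (ab : 'I_4 * 'I_4) v => adjM (tens v) ab.1 ab.2) v1.
case=> [c|c v||phi [pphi n1 hphi]].
- by apply: polyfam_adjM => *; apply: polyfun_tens.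
- exact: dhomog_adjM.
- by rewrite e1.
by exists phi; split=> //; exists v1.
Qed.

Lemma generic_birational : generically (fun T =>
  (quartic (tr T) ord_max).@[fun b => (adjM T i0 b).@[fun i => (i == i0)%:R]] != 0).
Proof.
have [T hT] := @symmetric_example k; have [v1 e1] := tens_onto T.
exists (fun v => (quartic (tr (tens v)) ord_max).@[fun b => (adjM (tens v) i0 b).@[fun i => (i == i0)%:R]]).
split=> //; last by exists v1; rewrite e1.
apply: (@polyfam_meval _ (fun v => quartic (tr (tens v)) ord_max)
  (fun b v => (adjM (tens v) i0 b).@[fun i => (i == i0)%:R])).
  by apply: polyfam_quartic => *; apply: polyfun_tens.
move=> b; apply: (@polyfam_meval _ (fun v => adjM (tens v) i0 b) (fun i v => (i == i0)%:R)).
  by apply: polyfam_adjM => *; apply: polyfun_tens.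
by move=> i; apply: polyfun_const.
Qed.

Lemma generic_good : generically good.
Proof.
have := generically_and (generically_and generic_line (generically_tr generic_line))
  (generically_and (generically_tr generic_adjugate) generic_birational).
apply: generically_imp => T [[l1 l2] [l3 ev]]; split=> //.
- exact: line_free_primitive (@dhomog_quartic _ T) l1.
- exact: line_free_primitive (@dhomog_quartic _ (tr T)) l2.
have [g gT] := gform_exists T; exists g; split=> //; exists ord_max.
apply: contraNneq ev => e; apply/eqP.
have := congr1 (meval (fun i => (i == i0)%:R)) e; rewrite meval_subst meval0 => <-.
congr (meval _ _); apply/funext => b.
by rewrite gT.2 mevalM mevalXU eqxx mul1r.
Qed.

End GenericTensors.

(** * Linear syzygies *)

Section LinearAlgebra.
Context {k : fieldType}.
Local Notation S := {mpoly k[4]}.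

Lemma polyfam_scale n (phi : ('I_n -> k) -> k) (p : S) :
  polyfun phi -> polyfam (fun u => phi u *: p).
Proof.
move=> [f hf]; exists (f *: map_mpoly (@mpolyC n k) p) => v.
rewrite hf -[in RHS]mul_mpolyC rmorphM /= map_mpolyC -[LHS]mul_mpolyC; congr (_ * _).
by apply/mpolyP => m; rewrite !mcoeff_map_mpoly [RHS]mevalC.
Qed.

Lemma const_homog_eq0 (p : S) : p \is 0.-homog -> forall d (A : 'I_4 -> S) (q : 'I_4 -> S),
  (forall b, A b \is d.+1.-homog) -> p = \sum_b q b * A b -> p = 0.
Proof.
move=> hp d A q hA e; rewrite -(pihomog_dE hp) e raddf_sum /= big1 // => b _.
exact: (pihomogMr_lt _ (hA b)).
Qed.

(** A relation with constant coefficients is a syzygy of degree 0, whereas by Hilbert-Burch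
    the syzygies are generated in degree 1. *)
Lemma quartic_free T (x : 'I_5 -> k) : gen_line T ->
  \sum_c x c *: quartic T c = 0 -> forall c, x c = 0.
Proof.
move=> /gen_line_primitive; rewrite quarticE => pF e c.
have [|q hq] := @hilbert_burch _ _ _ (fun c => (x c)%:MP) pF.
  by rewrite -[RHS]e; apply: eq_bigr => d _; rewrite mul_mpolyC.
have := const_homog_eq0 _ (fun b => Nmx_homog T b c) (hq c).
rewrite -alg_mpolyC dhomogZ ?dhomog1 // => /(_ isT) /eqP.
by rewrite alg_mpolyC mpolyC_eq0 => /eqP.
Qed.

(** The slices b of T are the linear syzygies sum T_abc x_a F_c = 0; as vectors of scalars
    indexed by the pairs (a, c) they are the rows of this matrix. *)
Definition flat (T : tensor k) : 'M[k]_(4, #|{: 'I_4 * 'I_5}|) :=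
  \matrix_(b, j) T (enum_val j).1 b (enum_val j).2.

Definition unflat (U : 'M[k]_(4, #|{: 'I_4 * 'I_5}|)) : tensor k :=
  fun a b c => U b (enum_rank (a, c)).

Lemma flatK T : unflat (flat T) = T.
Proof.
by apply/funext => a; apply/funext => b; apply/funext => c; rewrite /unflat mxE enum_rankK.
Qed.

Lemma unflatK U : flat (unflat U) = U.
Proof.
by apply/matrixP => b j; rewrite mxE /unflat -surjective_pairing enum_valK.
Qed.

Lemma row_free_flat T : gen_line T -> row_free (flat T).
Proof.
move=> /gen_line_primitive; rewrite quarticE => pF; have [c0 F0] := primitive_neq0 ord0 pF.
rewrite -kermx_eq0; apply/eqP/row_matrixP => i; rewrite row0.
set x := row i _; have xT : x *m flat T = 0 by rewrite -row_mul mulmx_ker row0.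
have xE a c : \sum_b x 0 b * T a b c = 0.
  have /rowP/(_ (enum_rank (a, c))) := xT; rewrite !mxE => e; rewrite -[RHS]e.
  by apply: eq_bigr => b _; rewrite [flat _ _ _]mxE enum_rankK.
apply/rowP => b; rewrite [RHS]mxE.
have := rows_independent (A := Nmx (constT T) (fun a => 'X_a))
  (q := fun b => (x 0 b)%:MP) F0 _ b.
move=> H; apply/eqP; rewrite -(mpolyC_eq0 4) H // => c.
under eq_bigr do rewrite [Nmx _ _ _ _]mxE mulr_sumr.
rewrite exchange_big big1 // => a _ /=.
transitivity ('X_a * (\sum_b x 0 b * T a b c)%:MP : S); last by rewrite xE mpolyC0 mulr0.
rewrite (raddf_sum (@mpolyC _ _)) mulr_sumr; apply: eq_bigr => d _.
by rewrite /= mpolyCM /constT; ring.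
Qed.

Definition linear_syz (F : 'I_5 -> S) (l : 'rV[k]_#|{: 'I_4 * 'I_5}|) : S :=
  \sum_j l 0 j *: ('X_((enum_val j).1) * F (enum_val j).2).

Lemma linear_syzE F l : linear_syz F l =
  \sum_c (\sum_a l 0 (enum_rank (a, c)) *: 'X_a) * F c.
Proof.
transitivity (\sum_a \sum_c l 0 (enum_rank (a, c)) *: ('X_a * F c)).
  rewrite pair_bigA (reindex (fun j : 'I_#|{: 'I_4 * 'I_5}| => enum_val j)) /=; last first.
    by exists enum_rank => ? _; rewrite ?enum_valK ?enum_rankK.
  apply: eq_bigr => j _; congr (l 0 _ *: _); rewrite -[LHS]enum_valK.
  by congr enum_rank; case: (enum_val j).
rewrite exchange_big; apply: eq_bigr => c _; rewrite mulr_suml.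
by apply: eq_bigr => a _; rewrite scalerAl.
Qed.

Lemma linear_syz_row F T b : linear_syz F (row b (flat T)) =
  \sum_c Nmx (constT T) (fun a => 'X_a) b c * F c.
Proof.
rewrite linear_syzE; apply: eq_bigr => c _; congr (_ * _); rewrite mxE.
by apply: eq_bigr => a _; rewrite !mxE enum_rankK -mul_mpolyC mulrC.
Qed.

(** Hilbert-Burch in degree one. *)
Lemma linear_syz_sub T l : gen_line T -> linear_syz (quartic T) l = 0 -> (l <= flat T)%MS.
Proof.
move=> /gen_line_primitive; rewrite linear_syzE quarticE => pF /(hilbert_burch pF) [q hq].
have /choice [x hx] : forall b, exists x, pihomog mdeg 0 (q b) = x%:MP.
  by move=> b; apply/dhomog_constP/pihomogP.
apply/submxP; exists (\row_b x b); apply/rowP => j; rewrite mxE.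
case ej : (enum_val j) => [a c]; have ej' : j = enum_rank (a, c) by rewrite -ej enum_valK.
have hl : \sum_a l 0 (enum_rank (a, c)) *: 'X_a \is 1.-homog.
  by apply: rpred_sum => i _; apply: rpredZ; rewrite dhomogX /= mdeg1.
have := congr1 (mcoeff U_(a)) (pihomog_dE hl).
rewrite {1}hq (raddf_sum (pihomog mdeg 1)) !(raddf_sum (mcoeff U_(a))) /=.
have one (f : 'I_4 -> k) : \sum_i (f i *: 'X_i)@_U_(a) = f a.
  rewrite (bigD1 a) //= mcoeffZ mcoeffXU eqxx mulr1 big1 ?addr0 // => i /negPf ne.
  by rewrite mcoeffZ mcoeffXU ne mulr0.
rewrite one -ej' => <-.
apply: eq_bigr => b _.
rewrite (@pihomogMr _ _ _ _ 0 1) ?Nmx_homog // hx mcoeffCM !mxE ej /=; congr (_ * _).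
rewrite (raddf_sum (mcoeff U_(a))) /= -[RHS](one (fun a => T a b c)).
by apply: eq_bigr => i _; rewrite -mul_mpolyC mulrC.
Qed.

Lemma ideal_gen_sub (J J' : finType) (F : J -> S) (G : J' -> S) :
  (forall c, ideal_gen G (F c)) -> forall p, ideal_gen F p -> ideal_gen G p.
Proof.
move=> h p [r ->]; apply: (ideal_sum (ideal_gen_ideal G)) => c _.
exact: (idealMl (ideal_gen_ideal G)).
Qed.

End LinearAlgebra.

(** * From a frame back to the tensor *)

Section Recover.
Context {k : fieldType}.
Local Notation S := {mpoly k[4]}.
Local Notation t := (gotzmann 10 11).
Local Notation N := (grass_rank 10 11).
Local Notation m := #|frame_index t N|.
Local Notation pt := ('I_m -> k).
Local Notation mons := 'X_{1..4 < t.+1}.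
Implicit Types (T : tensor k) (e : 'I_N -> S) (I : ideal k).

Definition entry (u : pt) (i : 'I_N) (mo : 'X_{1..4}) : k :=
  if insub mo is Some b then u (enum_rank (i, b : mons)) else 0.

Lemma entryE I e i mo : frame I t e -> entry (frame_coords e) i mo = (e i)@_mo.
Proof.
move=> he; rewrite /entry; case: insubP => [b _ <-|]; first by rewrite frame_coordsE.
move=> big; have [/dhomogP h _] := he.1 i.
apply/esym/memN_msupp_eq0/negP => /h /= e'; move: big; rewrite e'.
by rewrite ltnSn.
Qed.

Lemma polyfun_entry i mo : polyfun (fun u => entry u i mo).
Proof. by rewrite /entry; case: insub => [b|]; [apply: polyfun_coord | apply: polyfun_const]. Qed.

(** The coefficients of the frame at the monomials not divisible by x_0^31: the left kernel
    consists of the combinations divisible by x_0^31, and high divides by that power. *)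
Definition low (u : pt) : 'M[k]_(N, #|{: mons}|) := \matrix_(i, j)
  if (bmnm (enum_val j) i0 < 31)%N then entry u i (bmnm (enum_val j)) else 0.

Definition high (u : pt) (U : 'rV[k]_N) : S :=
  \sum_(b : 'X_{1..4 < 5}) (\sum_i U 0 i * entry u i (U_(i0) *+ 31 + bmnm b)%MM) *: 'X_[bmnm b].

Lemma mcoeff_Xn_low j (q : S) (mo : 'X_{1..4}) : (mo i0 < j)%N -> ('X_i0 ^+ j * q)@_mo = 0.
Proof.
move=> lt; rewrite {1}[q]mpolyE mulr_sumr raddf_sum /= big1 // => m' _.
rewrite -scalerAr mcoeffZ mpolyXn -mpolyXD mcoeffX; case: eqP => [e|]; rewrite ?mulr0 //.
by move: lt; rewrite -e mnmDE mulmnE mnm1E eqxx mul1n ltnNge leq_addr.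
Qed.

Lemma low_ker I e (l : 'rV[k]_N) : frame I t e -> l *m low (frame_coords e) = 0 <->
  exists q, q \is 4.-homog /\ \sum_i l 0 i *: e i = 'X_i0 ^+ 31 * q.
Proof.
move=> he; set p := \sum_i _.
have hp : p \is t.-homog by apply: rpred_sum => i _; apply: rpredZ; have [] := he.1 i.
have lE j : (l *m low (frame_coords e)) 0 j =
    if (bmnm (enum_val j) i0 < 31)%N then p@_(bmnm (enum_val j)) else 0.
  rewrite mxE; case: ltnP => h; last first.
    by apply: big1 => i _; rewrite mxE ltnNge h mulr0.
  rewrite raddf_sum; apply: eq_bigr => i _.
  by rewrite /= mcoeffZ mxE h (entryE _ _ he).
split=> [l0|[q [hq pq]]]; last first.
  apply/rowP => j; rewrite lE mxE; case: ifP => // h.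
  by rewrite pq mcoeff_Xn_low.
have plow mo : mo \in msupp p -> (31 <= mo i0)%N.
  move=> sp; rewrite leqNgt; apply/negP => h.
  have md : (mdeg mo < t.+1)%N by have /dhomogP/(_ mo sp) /= -> := hp.
  have /rowP/(_ (enum_rank (BMultinom md))) := l0.
  rewrite lE enum_rankK /= h mxE => p0.
  by move: sp; rewrite mcoeff_msupp p0 eqxx.
pose q : S := \sum_(mo <- msupp p) p@_mo *: 'X_[mo - U_(i0) *+ 31].
have pq : p = 'X_i0 ^+ 31 * q.
  rewrite {1}[p]mpolyE mulr_sumr big_seq [RHS]big_seq; apply: eq_bigr => mo /plow h.
  rewrite -scalerAr mpolyXn -mpolyXD addmC submK //.
  apply/mnm_lepP => i; rewrite mulmnE mnm1E eq_sym.
  by case: eqP => [->|_]; rewrite ?mul1n ?mul0n.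
exists q; split=> //; rewrite mulrC in pq.
apply: (@dhomog_factor _ _ _ _ 4 31) (homogXn i0 31) _.
  by rewrite expf_neq0 ?mpolyX_neq0.
by rewrite -pq.
Qed.

Lemma highE I e (l : 'rV[k]_N) q : frame I t e -> q \is 4.-homog ->
  \sum_i l 0 i *: e i = 'X_i0 ^+ 31 * q -> high (frame_coords e) l = q.
Proof.
move=> he hq pq; rewrite [RHS](mpoly_sum_bound (homog_msize_le hq)).
apply: eq_bigr => b _; congr (_ *: _).
have <- : ('X_i0 ^+ 31 * q)@_(U_(i0) *+ 31 + bmnm b)%MM = q@_(bmnm b).
  by rewrite mpolyXn mulrC mcoeffMX.
rewrite -pq raddf_sum /=.
by apply: eq_bigr => i _; rewrite mcoeffZ (entryE _ _ he).
Qed.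

(** The multiples x_0^31 F_c are in the span of the frame, since 35 = 31 + 4. *)
Lemma quartics_frame T e : frame (ideal_gen (quartic T)) t e -> gen_line T ->
  exists V : 'M[k]_(5, N), row_free V /\
    forall c, \sum_i row c V 0 i *: e i = 'X_i0 ^+ 31 * quartic T c.
Proof.
move=> he gl; have /choice [v hv] : forall c, exists v : 'rV[k]_N,
    'X_i0 ^+ 31 * quartic T c = \sum_i v 0 i *: e i.
  move=> c; apply: (frame_span he).
    by rewrite gotzmannE; apply: dhomogM; [apply: homogXn | apply: dhomog_quartic].
  by apply: (idealMl (ideal_gen_ideal _)); apply: ideal_gen_mem.
exists (\matrix_c v c); split=> [|c]; last by rewrite hv rowK.
rewrite -kermx_eq0; apply/eqP/row_matrixP => i; rewrite row0.
set x := row i _; have x0 : x *m (\matrix_c v c) = 0 by rewrite -row_mul mulmx_ker row0.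
apply/rowP => c; rewrite [RHS]mxE; apply: (quartic_free (x := fun c => x 0 c) gl).
apply: (mulfI (expf_neq0 31 (mpolyX_neq0 i0))); rewrite mulr0 mulr_sumr.
transitivity (\sum_i (x *m \matrix_c v c) 0 i *: e i); last first.
  by rewrite x0 big1 // => j _; rewrite mxE scale0r.
under eq_bigr do rewrite -scalerAr hv scaler_sumr.
rewrite exchange_big; apply: eq_bigr => j _; rewrite [(_ *m _) _ _]mxE scaler_suml.
by apply: eq_bigr => d _; rewrite [(\matrix_ _ _) _ _]mxE scalerA.
Qed.

(** The ideal is prime and contains no linear form, so if it contains x_0^31 q it
    contains q. *)
Lemma low_quartics T e (l : 'rV[k]_N) : frame (ideal_gen (quartic T)) t e ->
  prime_ideal (ideal_gen (quartic T)) -> l *m low (frame_coords e) = 0 ->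
  exists x : 'rV[k]_5, high (frame_coords e) l = \sum_d x 0 d *: quartic T d /\
    \sum_i l 0 i *: e i = 'X_i0 ^+ 31 * \sum_d x 0 d *: quartic T d.
Proof.
move=> he [I1 prI] /(low_ker _ he) [q [hq pq]]; rewrite (highE he hq pq) pq.
have Iq : ideal_gen (quartic T) q.
  have : ideal_gen (quartic T) ('X_i0 ^+ 31 * q).
    rewrite -pq; apply: (ideal_sum (ideal_gen_ideal _)) => i _.
    by apply: (idealZ (ideal_gen_ideal _)); have [] := he.1 i.
  elim: 31%N => [|j IH]; first by rewrite mul1r.
  rewrite exprS -mulrA => /prI [X0|//].
  have h1 : ('X_i0 : S) \is 1.-homog by rewrite dhomogX /= mdeg1.
  have /eqP := ideal_gen_lt (@dhomog_quartic _ T) h1 isT X0.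
  by rewrite (negPf (mpolyX_neq0 i0)).
have [r [hr qE]] := @ideal_gen_forms _ _ _ 4 0 q (@dhomog_quartic _ T) hq Iq.
have /choice [x hx] : forall c, exists x, r c = x%:MP by move=> c; apply: dhomog_constP.
suff -> : q = \sum_d (\row_c x c) 0 d *: quartic T d by exists (\row_c x c).
by rewrite qE; apply: eq_bigr => c _; rewrite hx mul_mpolyC mxE.
Qed.

Definition syz_mx (F : 'I_5 -> S) : 'M[k]_(#|{: 'I_4 * 'I_5}|, #|{: 'X_{1..4 < 6}}|) :=
  \matrix_(j, b) ('X_((enum_val j).1) * F (enum_val j).2)@_(bmnm (enum_val b)).

Lemma syz_ker (F : 'I_5 -> S) l : (forall c, F c \is 4.-homog) ->
  l *m syz_mx F = 0 <-> linear_syz F l = 0.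
Proof.
move=> hF; have lE b : (l *m syz_mx F) 0 b = (linear_syz F l)@_(bmnm (enum_val b)).
  rewrite mxE raddf_sum; apply: eq_bigr => j _.
  by rewrite /= mcoeffZ [syz_mx _ _ _]mxE.
split=> [l0|l0]; last by apply/rowP => b; rewrite lE l0 mcoeff0 mxE.
have h5 : linear_syz F l \is 5.-homog.
  apply: rpred_sum => j _; apply: rpredZ; apply: (@dhomogM _ _ _ 1 _ 4) => //.
  by rewrite dhomogX /= mdeg1.
rewrite [LHS](mpoly_sum_bound (homog_msize_le h5)) big1 // => b _.
by rewrite -[b]enum_rankK -lE l0 mxE scale0r.
Qed.

(** The tensor, hence the determinantal presentation, depends polynomially on a frame in
    high degree.  The forms in the span of the frame that are divisible by a power of
    x_0 give the quartics of the ideal because the ideal is prime, and their linear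
    syzygies give the matrix. *)
Theorem recover (n := #|{: 'I_4 * 'I_4 * 'I_5}|) (phi : ('I_n -> k) -> k) vs :
  polyfun phi -> phi vs != 0 -> (forall v, phi v != 0 -> primitive (quartic (tens v))) ->
  gen_line (tens vs) -> prime_ideal (ideal_gen (quartic (tens vs))) ->
  exists G : {mpoly k[m]},
    (exists2 e, frame (ideal_gen (quartic (tens vs))) t e & G.@[frame_coords e] != 0) /\
    forall T e, gen_line T -> prime_ideal (ideal_gen (quartic T)) ->
      frame (ideal_gen (quartic T)) t e -> G.@[frame_coords e] != 0 ->
      exists2 v, phi v != 0 & ideal_gen (quartic T) = ideal_gen (quartic (tens v)).
Proof.
move=> pphi phis phiP gs prs.
have [es hes] := frame_exists (det_locus_dim gs); set us : pt := frame_coords es.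
have [V1 [fV1 V1E]] := quartics_frame hes gs.
have V1_low : V1 *m low us = 0.
  apply/row_matrixP => c; rewrite row_mul row0; apply/(low_ker _ hes).
  by exists (quartic (tens vs) c); split; [apply: dhomog_quartic | apply: V1E].
have span_sub T e (V : 'M[k]_(5, N)) (l : 'rV[k]_N) (x : 'rV[k]_5) :
    frame (ideal_gen (quartic T)) t e ->
    (forall c, \sum_i row c V 0 i *: e i = 'X_i0 ^+ 31 * quartic T c) ->
    \sum_i l 0 i *: e i = 'X_i0 ^+ 31 * \sum_d x 0 d *: quartic T d -> l = x *m V.
  move=> he hV hl; apply/eqP; rewrite -subr_eq0; apply/eqP.
  apply: (frame_free (ideal_gen_ideal _) he).
  under eq_bigr do rewrite mxE [X in _ + X]mxE scalerBl.
  rewrite sumrB hl; apply/eqP; rewrite subr_eq0; apply/eqP.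
  under [RHS]eq_bigr do rewrite mxE scaler_suml.
  rewrite exchange_big mulr_sumr; apply: eq_bigr => d _; rewrite -scalerAr -hV scaler_sumr.
  by apply: eq_bigr => i _; rewrite scalerA mxE.
have [|l l0|phi1 [U [pphi1 phi1s pU U1 UP]]] := @kernel_family _ _ _ _ _ low us V1 _ fV1 V1_low.
- move=> i j; under [in X in polyfun X]eq_fun do rewrite mxE.
  by case: (_ < 31)%N; [apply: polyfun_entry | apply: polyfun_const].
- have [x [_ ex]] := low_quartics hes prs l0; apply/submxP; exists x.
  exact: span_sub hes V1E ex.
pose F u c := high u (row c (U u)).
have pF c : polyfam (F^~ c).
  apply: polyfam_sum => b; apply: polyfam_scale; apply: polyfun_sum => i.
  apply: polyfunM; last exact: polyfun_entry.
  by under [in X in polyfun X]eq_fun do rewrite mxE.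
have Fs c : F us c = quartic (tens vs) c.
  by rewrite /F U1; apply: (highE hes); [apply: dhomog_quartic | apply: V1E].
have syz_s b : linear_syz (F us) (row b (flat (tens vs))) = 0.
  by rewrite linear_syz_row; under eq_bigr do rewrite Fs; apply: quartic_syz.
have Fs' : F us = quartic (tens vs) by apply/funext.
have [||l l0|phi2 [W [pphi2 phi2s pW W1 WP]]] := @kernel_family _ _ _ _ _
  (fun u => syz_mx (F u)) us (flat (tens vs)) _ (row_free_flat gs).
- move=> i j; under [in X in polyfun X]eq_fun do rewrite mxE.
  exact/polyfam_coef/polyfam_mulC.
- apply/row_matrixP => b; rewrite row_mul row0; apply/syz_ker => //.
  by move=> c; rewrite Fs; apply: dhomog_quartic.
- apply: linear_syz_sub gs _; rewrite -Fs'; apply/syz_ker => //.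
  by move=> c; rewrite Fs; apply: dhomog_quartic.
pose tv u : 'I_n -> k := fun j => let: (a, b, c) := enum_val j in unflat (W u) a b c.
have tvE u : tens (tv u) = unflat (W u).
  by apply/funext => a; apply/funext => b; apply/funext => c; rewrite /tens /tv enum_rankK.
(* The equation is the product of the two determinants and of the condition phi. *)
have [G hG] : polyfun (fun u => phi1 u * (phi2 u * phi (tv u))).
  apply: polyfunM => //; apply: polyfunM => //; case: pphi => f hf.
  under [in X in polyfun X]eq_fun do rewrite hf.
  apply: polyfun_meval => j; rewrite /tv; case: (enum_val j) => [[a b] c].
  exact: pW.
exists G; split.
  exists es => //; rewrite -hG !mulf_neq0 //.
  have -> : tv us = vs; last by [].
  apply/funext => j; rewrite /tv W1; case ej : (enum_val j) => [[a b] c].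
  by rewrite flatK /tens -ej enum_valK.
move=> T e gT prT he; rewrite -hG !mulf_eq0 !negb_or => /and3P [n1 n2 n3].
set u := frame_coords e in n1 n2 n3.
have [V [fV VE]] := quartics_frame he gT.
have [|Ulow fU] := UP u n1 V fV.
  apply/row_matrixP => c; rewrite row_mul row0; apply/(low_ker _ he).
  by exists (quartic T c); split; [apply: dhomog_quartic | apply: VE].
have /choice [g hg] : forall c, exists x : 'rV[k]_5, F u c = \sum_d x 0 d *: quartic T d /\
    \sum_i row c (U u) 0 i *: e i = 'X_i0 ^+ 31 * \sum_d x 0 d *: quartic T d.
  by move=> c; apply: (low_quartics he prT); rewrite -row_mul Ulow row0.
pose A : 'M[k]_5 := \matrix_c g c.
have FE c : F u c = \sum_d A c d *: quartic T d.
  by rewrite (hg c).1; apply: eq_bigr => d _; rewrite mxE.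
have UA : U u = A *m V.
  by apply/row_matrixP => c; rewrite row_mul rowK; apply: (span_sub _ _ _ _ _ he VE (hg c).2).
have uA : A \in unitmx.
  by rewrite -row_free_unit /row_free -(mxrankMfree A fV) -UA; apply: fU.
(* The forms read off from the frame are another basis of the quartics in the ideal. *)
have QE d : quartic T d = \sum_c invmx A d c *: F u c.
  under eq_bigr do rewrite FE scaler_sumr.
  rewrite exchange_big; transitivity (\sum_j (invmx A *m A) d j *: quartic T j).
    rewrite mulVmx // (bigD1 d) //= mxE eqxx scale1r big1 ?addr0 // => j /negPf ne.
    by rewrite mxE eq_sym ne scale0r.
  apply: eq_bigr => j _; rewrite mxE scaler_suml.
  by apply: eq_bigr => c _; rewrite scalerA.
have hF c : F u c \is 4.-homog.
  by rewrite FE; apply: rpred_sum => d _; apply/rpredZ/dhomog_quartic.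
(* T in that basis: the linear syzygies of the F u c are independent, so the second kernel
   has not shrunk either. *)
pose T' : tensor k := fun a b c => \sum_d T a b d * invmx A d c.
have flatT' (x : 'rV[k]_4) a c : (x *m flat T') 0 (enum_rank (a, c)) =
    \sum_d (x *m flat T) 0 (enum_rank (a, d)) * invmx A d c.
  rewrite mxE; under eq_bigr do rewrite [flat _ _ _]mxE enum_rankK /T' mulr_sumr.
  rewrite exchange_big; apply: eq_bigr => d _; rewrite mxE mulr_suml.
  by apply: eq_bigr => b _; rewrite [flat _ _ _]mxE enum_rankK mulrA.
have fT' : row_free (flat T').
  rewrite -kermx_eq0; apply/eqP/row_matrixP => i; rewrite row0.
  set x := row i _; have x0 : x *m flat T' = 0 by rewrite -row_mul mulmx_ker row0.
  apply: (row_free_inj (row_free_flat gT)); rewrite mul0mx; apply/rowP => j.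
  rewrite [RHS]mxE -[j]enum_valK; case: (enum_val j) => a d.
  pose y : 'rV_5 := \row_d (x *m flat T) 0 (enum_rank (a, d)).
  suff /rowP/(_ d) : y = 0 by rewrite !mxE.
  apply: (can_inj (mulmxKV uA)); rewrite mul0mx; apply/rowP => c.
  transitivity ((x *m flat T') 0 (enum_rank (a, c))); last by rewrite x0 !mxE.
  by rewrite flatT' mxE; apply: eq_bigr => e' _; rewrite mxE.
have [|synF fW] := WP u n2 (flat T') fT'.
  apply/row_matrixP => b; rewrite row_mul row0; apply/syz_ker => //.
  rewrite linear_syz_row -[RHS](quartic_syz T b); under [RHS]eq_bigr do rewrite QE mulr_sumr.
  rewrite [RHS]exchange_big.
apply: eq_bigr => c _ /=.
  under [RHS]eq_bigr do rewrite -scalerAr -mul_mpolyC mulrA.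
  rewrite -mulr_suml; congr (_ * _); rewrite mxE.
  under eq_bigr do rewrite /constT /T' (raddf_sum (@mpolyC _ _)) mulr_sumr /=.
  rewrite exchange_big; apply: eq_bigr => d _; rewrite mxE mulr_sumr.
  by apply: eq_bigr => a _; rewrite mpolyCM /constT; ring.
have syzF b : \sum_c Nmx (constT (tens (tv u))) (fun a => 'X_a) b c * F u c = 0.
  by rewrite -linear_syz_row; apply/syz_ker => //; rewrite tvE unflatK -row_mul synF row0.
exists (tv u) => //; have pQ := phiP _ n3.
have [h hE] : exists h, forall c, F u c = h * quartic (tens (tv u)) c.
  by apply: pQ => i j; rewrite quarticE mulrC (kernel_minors (y := F u) j i syzF) mulrC.
have [c0 Q0] := primitive_neq0 ord0 pQ.
have [l lE] : exists l, h = l%:MP.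
  apply: dhomog_constP; apply: (dhomog_factor Q0 (@dhomog_quartic _ _ _)).
  by rewrite -hE; apply: hF.
apply/funext => p; apply/propext; split; apply: ideal_gen_sub => c.
  rewrite QE; apply: (ideal_sum (ideal_gen_ideal _)) => d _.
  apply: (idealZ (ideal_gen_ideal _)); rewrite hE.
  by apply: (idealMl (ideal_gen_ideal _)); apply: ideal_gen_mem.
have l0 : l != 0.
  apply/eqP => l0; have [d] := primitive_neq0 ord0 (gen_line_primitive gT).
  by rewrite QE big1 ?eqxx // => i _; rewrite hE lE l0 mpolyC0 mul0r scaler0.
have -> : quartic (tens (tv u)) c = l^-1 *: F u c.
  by rewrite hE lE mul_mpolyC scalerA mulVf ?scale1r.
apply: (idealZ (ideal_gen_ideal _)); rewrite FE.
apply: (ideal_sum (ideal_gen_ideal _)) => d _; apply: (idealZ (ideal_gen_ideal _)).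
exact: ideal_gen_mem.
Qed.

End Recover.

(** * The general curve *)

(** Intersect the open set where the curve is smooth, irreducible and arithmetically
    Cohen-Macaulay with the one where the tensor recovered from the ideal is good.  They
    meet because both conditions hold for the general tensor. *)
Lemma general_good (k : fieldType) (k_char0 : [pchar k] =i pred0) (H : ideal k -> Prop) :
  hilb_component 10 11 H -> general_in 10 11 H smooth_irreducible_ACM ->
  general_in 10 11 H (fun C => exists2 T, good T & C = ideal_gen (quartic T)).
Proof.
move=> cH gH; have WH := det_locus_component k_char0 cH gH.
have HHilb I : H I -> Hilb 10 11 I by case: cH => [[h _ _] _]; apply: h.
case: gH => Z0 [cZ0 [I0 [HI0 nI0]] gZ0].
have inW I : H I -> ~ Z0 I -> det_locus I.
  by move=> HI nI; apply: (curve_det_locus k_char0); [apply: HHilb | apply: gZ0].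
have [T0 g0 e0] := inW _ HI0 nI0; have [v0 ev0] := tens_onto T0.
rewrite e0 -ev0 in g0 nI0; have [q [pq q0 qP]] := det_locus_open cZ0 g0 nI0.
have [phi [pphi [v1 phi1] phiP]] := generic_good k_char0.
have [vs [/qP [gs ns] phis]] := polyfun_common k_char0 pq pphi q0 phi1.
have Hs : H (ideal_gen (quartic (tens vs))) by apply: WH; exists (tens vs).
have [prs _ _] := gZ0 _ Hs ns.
have [|G [[e he Ge] GP]] := recover pphi phis _ gs prs; first by move=> v /phiP [].
exists (fun I => Z0 I \/ forall e, frame I (gotzmann 10 11) e -> G.@[frame_coords e] = 0).
split.
- by apply: hilb_closedU => //; apply: frame_zeros_closed.
- exists (ideal_gen (quartic (tens vs))); split=> // -[//|/(_ e he) Ge0].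
  by move: Ge; rewrite Ge0 eqxx.
move=> I HI /not_orP [nI /existsNP [eI /not_implyP [heI /eqP GI]]].
have [T gT eT] := inW _ HI nI; have [pI _ _] := gZ0 _ HI nI.
rewrite eT in pI heI; have [v /phiP gv ev] := GP T eI gT pI heI GI.
by exists (tens v) => //; rewrite eT.
Qed.

Theorem proposition3p13 (k : closedFieldType) (k_char0 : [pchar k] =i pred0)
    (R : realFieldType) (H : ideal k -> Prop)
    (H_component : hilb_component 10 11 H)
    (H_general : general_in 10 11 H smooth_irreducible_ACM) :
  let D : divisor_class := clH *+ 40 - clE *+ 11 in
  general_in 10 11 H (fun C =>
    [/\ effective C D, rigid C D,
        spans_extremal_ray (Eff R C) (real_class R D)
      & forall v : 'rV[R]_2,
          Eff R C v <-> cone2 (real_class R D) (real_class R clE) v]).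
Proof.
have [Z [cZ neZ gZ]] := general_good k_char0 H_component H_general.
exists Z; split=> // C HC nC; have [T gT ->] := gZ C HC nC.
exact: good_conclusion gT.
Qed.
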